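(* Let $-A$ be the generator of a $C_0$-semigroup $(e^{-tA})_{t\ge 0}$ on a complex Banach space $X$, and let $\overline{\mathrm{ran}}(A)=X$. Assume that $$M:=\sup_{t\ge 0}\|e^{-tA}\|<\infty .$$ If $f\in\mathcal{S}_2$, then for any $x\in X$ one has $\Delta_{n,t}(A)x\in\mathrm{dom}(f(A))$ and $$\|f(A)\Delta_{n,t}(A)x\|\le 12\,M\,\|x\|\,f(\sqrt{n}/t),\qquad n\in\mathbb N,\ t>0,$$ and for any $x=f(A)y$ with $y\in\mathrm{dom}(f(A))$, $$\|\Delta_{n,t}(A)x\|\le 12\,M\,\|y\|\,f(\sqrt{n}/t),\qquad n\in\mathbb N,\ t>0.$$ In particular, (taking $f(z)=z^{-\alpha}$) for every $\alpha\in(0,2]$ and every $x\in\mathrm{dom}(A^\alpha)$, $$\|\Delta_{n,t}(A)x\|\le 12\,M\,\|A^\alpha x\|\left(\frac{t}{\sqrt n}\right)^{\alpha},\qquad n\in\mathbb N,\ t>0.$$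
   Context: $\mathbb C_+=\{z\in\mathbb C:\mathrm{Re}\,z>0\}$, $\mathbb R_+=[0,\infty)$; $\mathrm{dom}$ and $\mathrm{ran}$ denote domain and range, and $\overline{\mathrm{ran}}(A)$ is the norm-closure of the range of $A$. Products of operators have their natural domains. For $n\in\mathbb N$, $t>0$: $\Delta_{n,t}(A):=\left(1+\frac tn A\right)^{-n}-e^{-tA}$. Generalized Stieltjes functions: a function $f:(0,\infty)\to[0,\infty)$ belongs to $\mathcal S_\alpha$ ($\alpha>0$) if $f(z)=a+\int_0^\infty\frac{\mu(d\tau)}{(z+\tau)^\alpha}$ for $z>0$, where $a\ge 0$ and $\mu$ is a positive Radon measure on $[0,\infty)$ with $\int_0^\infty\frac{\mu(d\tau)}{(1+\tau)^\alpha}<\infty$. Such an $f$ is identified with its unique analytic extension to $\mathbb C\setminus(-\infty,0]$. Functional calculus: $M(\mathbb R_+)$ is the Banach algebra of bounded (complex) Radon measures on $\mathbb R_+$, $(\mathcal L\mu)(z)=\int_0^\infty e^{-sz}\mu(ds)$ for $z\in\mathbb C_+$, and $A^1_+(\mathbb C_+)=\{\mathcal L\mu:\mu\in M(\mathbb R_+)\}$. For $-A$ generating a bounded $C_0$-semigroup and $g=\mathcal L\mu\in A^1_+(\mathbb C_+)$, $g(A)x:=\int_0^\infty e^{-sA}x\,\mu(ds)$ for $x\in X$. If $f:\mathbb C_+\to\mathbb C$ is holomorphic and there is $e\in A^1_+(\mathbb C_+)$ (a regularizer) with $ef\in A^1_+(\mathbb C_+)$ and $e(A)$ injective, then $f(A):=e(A)^{-1}(ef)(A)$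 with $\mathrm{dom}(f(A))=\{x\in X:(ef)(A)x\in\mathrm{ran}(e(A))\}$; this does not depend on the choice of $e$ (extended Hille–Phillips calculus). For $\overline{\mathrm{ran}}(A)=X$ every $f\in\mathcal S_2$ is regularizable by $e(z)=z^2/(1+z)^2$. The operator $A^\alpha$ is obtained by applying this calculus to $z^\alpha$ (principal branch). *)

(* Defs.v *)
From HB Require Import structures.
From mathcomp Require Import all_boot all_order all_algebra.
From mathcomp Require Import complex.
From mathcomp Require Import all_classical all_reals all_analysis.
Import numFieldNormedType.Exports.
Set Implicit Arguments.
Unset Strict Implicit.
Unset Printing Implicit Defensive.
Import Order.TTheory GRing.Theory Num.Theory.
Local Open Scope classical_set_scope.
Local Open Scope ring_scope.
Local Open Scope complex_scope.

(* The norm of a normed module over R[i] takes its values in R[i], on the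
   nonnegative real axis; rnorm is the same norm as an element of R. *)
Definition rnorm (R : realType) (V : normedModType R[i]) (v : V) : R :=
  complex.Re `|v|.

(* Unbounded operators are represented by their graphs:
   A x y means that x is in the domain of A and A x = y. *)
Definition operator (X : Type) := X -> X -> Prop.

Definition op_dom (X : Type) (A : operator X) : set X :=
  [set x | exists y, A x y].

Definition op_ran (X : Type) (A : operator X) : set X :=
  [set y | exists x, A x y].

Definition op_fun (X : Type) (f : X -> X) : operator X := fun x y => y = f x.

Definition op_inv (X : Type) (A : operator X) : operator X := fun x y => A y x.

Definition op_comp (X : Type) (B A : operator X) : operator X :=
  fun x z => exists2 y, A x y & B y z.

Definition op_pow (X : Type) (A : operator X) (n : nat) : operator X :=
  iter n (op_comp A) (op_fun id).

Definition op_add (X : zmodType) (A B : operator X) : operator X :=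
  fun x y => exists u v, [/\ A x u, B x v & y = u + v].

Definition op_opp (X : zmodType) (A : operator X) : operator X :=
  fun x y => A x (- y).

Definition op_scale (K : pzRingType) (X : lmodType K) (c : K)
    (A : operator X) : operator X :=
  fun x y => exists2 u, A x u & y = c *: u.

(* Only the values T t with t >= 0 matter. *)
Record C0_semigroup (R : realType) (X : normedModType R[i])
    (T : R -> {linear X -> X}) : Prop := {
  C0_bounded : forall t : R, 0 <= t -> continuous (T t);
  C0_zero : forall x, T 0 x = x;
  C0_add : forall (s t : R) (x : X), 0 <= s -> 0 <= t -> T (s + t) x = T s (T t x);
  C0_strong : forall x, T t x @[t --> 0^'+] --> x }.

Definition generator (R : realType) (X : normedModType R[i])
    (T : R -> {linear X -> X}) : operator X :=
  fun x y => (t^-1)%:C *: (T t x - x) @[t --> 0^'+] --> y.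

Definition opnorm (R : realType) (X : normedModType R[i]) (L : X -> X)
    : \bar R :=
  ereal_sup [set (rnorm (L x))%:E | x in [set x | rnorm x <= 1]].

Definition semigroup_sup (R : realType) (X : normedModType R[i])
    (T : R -> {linear X -> X}) : \bar R :=
  ereal_sup [set opnorm (T t) | t in [set t : R | 0 <= t]].

(* (1 + (t/n) A)^-n - e^(-tA), where -A generates T *)
Definition Delta (R : realType) (X : normedModType R[i])
    (T : R -> {linear X -> X}) (A : operator X) (n : nat) (t : R)
    : operator X :=
  op_add
    (op_pow (op_inv (op_add (op_fun id) (op_scale (t / n%:R)%:C A))) n)
    (op_opp (op_fun (T t))).

Definition Rplus (R : realType) : set R := [set s | 0 <= s].

Definition Cplus (R : realType) : set R[i] := [set z | 0 < complex.Re z].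

Definition slit_plane (R : realType) : set R[i] :=
  [set z | ~ (complex.Im z = 0 /\ complex.Re z <= 0)].

Definition holomorphic_on (R : realType) (U : set R[i]) (f : R[i] -> R[i]) :=
  forall z, U z -> derivable (f : R[i]^o -> R[i]^o) z 1.

(* local expansion in convergent power series *)
Definition analytic_on (R : realType) (U : set R[i]) (f : R[i] -> R[i]) :=
  forall z0, U z0 -> exists (c : nat -> R[i]) (r : R), 0 < r /\
    forall z : R[i], `|z - z0| < r%:C ->
      series (fun k => c k * (z - z0) ^+ k) @ \oo --> (f z : R[i]^o).

(* Measures on [0, +oo) are represented by Borel measures on R, of which only
   the restriction to [0, +oo) is used.  The integrability condition makes this
   restriction finite on compact sets, i.e. a Radon measure. *)
Definition stieltjes (R : realType) (alpha : R) (f : R -> R) : Prop :=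
  exists (a : R) (mu : {measure set (measurableTypeR R) -> \bar R}),
    [/\ 0 <= a,
        (\int[mu]_(tau in @Rplus R) ((1 + tau) `^ (- alpha))%:E < +oo)%E
      & forall z : R, 0 < z ->
        (f z)%:E =
        (a%:E + \int[mu]_(tau in @Rplus R) ((z + tau) `^ (- alpha))%:E)%E].

Definition analytic_extension (R : realType) (f : R -> R) (F : R[i] -> R[i]) :=
  analytic_on (@slit_plane R) F /\ forall z : R, 0 < z -> F z%:C = (f z)%:C.

Definition cexp (R : realType) (z : R[i]) : R[i] :=
  (expR (complex.Re z))%:C
  * (cos (complex.Im z) +i* sin (complex.Im z)).

(* The principal logarithm, for z in Cplus only (where the principal argument
   is the arctangent below). *)
Definition clog (R : realType) (z : R[i]) : R[i] :=
  ln (complex.Re `|z|) +i* atan (complex.Im z / complex.Re z).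

Definition cpow (R : realType) (alpha : R) (z : R[i]) : R[i] :=
  cexp (alpha%:C * clog z).

(* A complex measure is given by its real and imaginary parts, which are finite
   signed measures; as above only the restriction to [0, +oo) is used.  A finite
   Borel measure on [0, +oo) is automatically Radon. *)
Record cmeasure (R : realType) := CMeasure {
  cm_re : {charge set (measurableTypeR R) -> \bar R};
  cm_im : {charge set (measurableTypeR R) -> \bar R} }.

(* The Jordan decomposition; it does not depend on the Hahn decomposition
   selected here. *)
Definition pos_part (R : realType)
    (nu : {charge set (measurableTypeR R) -> \bar R})
    : {finite_measure set (measurableTypeR R) -> \bar R} :=
  jordan_pos (svalP (cid (svalP (cid (Hahn_decomposition nu))))).

Definition neg_part (R : realType)
    (nu : {charge set (measurableTypeR R) -> \bar R})
    : {finite_measure set (measurableTypeR R) -> \bar R} :=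
  jordan_neg (svalP (cid (svalP (cid (Hahn_decomposition nu))))).

Definition cintegral (R : realType)
    (mu : {finite_measure set (measurableTypeR R) -> \bar R})
    (h : R -> R[i]) : R[i] :=
  (\int[mu]_(s in @Rplus R) complex.Re (h s))
  +i* (\int[mu]_(s in @Rplus R) complex.Im (h s)).

Definition charge_cintegral (R : realType)
    (nu : {charge set (measurableTypeR R) -> \bar R}) (h : R -> R[i]) : R[i] :=
  cintegral (pos_part nu) h - cintegral (neg_part nu) h.

Definition laplace (R : realType) (mu : cmeasure R) (z : R[i]) : R[i] :=
  charge_cintegral (cm_re mu) (fun s => cexp (- (s%:C * z)))
  + (0 +i* 1) * charge_cintegral (cm_im mu) (fun s => cexp (- (s%:C * z))).

Definition simple_function (R : realType) (V : Type) (s : R -> V) : Prop :=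
  finite_set (range s) /\
  forall v, measurable (s @^-1` [set v] : set (measurableTypeR R)).

Definition simple_integral (R : realType) (V : normedModType R[i])
    (mu : {finite_measure set (measurableTypeR R) -> \bar R})
    (s : R -> V) : V :=
  \sum_(v \in range s)
    (fine (mu (@Rplus R `&` s @^-1` [set v])))%:C *: v.

(* y is the Bochner integral of h over [0, +oo) with respect to mu *)
Definition bochner_integral (R : realType) (V : normedModType R[i])
    (mu : {finite_measure set (measurableTypeR R) -> \bar R})
    (h : R -> V) (y : V) : Prop :=
  exists s : nat -> R -> V,
    [/\ forall k, simple_function (s k),
        {ae mu, forall r, Rplus r -> s k r @[k --> \oo] --> h r},
        (\int[mu]_(r in @Rplus R) (rnorm (h r - s k r))%:E @[k --> \oo]
           --> 0)%E
      & simple_integral mu (s k) @[k --> \oo] --> y].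

Definition charge_bochner (R : realType) (V : normedModType R[i])
    (nu : {charge set (measurableTypeR R) -> \bar R})
    (h : R -> V) (y : V) : Prop :=
  exists yp yn, [/\ bochner_integral (pos_part nu) h yp,
    bochner_integral (neg_part nu) h yn & y = yp - yn].

(* The operator g(A), for g the Laplace transform of mu and -A the generator
   of T. *)
Definition hille_phillips (R : realType) (X : normedModType R[i])
    (T : R -> {linear X -> X}) (mu : cmeasure R) : operator X :=
  fun x y => exists yr yi,
    [/\ charge_bochner (cm_re mu) (fun s => T s x) yr,
        charge_bochner (cm_im mu) (fun s => T s x) yi
      & y = yr + (0 +i* 1) *: yi].

(* The Laplace transform e of mu is a regularizer for f, and e f is the Laplace
   transform of nu. *)
Definition regularizes (R : realType) (X : normedModType R[i])
    (T : R -> {linear X -> X}) (f : R[i] -> R[i]) (mu nu : cmeasure R) : Prop :=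
  [/\ holomorphic_on (@Cplus R) f,
      forall z, Cplus z -> laplace nu z = laplace mu z * f z
    & forall x1 x2 y, hille_phillips T mu x1 y -> hille_phillips T mu x2 y ->
        x1 = x2].

(* f(A) = e(A)^-1 (e f)(A).  As the right-hand side does not depend on the
   regularizer e, the graph is given with any of them. *)
Definition functional_calculus (R : realType) (X : normedModType R[i])
    (T : R -> {linear X -> X}) (f : R[i] -> R[i]) : operator X :=
  fun x y => exists mu nu, regularizes T f mu nu /\
    op_comp (op_inv (hille_phillips T mu)) (hille_phillips T nu) x y.

(* Main.v *)
Require Import Defs.
From HB Require Import structures.
From mathcomp Require Import all_boot all_order all_algebra.
From mathcomp Require Import complex.
From mathcomp Require Import all_classical all_reals all_analysis.
From mathcomp Require Import measurable_realfun.
From mathcomp Require Import ring lra.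
Import numFieldNormedType.Exports.
Import Order.TTheory GRing.Theory Num.Theory.
Set Implicit Arguments.
Unset Strict Implicit.
Unset Printing Implicit Defensive.
Local Open Scope classical_set_scope.
Local Open Scope ring_scope.
Local Open Scope complex_scope.

(** The operator [f(A) Delta_(n,t)(A)] has the symbol [f(z) * delta(z)], where
    [delta(z) = (1 + t z / n) ^ -n - exp (- t z)]. The estimates follow once this
    symbol is recognized as the Laplace transform of a real measure on the
    half-line of total variation at most [8 * f (sqrt n / t)], since integrating
    the semigroup against a measure costs at most the factor [M].

    Two facts about [delta] give this measure. It is a difference of two
    transforms of probability measures, hence has total variation at most [2]
    ([lap_delta]). Moreover [(1 + z)^-1] and [exp (- z)] are the transforms of laws of
    the same mean, so their difference divided by [z ^ 2] is the transform of a
    positive measure of mass [1/2] ([lap_taylor2]); telescoping the difference of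
    the [n]-th powers of [(1 + t z / n)^-1] and [exp (- t z / n)] bounds the total
    variation for [delta(z) / z ^ 2] by [t ^ 2 / (2 n)] ([lap_delta_square]). In
    [f(z) = a + int (z + tau) ^ -2 mu(d tau)] the measure is cut at
    [c = sqrt n / t]. For [tau > c] the kernel [(z + tau) ^ -2] is itself a
    transform of mass [tau ^ -2], at most [4 (c + tau) ^ -2], and is paired with the
    first bound; for [tau <= c] the product [z ^ 2 (z + tau) ^ -2] has total
    variation at most [4] and is paired with the second ([lap_stieltjes_near],
    [lap_stieltjes_far], [stieltjes_split]). The choice of [c] makes the sum of all
    contributions at most [8 * f(c)] ([lap_stieltjes_delta]).

    The passage from symbols to operators needs that the operator depends only on
    the values of the transform on the positive half-line, and that products go to
    products. Both come from one approximation: averaging the orbit with Poisson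
    weights writes the operator of a measure as a strong limit, as [N] grows, of
    power series in [T (1/(N+1))] whose coefficients are those of the power series
    of the transform at [(1 - w) (N+1)] in the variable [w] ([hpint_approx]). Uniqueness
    of power series and Cauchy products then give [rep_unique] and [repM], from
    which the resolvent, [Delta] and the injectivity of the regularizer
    [z ^ 2 / (1 + z) ^ 2] for dense range are derived (the latter is the mean ergodic
    theorem, [range_dense_injective]).

    In the extended calculus, [f(A) x = y] means [(e f)(A) x = e(A) y] with [e(A)]
    injective, so comparing symbols on the positive half-line suffices to evaluate
    [f(A)] on the range of [Delta] and to commute it with [Delta]
    ([functional_calculus_value], [functional_calculus_comm]). Only the existence
    of a regularizer requires an identity on the whole right half-plane: Laplace
    transforms are analytic there ([laplace_ana]), and analytic functions that agree
    on the half-line agree ([identity_Cplus]).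

    Finally, [z ^ -alpha] is a Stieltjes function of order two for [0 < alpha <= 2]
    ([stieltjes_power]), and applying [A ^ alpha] to the commutation lemma with
    [z ^ alpha * (z ^ -alpha * delta(z)) = delta(z)] gives the last estimate. *)

(** * Real-valued norms over the complex field *)

Section RealNorm.
Context {R : realType} {V : normedModType R[i]}.
Implicit Types (u v : V) (r : R).

Lemma rnormE v : `|v| = (rnorm v)%:C.
Proof.
have /= := normr_ge0 v; rewrite lecE /= => /andP[/eqP h _].
by apply/eqP; rewrite eq_complex /= h !eqxx.
Qed.

Lemma rnorm_ge0 v : 0 <= rnorm v.
Proof. by have := normr_ge0 v; rewrite rnormE lecR. Qed.

Lemma rnorm0 : rnorm (0 : V) = 0.
Proof. by rewrite /rnorm normr0. Qed.

Lemma rnorm_eq0 v : rnorm v = 0 -> v = 0.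
Proof. by move=> h; apply/normr0_eq0; rewrite rnormE h. Qed.

Lemma rnormD u v : rnorm (u + v) <= rnorm u + rnorm v.
Proof. by rewrite -lecR rmorphD /= -!rnormE ler_normD. Qed.

Lemma rnormN v : rnorm (- v) = rnorm v.
Proof. by rewrite /rnorm normrN. Qed.

Lemma rnormB u v : rnorm (u - v) <= rnorm u + rnorm v.
Proof. by rewrite -(rnormN v) rnormD. Qed.

Lemma rdistC u v : rnorm (u - v) = rnorm (v - u).
Proof. by rewrite -rnormN opprB. Qed.

Lemma rnorm_triangle w u v : rnorm (u - v) <= rnorm (u - w) + rnorm (w - v).
Proof. by rewrite -[u - v](subrKA w) rnormD. Qed.

Lemma rnormZ (c : R[i]) v : rnorm (c *: v) = complex.Re `|c| * rnorm v.
Proof.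
apply: (@complexI R); rewrite -rnormE normrZ rnormE rmorphM /=; congr (_ * _).
Qed.

Lemma rnormZr r v : rnorm (r%:C *: v) = `|r| * rnorm v.
Proof. by rewrite rnormZ; congr (_ * _); rewrite normc_def /= expr0n addr0 sqrtr_sqr. Qed.

Lemma rnorm_sum (I : Type) (s : seq I) (P : pred I) (F : I -> V) :
  rnorm (\sum_(i <- s | P i) F i) <= \sum_(i <- s | P i) rnorm (F i).
Proof.
elim/big_rec2 : _ => [|i y x _ h]; first by rewrite rnorm0.
by rewrite (le_trans (rnormD _ _)) // lerD2l.
Qed.

Lemma rnorm_dist u v : `|rnorm u - rnorm v| <= rnorm (u - v).
Proof.
rewrite ler_norml; apply/andP; split.
  by have := rnormD (v - u) u; rewrite subrK rdistC; lra.
by have := rnormD (u - v) v; rewrite subrK; lra.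
Qed.

End RealNorm.

Section RealNormTopology.
Context {R : realType} {V : normedModType R[i]}.

Lemma cvg_rnormP {T : Type} {F : set_system T} {FF : Filter F} (f : T -> V) (l : V) :
  f @ F --> l <-> forall e : R, 0 < e -> \forall x \near F, rnorm (f x - l) < e.
Proof.
split.
  move=> /cvgrPdist_lt h e e0.
  have e0' : 0 < e%:C by rewrite ltcR.
  apply: filterS (h _ e0') => x; by rewrite rnormE ltcR rdistC.
move=> h; apply/cvgrPdist_lt => e; rewrite ltcE /= => /andP[/eqP ei er].
apply: filterS (h _ er) => x; rewrite rnormE ltcE /= ei eqxx /= => hx.
by rewrite rdistC.
Qed.

Lemma cvg_rnorm {T : Type} {F : set_system T} {FF : Filter F} (f : T -> V) (l : V) :
  f @ F --> l <-> (fun x => rnorm (f x - l)) @ F --> (0 : R).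
Proof.
split.
  move=> /cvg_rnormP h; apply/cvgrPdist_lt => e e0.
  apply: filterS (h _ e0) => x; by rewrite sub0r normrN ger0_norm ?rnorm_ge0.
move=> /cvgrPdist_lt h; apply/cvg_rnormP => e e0.
apply: filterS (h _ e0) => x; by rewrite sub0r normrN ger0_norm ?rnorm_ge0.
Qed.

Lemma cvg_rnorm_le {T : Type} {F : set_system T} {FF : Filter F} (f : T -> V) (l : V)
    (g : T -> R) : (forall x, rnorm (f x - l) <= g x) -> g @ F --> (0 : R) ->
  f @ F --> l.
Proof.
move=> h cg; apply/cvg_rnorm; apply: (@squeeze_cvgr _ _ _ _ (fun=> 0) g) cg.
- by apply: nearW => x; rewrite rnorm_ge0 h.
- exact: cvg_cst.
Qed.

Lemma rnorm_le_eps (v w : V) :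
  (forall e : R, 0 < e -> rnorm (v - w) <= e) -> v = w.
Proof.
move=> h; apply/eqP; rewrite -subr_eq0; apply/eqP/rnorm_eq0/eqP.
by rewrite eq_le rnorm_ge0 andbT; apply/ler_addgt0Pr => e e0; rewrite add0r h.
Qed.

Lemma continuous_rnorm_comp {T : topologicalType} (f : T -> V) (v : V) :
  continuous f -> continuous (fun x => rnorm (f x - v) : R).
Proof.
move=> cf x; have /cvg_rnormP h := cf x.
apply/cvgrPdist_lt => e e0; apply: filterS (h _ e0) => y hy.
apply: le_lt_trans (rnorm_dist _ _) _.
by rewrite opprB addrA subrK rdistC.
Qed.

End RealNormTopology.

Section RealNormComplete.
Context {R : realType} {V : completeNormedModType R[i]}.

Lemma rnorm_cauchy_cvg (u : nat -> V) :
  (forall e : R, 0 < e -> exists N, forall m n, (N <= m)%N -> (N <= n)%N ->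
     rnorm (u m - u n) <= e) ->
  exists l : V, u @ \oo --> l.
Proof.
move=> h; suff : cvg (u @ \oo) by move=> /cvg_ex.
apply/cauchy_cvgP/cauchy_ballP => e; rewrite ltcE /= => /andP[/eqP ei er].
have er2 : 0 < complex.Re e / 2 by rewrite divr_gt0.
have [N hN] := h _ er2.
exists (u @` [set n | (N <= n)%N], u @` [set n | (N <= n)%N]) => /=.
  by split; exists N => //= n hn; exists n.
move=> [_ _] /= [[m hm <-] [n hn <-]]; rewrite -ball_normE /ball_ /= rnormE ltcE /= ei eqxx /=.
by apply: le_lt_trans (hN _ _ hm hn) _; lra.
Qed.

End RealNormComplete.

(** * Bounded measurable functions on the half-line *)

Notation finmeas R := {finite_measure set (measurableTypeR R) -> \bar R}.

Section BoundedMeasurable.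
Context {R : realType}.
Local Notation RR := (measurableTypeR R).
Implicit Types (p : finmeas R) (g : R -> R).

Lemma measurable_Rplus : measurable (@Rplus R : set RR).
Proof.
by rewrite (_ : @Rplus R = `[0, +oo[%classic) //; apply/seteqP; split=> x /=;
  rewrite /Rplus /= in_itv /= andbT.
Qed.

(** Every kernel integrated below is bounded, and bounded integrands are
    integrable against all finite measures at once. *)
Definition bm g := measurable_fun (@Rplus R : set RR) g /\
  exists B : R, forall s, 0 <= s -> `|g s| <= B.

Definition Iplus p g : R := \int[p]_(s in @Rplus R) g s.

Definition mass p : R := fine (p (@Rplus R)).

Lemma mass_ge0 p : 0 <= mass p.
Proof. by rewrite fine_ge0. Qed.

Lemma mass_fin p : p (@Rplus R) = (mass p)%:E.
Proof. by rewrite /mass fineK // fin_num_measure //; exact: measurable_Rplus. Qed.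

Lemma bm_integrable p g : bm g -> p.-integrable (@Rplus R) (EFin \o g).
Proof.
move=> [mg [B hB]]; apply: measurable_bounded_integrable => //.
- exact: measurable_Rplus.
- by rewrite (le_lt_trans _ (ltry (mass p))) // -mass_fin.
- exists B; split; first exact: num_real.
  by move=> x Bx y /= hy; apply: le_trans (hB _ hy) (ltW Bx).
Qed.

Lemma bm_cst c : bm (fun=> c).
Proof. by split; [exact: measurable_cst | exists `|c|]. Qed.

Lemma bmD g1 g2 : bm g1 -> bm g2 -> bm (fun s => g1 s + g2 s).
Proof.
move=> [m1 [B1 h1]] [m2 [B2 h2]]; split; first exact: measurable_funD.
by exists (B1 + B2) => s s0; rewrite (le_trans (ler_normD _ _)) // lerD ?h1 ?h2.
Qed.

Lemma bmM g1 g2 : bm g1 -> bm g2 -> bm (fun s => g1 s * g2 s).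
Proof.
move=> [m1 [B1 h1]] [m2 [B2 h2]]; split; first exact: measurable_funM.
by exists (B1 * B2) => s s0; rewrite normrM ler_pM ?h1 ?h2.
Qed.

Lemma bmZ c g : bm g -> bm (fun s => c * g s).
Proof. by move=> h; apply: bmM => //; exact: bm_cst. Qed.

Lemma bmN g : bm g -> bm (fun s => - g s).
Proof. by move=> /(bmZ (-1)) [m b]; split; [under eq_fun do rewrite -mulN1r|under eq_exists do under eq_forall do rewrite -mulN1r]. Qed.

Lemma bmB g1 g2 : bm g1 -> bm g2 -> bm (fun s => g1 s - g2 s).
Proof. by move=> h1 h2; apply: bmD => //; exact: bmN. Qed.

Lemma bm_sum (I : Type) (r : seq I) (F : I -> R -> R) :
  (forall i, bm (F i)) -> bm (fun s => \sum_(i <- r) F i s).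
Proof.
move=> h; elim: r => [|i r IH].
  by under eq_fun do rewrite big_nil; exact: bm_cst.
by under eq_fun do rewrite big_cons; exact: bmD.
Qed.

Lemma bm_continuous g (B : R) : continuous g ->
  (forall s, 0 <= s -> `|g s| <= B) -> bm g.
Proof.
move=> cg hB; split; last by exists B.
by apply: measurable_funTS; exact: continuous_measurable_fun.
Qed.

Lemma bm_indic (D : set RR) : measurable D -> bm (\1_D : R -> R).
Proof.
move=> mD; split; first exact: measurable_indic.
exists 1 => s _; rewrite indicE; case: (_ \in _); rewrite ?normr1 ?normr0 //.
Qed.

Lemma Iplus_eq p g1 g2 : (forall s, 0 <= s -> g1 s = g2 s) ->
  Iplus p g1 = Iplus p g2.
Proof. by move=> h; apply: eq_Rintegral => s; rewrite inE; exact: h. Qed.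

Lemma IplusD p g1 g2 : bm g1 -> bm g2 ->
  Iplus p (fun s => g1 s + g2 s) = Iplus p g1 + Iplus p g2.
Proof.
move=> h1 h2; apply: RintegralD; first exact: measurable_Rplus.
- exact: bm_integrable h1.
- exact: bm_integrable h2.
Qed.

Lemma IplusZ p c g : bm g -> Iplus p (fun s => c * g s) = c * Iplus p g.
Proof. by move=> h; apply: RintegralZl; [exact: measurable_Rplus|exact: bm_integrable h]. Qed.

Lemma IplusB p g1 g2 : bm g1 -> bm g2 ->
  Iplus p (fun s => g1 s - g2 s) = Iplus p g1 - Iplus p g2.
Proof.
move=> h1 h2; apply: RintegralB; first exact: measurable_Rplus.
- exact: bm_integrable h1.
- exact: bm_integrable h2.
Qed.

Lemma Iplus_cst p c : Iplus p (fun=> c) = c * mass p.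
Proof. by rewrite /Iplus Rintegral_cst //; exact: measurable_Rplus. Qed.

Lemma Iplus_sum (I : Type) (r : seq I) (F : I -> R -> R) p :
  (forall i, bm (F i)) ->
  Iplus p (fun s => \sum_(i <- r) F i s) = \sum_(i <- r) Iplus p (F i).
Proof.
move=> h; elim: r => [|i r IH].
  rewrite big_nil -[RHS](mul0r (mass p)) -Iplus_cst.
  by apply: Iplus_eq => s _; rewrite big_nil.
rewrite big_cons -IH -IplusD //; last exact: bm_sum.
by apply: Iplus_eq => s _; rewrite big_cons.
Qed.

Lemma Iplus_le p g1 g2 : bm g1 -> bm g2 ->
  (forall s, 0 <= s -> g1 s <= g2 s) -> Iplus p g1 <= Iplus p g2.
Proof.
move=> h1 h2 h; apply: le_Rintegral => //; first exact: measurable_Rplus.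
- exact: bm_integrable h1.
- exact: bm_integrable h2.
Qed.

Lemma Iplus_ge0 p g : (forall s, 0 <= s -> 0 <= g s) -> 0 <= Iplus p g.
Proof. by move=> h; apply: Rintegral_ge0. Qed.

Lemma Iplus_indic p (D : set RR) : measurable D ->
  Iplus p \1_D = fine (p (@Rplus R `&` D)).
Proof.
move=> mD; rewrite /Iplus /Rintegral integral_indic //; last exact: measurable_Rplus.
by rewrite setIC.
Qed.

Lemma Iplus_EFin p g : bm g ->
  (\int[p]_(s in @Rplus R) (g s)%:E)%E = (Iplus p g)%:E.
Proof.
move=> h; rewrite /Iplus /Rintegral fineK //.
by apply: integrable_fin_num; [exact: measurable_Rplus|exact: bm_integrable h].
Qed.

Lemma Iplus_dct p (g_ : nat -> R -> R) g (B : R) :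
  (forall n, bm (g_ n)) -> bm g ->
  (forall n s, 0 <= s -> `|g_ n s| <= B) ->
  (forall s, 0 <= s -> g_ ^~ s @ \oo --> g s) ->
  (fun n => Iplus p (g_ n)) @ \oo --> Iplus p g.
Proof.
move=> h_ h hB hc.
have mE f : bm f -> measurable_fun (@Rplus R : set RR) (EFin \o f).
  by move=> [mf _]; exact/measurable_EFinP.
have [//|||||] := @dominated_convergence _ _ _ p _ measurable_Rplus
  (fun n s => (g_ n s)%:E) (EFin \o g) (EFin \o (fun=> B)).
- by move=> n; exact: mE.
- exact: mE.
- by apply: aeW => s s0; apply: cvg_EFin; [exact: nearW|exact: hc].
- exact: bm_integrable (bm_cst B).
- by apply: aeW => s n s0; rewrite /= lee_fin hB.
move=> _ _ H.
suff : (fun n => (Iplus p (g_ n))%:E) @ \oo --> (Iplus p g)%:E.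
  by move=> /fine_cvgP [].
rewrite -Iplus_EFin // (_ : (fun n => _) = (fun n => \int[p]_(s in @Rplus R) (g_ n s)%:E)%E) //.
by apply/funext => n; rewrite -Iplus_EFin.
Qed.

End BoundedMeasurable.

(** * Bochner integrals as limits of Riemann sums *)

Section SimpleIntegral.
Context {R : realType} {V : normedModType R[i]}.
Local Notation RR := (measurableTypeR R).
Implicit Types p : finmeas R.

(** Values of a simple function may coincide under different labels; summing over
    labels lets two simple functions be compared on a common refinement. *)
Lemma simple_integral_label p (W : choiceType) (g : R -> W) (rs : seq W) (c : W -> V) :
  uniq rs -> (forall s, g s \in rs) ->
  (forall w, measurable (g @^-1` [set w] : set RR)) ->
  simple_integral p (c \o g) =
  \sum_(w <- rs) (Iplus p \1_(g @^-1` [set w]))%:C *: c w.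
Proof.
move=> urs grs mg.
have Emass v : fine (p (@Rplus R `&` (c \o g) @^-1` [set v])) =
    \sum_(w <- rs | c w == v) Iplus p \1_(g @^-1` [set w]).
  have mc : measurable ((c \o g) @^-1` [set v] : set RR).
    rewrite (_ : _ @^-1` _ = \bigcup_(w in [set` [seq w <- rs | c w == v]]) (g @^-1` [set w])).
      by apply: fin_bigcup_measurable => // w _; exact: mg.
    apply/seteqP; split=> s /=.
      by move=> h; exists (g s) => //=; rewrite mem_filter grs h eqxx.
    by move=> [w /=]; rewrite mem_filter => /andP[/eqP <- _] ->.
  rewrite -Iplus_indic // -big_filter -Iplus_sum; last first.
    by move=> w; apply: bm_indic.
  apply: Iplus_eq => s _; rewrite indicE.
  have [h|h] := eqVneq (c (g s)) v.
    rewrite mem_set //= (bigD1_seq (g s)) ?filter_uniq //=; last first.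
      by rewrite mem_filter grs h eqxx.
    rewrite indicE mem_set //= big1_seq ?addr0 // => w /andP[wn _].
    by rewrite indicE memNset //= => e; rewrite e eqxx in wn.
  rewrite memNset /=; last by move=> e; rewrite /= e eqxx in h.
  rewrite big1_seq // => w; rewrite mem_filter => /andP[_ /andP[/eqP e _]].
  by rewrite indicE memNset //= => e'; rewrite e' e eqxx in h.
rewrite /simple_integral (fsbig_widen _ [set` undup (map c rs)]); first last.
- move=> v [_ /= nv]; rewrite Emass big1_seq ?scale0r // => w /andP[/eqP cw _].
  rewrite (_ : g @^-1` [set w] = set0) ?indic0 ?Iplus_cst ?mul0r //.
  apply/seteqP; split=> s //= gs; apply: nv; exists s => //=; by rewrite gs.
- by move=> _ [s _ <-] /=; rewrite mem_undup; apply: map_f; exact: grs.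
rewrite -fsbig_seq ?undup_uniq //.
under eq_bigr do rewrite Emass rmorph_sum /= scaler_suml big_mkcond /=.
rewrite exchange_big /= [LHS]big_seq [RHS]big_seq; apply: eq_bigr => w wrs.
rewrite (bigD1_seq (c w)) ?undup_uniq ?mem_undup ?map_f //= eqxx.
by rewrite big1 ?addr0 // => v /negPf; rewrite eq_sym => ->.
Qed.

Lemma simple_function_seq (s : R -> V) : simple_function s ->
  exists r, uniq r /\ forall x, s x \in r.
Proof.
move=> [/finite_seqP [r hr] _]; exists (undup r); split; first exact: undup_uniq.
move=> x; rewrite mem_undup; have : range s (s x) by exists x.
by rewrite hr.
Qed.

(** Measurability is asked of the distances to fixed vectors only, so that no
    sigma-algebra on [V] is involved. *)
Definition bmv (h : R -> V) := forall v, bm (fun r => rnorm (h r - v)).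

Lemma bmv_continuous (h : R -> V) (B : R) : continuous h ->
  (forall r, 0 <= r -> rnorm (h r) <= B) -> bmv h.
Proof.
move=> ch hB v; apply: (@bm_continuous _ _ (B + rnorm v)).
  exact: continuous_rnorm_comp.
move=> r r0; rewrite ger0_norm ?rnorm_ge0 // (le_trans (rnormB _ _)) //.
by rewrite lerD2r hB.
Qed.

Lemma bm_dist_simple (h s : R -> V) : bmv h -> simple_function s ->
  bm (fun r => rnorm (h r - s r)).
Proof.
move=> bh ss; have [rs [urs hrs]] := simple_function_seq ss.
rewrite (_ : (fun _ => _) = (fun r => \sum_(v <- rs)
    \1_(s @^-1` [set v]) r * rnorm (h r - v))).
  apply: bm_sum => v; apply: bmM; last exact: bh.
  by apply: bm_indic; exact: ss.2.
apply/funext => r; rewrite (bigD1_seq (s r)) //= indicE mem_set // mul1r.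
rewrite big1 ?addr0 // => v /eqP vn; rewrite indicE memNset ?mul0r //.
by move=> /= e; apply: vn.
Qed.

Lemma bmv_simple (s : R -> V) : simple_function s -> bmv s.
Proof.
move=> ss v; under eq_fun do rewrite rdistC.
apply: (@bm_dist_simple (fun=> v)) => // w; exact: bm_cst.
Qed.

Lemma simple_integral_dist p (s1 s2 : R -> V) :
  simple_function s1 -> simple_function s2 ->
  rnorm (simple_integral p s1 - simple_integral p s2) <=
  Iplus p (fun r => rnorm (s1 r - s2 r)).
Proof.
move=> ss1 ss2.
have [r1 [u1 h1]] := simple_function_seq ss1.
have [r2 [u2 h2]] := simple_function_seq ss2.
pose g s := (s1 s, s2 s); pose rs := undup [seq (a, b) | a <- r1, b <- r2].
have grs s : g s \in rs by rewrite mem_undup; apply: (allpairs_f pair).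
have mg w : measurable (g @^-1` [set w] : set RR).
  rewrite (_ : g @^-1` _ = s1 @^-1` [set w.1] `&` s2 @^-1` [set w.2]).
    by apply: measurableI; [exact: ss1.2|exact: ss2.2].
  apply/seteqP; split=> s; first by move=> /= <-.
  by case: w => a b /= [] <- <-.
have -> : simple_integral p s1 = _ := simple_integral_label p fst (undup_uniq _) grs mg.
have -> : simple_integral p s2 = _ := simple_integral_label p snd (undup_uniq _) grs mg.
rewrite -sumrB; apply: le_trans (rnorm_sum _ _ _) _.
rewrite (eq_bigr (fun w => Iplus p (fun s => rnorm (w.1 - w.2) * \1_(g @^-1` [set w]) s))); last first.
  move=> w _; rewrite -scalerBr rnormZr ger0_norm; last first.
    by apply: Iplus_ge0 => s _; rewrite indicE.
  by rewrite mulrC IplusZ //; apply: bm_indic; exact: mg.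
rewrite -Iplus_sum; last by move=> w; apply: bmZ; apply: bm_indic; exact: mg.
apply: Iplus_le.
- by apply: bm_sum => w; apply: bmZ; apply: bm_indic; exact: mg.
- by apply: bm_dist_simple => //; exact: bmv_simple.
move=> s _; rewrite (bigD1_seq (g s)) ?undup_uniq //= indicE mem_set // mulr1.
rewrite big1 ?addr0 // => w /eqP wn; rewrite indicE memNset ?mulr0 //.
by move=> /= e; apply: wn.
Qed.

End SimpleIntegral.

Section Bochner.
Context {R : realType} {V : normedModType R[i]}.
Local Notation RR := (measurableTypeR R).
Implicit Types (p : finmeas R) (h : R -> V).

Lemma bochner_integral_ext p h1 h2 y : (forall r, 0 <= r -> h1 r = h2 r) ->
  bochner_integral p h1 y -> bochner_integral p h2 y.
Proof.
move=> e [s [s1 s2 s3 s4]]; exists s; split => //.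
  by apply: negligibleS s2 => r /= nr hr; apply: nr => r0; rewrite -e //; exact: hr.
have <- // : (fun k => (\int[p]_(r in @Rplus R) (rnorm (h1 r - s k r))%:E)%E) =
  (fun k => (\int[p]_(r in @Rplus R) (rnorm (h2 r - s k r))%:E)%E).
by apply/funext => k; apply: eq_integral => r; rewrite inE => r0; rewrite e.
Qed.

Lemma bochner_integral_approx p h (s : nat -> R -> V) :
  bmv h -> (forall k, simple_function (s k)) ->
  (\int[p]_(r in @Rplus R) (rnorm (h r - s k r))%:E @[k --> \oo] --> 0)%E ->
  (fun k => Iplus p (fun r => rnorm (h r - s k r))) @ \oo --> (0 : R).
Proof.
move=> bh ss.
rewrite (_ : (fun k => _) = (fun k => (Iplus p (fun r => rnorm (h r - s k r)))%:E)).
  by move=> /fine_cvgP [].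
by apply/funext => k; rewrite -Iplus_EFin //; exact: bm_dist_simple.
Qed.

Lemma simple_integral_dist_le p h (s1 s2 : R -> V) : bmv h ->
  simple_function s1 -> simple_function s2 ->
  rnorm (simple_integral p s1 - simple_integral p s2) <=
  Iplus p (fun r => rnorm (h r - s1 r)) + Iplus p (fun r => rnorm (h r - s2 r)).
Proof.
move=> bh ss1 ss2; rewrite (le_trans (simple_integral_dist p ss1 ss2)) //.
have b1 := bm_dist_simple bh ss1; have b2 := bm_dist_simple bh ss2.
rewrite -IplusD //; apply: Iplus_le.
- by apply: bm_dist_simple => //; exact: bmv_simple.
- exact: bmD.
by move=> r _; rewrite (le_trans (rnorm_triangle (h r) _ _)) // lerD2r rdistC.
Qed.

(** Two approximating sequences differ, in the mean, by a null sequence, and the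
    integral of a simple function is bounded by its mean norm. *)
Lemma bochner_integral_unique p h y1 y2 : bmv h ->
  bochner_integral p h y1 -> bochner_integral p h y2 -> y1 = y2.
Proof.
move=> bh [s1 [ss1 _ i1 c1]] [s2 [ss2 _ i2 c2]].
have {}i1 := bochner_integral_approx bh ss1 i1.
have {}i2 := bochner_integral_approx bh ss2 i2.
have c : (simple_integral p (s1 k) - simple_integral p (s2 k)) @[k --> \oo] --> y1 - y2.
  exact: cvgB.
have c0 : (simple_integral p (s1 k) - simple_integral p (s2 k)) @[k --> \oo] --> (0 : V).
  apply: (@cvg_rnorm_le _ _ _ _ _ _ _ (fun k =>
    Iplus p (fun r => rnorm (h r - s1 k r)) + Iplus p (fun r => rnorm (h r - s2 k r)))).
    by move=> k; rewrite subr0 simple_integral_dist_le.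
  by rewrite -[X in _ --> X](addr0 0); exact: cvgD.
by apply/eqP; rewrite -subr_eq0; apply/eqP; exact: cvg_unique c c0.
Qed.

(** A function is sampled at the grid point below [s], of mesh [1/(J+1)]; the cap
    at [J+1] leaves finitely many samples. *)
Definition grid (J : nat) (s : R) : nat := minn (Num.truncn (s * J.+1%:R)) (J.+1 ^ 2).

Definition gridpt (J j : nat) : R := j%:R / J.+1%:R.

Lemma gridpt_ge0 J j : 0 <= gridpt J j.
Proof. by rewrite divr_ge0. Qed.

Lemma measurable_grid J j : measurable (grid J @^-1` [set j] : set RR).
Proof.
have mA k : measurable ([set s | (k <= grid J s)%N] : set RR).
  case: k => [|k].
    by rewrite (_ : [set _ | _] = setT) //; apply/seteqP; split.
  have [hk|hk] := leqP k.+1 (J.+1 ^ 2); last first.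
    rewrite (_ : [set _ | _] = set0) //; apply/seteqP; split=> s //=.
    by rewrite leq_min [X in _ && X]leqNgt hk andbF.
  rewrite (_ : [set _ | _] = `[k.+1%:R / J.+1%:R, +oo[%classic) //.
  apply/seteqP; split=> s /=; rewrite leq_min hk andbT truncn_gt_nat in_itv /= andbT;
    by rewrite ler_pdivrMr.
rewrite (_ : _ @^-1` _ = [set s | (j <= grid J s)%N] `\` [set s | (j.+1 <= grid J s)%N]).
  exact: measurableD.
apply/seteqP; split=> s /=; first by move=> ->; rewrite ltnn.
by move=> [h /negP]; rewrite -leqNgt => h'; apply/eqP; rewrite eqn_leq h h'.
Qed.

Lemma gridpt_near J s : 0 <= s -> s <= J.+1%:R ->
  gridpt J (grid J s) <= s < gridpt J (grid J s) + J.+1%:R^-1.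
Proof.
move=> s0 sJ; have N0 : 0 < J.+1%:R :> R by rewrite ltr0n.
have sN : 0 <= s * J.+1%:R by rewrite mulr_ge0.
have -> : grid J s = Num.truncn (s * J.+1%:R).
  apply/minn_idPl; rewrite -(ler_nat R) (le_trans (y := s * J.+1%:R)) ?truncn_le //.
  by rewrite natrX expr2 ler_wpM2r.
have /andP[h1 h2] := truncn_itv sN.
by rewrite /gridpt ler_pdivrMr // h1 -[X in _ + X]mul1r -mulrDl natr1 ltr_pdivlMr.
Qed.

Lemma cvg_gridpt s : 0 <= s -> (fun J => gridpt J (grid J s)) @ \oo --> s.
Proof.
move=> s0; apply/cvgrPdist_lt => e e0.
near=> J.
have sJ : s <= J.+1%:R.
  near: J; exists (Num.truncn s) => //= J hJ.
  by rewrite (le_trans (ltW (truncnS_gt s))) // ler_nat ltnS.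
have /andP[h1 h2] := gridpt_near s0 sJ.
rewrite ger0_norm ?subr_ge0 // ltrBlDl (lt_trans h2) // ltrD2l.
near: J; have := @near_infty_natSinv_lt R (PosNum e0).
by apply: filterS.
Unshelve. all: by end_near. Qed.

Definition riemann (W : lmodType R[i]) p (h : R -> W) (J : nat) : W :=
  \sum_(j < (J.+1 ^ 2).+1) (Iplus p \1_(grid J @^-1` [set (j : nat)]))%:C *: h (gridpt J j).

Definition riemannR p (g : R -> R) (J : nat) : R :=
  \sum_(j < (J.+1 ^ 2).+1) Iplus p \1_(grid J @^-1` [set (j : nat)]) * g (gridpt J j).

Definition step (W : Type) (h : R -> W) (J : nat) (s : R) : W := h (gridpt J (grid J s)).

Lemma grid_lt J s : (grid J s < (J.+1 ^ 2).+1)%N.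
Proof. by rewrite ltnS geq_minr. Qed.

Lemma step_simple h J : simple_function (step h J).
Proof.
split.
  apply: (@sub_finite_set _ _ ([set h (gridpt J j) | j in `I_(J.+1 ^ 2).+1])).
    by move=> _ [s _ <-]; exists (grid J s) => //=; exact: grid_lt.
  by apply: finite_image; exact: finite_II.
move=> v; rewrite (_ : _ @^-1` _ =
    \bigcup_(j in [set j | h (gridpt J j) = v]) (grid J @^-1` [set j])).
  by apply: bigcup_measurable => j _; exact: measurable_grid.
apply/seteqP; split=> s /=; first by move=> hs; exists (grid J s).
by move=> [j /= <- <-].
Qed.

Lemma riemannE p h J : simple_integral p (step h J) = riemann p h J.
Proof.
rewrite [LHS](@simple_integral_label _ _ p _ (grid J) (index_iota 0 (J.+1 ^ 2).+1) (h \o gridpt J)).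
- by rewrite /riemann (big_mkord xpredT (fun j => (Iplus p \1_(grid J @^-1` [set j]))%:C *: h (gridpt J j))).
- exact: iota_uniq.
- by move=> s; rewrite mem_index_iota grid_lt.
- exact: measurable_grid.
Qed.

Lemma cvg_step (W : topologicalType) (h : R -> W) s : continuous h -> 0 <= s ->
  step h J s @[J --> \oo] --> h s.
Proof. by move=> ch s0; apply: continuous_cvg; [exact: ch|exact: cvg_gridpt]. Qed.

Lemma riemannR_cvg p (g : R -> R) (B : R) : continuous g ->
  (forall s, 0 <= s -> `|g s| <= B) -> riemannR p g @ \oo --> Iplus p g.
Proof.
move=> cg hB.
have E J s : step g J s = \sum_(j < (J.+1 ^ 2).+1)
    g (gridpt J j) * \1_(grid J @^-1` [set (j : nat)]) s.
  rewrite (bigD1 (Ordinal (grid_lt J s))) //= indicE mem_set // mulr1.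
  rewrite big1 ?addr0 // => j /eqP jn; rewrite indicE memNset ?mulr0 //=.
  by move=> e; apply: jn; apply: val_inj.
have b J : bm (step g J).
  rewrite (_ : step g J = fun s => \sum_(j < (J.+1 ^ 2).+1)
    g (gridpt J j) * \1_(grid J @^-1` [set (j : nat)]) s); last exact/funext/E.
  by apply: bm_sum => j; apply: bmZ; apply: bm_indic; exact: measurable_grid.
rewrite (_ : riemannR p g = fun J => Iplus p (step g J)).
  apply: (@Iplus_dct _ _ _ _ B) => //.
  - exact: bm_continuous hB.
  - by move=> J s s0; apply: hB; exact: gridpt_ge0.
  - by move=> s s0; exact: cvg_step.
apply/funext => J; rewrite (Iplus_eq p (g2 := fun s => \sum_(j < (J.+1 ^ 2).+1)
    g (gridpt J j) * \1_(grid J @^-1` [set (j : nat)]) s)); last by move=> s _; exact: E.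
rewrite Iplus_sum; last first.
  by move=> j; apply: bmZ; apply: bm_indic; exact: measurable_grid.
apply: eq_bigr => j _; rewrite IplusZ 1?mulrC //.
by apply: bm_indic; exact: measurable_grid.
Qed.

Lemma step_dist_cvg p h (B : R) : continuous h ->
  (forall s, 0 <= s -> rnorm (h s) <= B) ->
  (fun J => Iplus p (fun s => rnorm (h s - step h J s))) @ \oo --> (0 : R).
Proof.
move=> ch hB; rewrite -[X in _ --> X](mul0r (mass p)) -Iplus_cst.
apply: (@Iplus_dct _ _ _ _ (B + B)).
- move=> J; apply: bm_dist_simple; last exact: step_simple.
  exact: bmv_continuous hB.
- exact: bm_cst.
- move=> J s s0; rewrite ger0_norm ?rnorm_ge0 // (le_trans (rnormB _ _)) //.
  by rewrite lerD ?hB //; exact: gridpt_ge0.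
- move=> s s0; have /cvg_rnorm := cvg_step ch s0.
  by rewrite (_ : (fun J => _) = (fun J => rnorm (h s - step h J s))) //;
    apply/funext => J; rewrite rdistC.
Qed.

End Bochner.

Section BochnerExists.
Context {R : realType} {V : completeNormedModType R[i]}.
Implicit Types (p : finmeas R) (h : R -> V).

(** The samples of a bounded continuous function converge to it pointwise, hence
    in the mean by dominated convergence, which makes the sums a Cauchy sequence. *)
Lemma bochner_riemann p h (B : R) : continuous h ->
  (forall s, 0 <= s -> rnorm (h s) <= B) ->
  exists y : V, bochner_integral p h y /\ riemann p h @ \oo --> y.
Proof.
move=> ch hB; have c0 := step_dist_cvg p ch hB.
have bh := bmv_continuous ch hB.
have [y hy] : exists y : V, simple_integral p (step h J) @[J --> \oo] --> y.
  apply: rnorm_cauchy_cvg => e e0.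
  move/cvgrPdist_lt: c0 => /(_ (e / 2)) []; first by rewrite divr_gt0.
  move=> N _ hN; exists N => m n hm hn.
  have := simple_integral_dist_le p bh (step_simple h m) (step_simple h n).
  move=> /= /le_trans; apply.
  have := hN _ hm; have := hN _ hn.
  rewrite !sub0r !normrN !ger0_norm; first lra.
  - by apply: Iplus_ge0 => s _; exact: rnorm_ge0.
  - by apply: Iplus_ge0 => s _; exact: rnorm_ge0.
exists y; split; last first.
  by rewrite (_ : riemann p h = fun J => simple_integral p (step h J)) //;
    apply/funext => J; rewrite riemannE.
exists (step h); split => //.
- exact: step_simple.
- by apply: aeW => s s0; exact: cvg_step.
- rewrite (_ : (fun k => _) = (fun J => (Iplus p (fun s => rnorm (h s - step h J s)))%:E)).
    by apply: cvg_EFin; [exact: nearW|exact: c0].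
  by apply/funext => J; rewrite Iplus_EFin //; apply: bm_dist_simple => //; exact: step_simple.
Qed.

Lemma bochner_riemann_cvg p h (B : R) y : continuous h ->
  (forall s, 0 <= s -> rnorm (h s) <= B) ->
  bochner_integral p h y -> riemann p h @ \oo --> y.
Proof.
move=> ch hB hy; have [y' [hy' c]] := bochner_riemann p ch hB.
by rewrite (bochner_integral_unique (bmv_continuous ch hB) hy hy').
Qed.

End BochnerExists.

(** * Poisson weights *)

Section Poisson.
Context {R : realType}.
Implicit Types (l : R) (k K : nat).

Definition pois l k : R := expR (- l) * (l ^+ k / k`!%:R).

Lemma pois_ge0 l k : 0 <= l -> 0 <= pois l k.
Proof. by move=> l0; rewrite mulr_ge0 ?expR_ge0 // divr_ge0 // exprn_ge0. Qed.

Lemma series_exp_cvg l : (fun K => \sum_(k < K) l ^+ k / k`!%:R) @ \oo --> expR l.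
Proof.
have := @is_cvg_series_exp_coeff R l; rewrite /expR /series /=.
rewrite (_ : (fun K => \sum_(k < K) l ^+ k / k`!%:R) = [sequence \sum_(0 <= k < n) exp_coeff l k]_n) //.
by apply/funext => K /=; rewrite big_mkord; apply: eq_bigr => k _; rewrite /exp_coeff /= mulrC.
Qed.

Lemma pois_gen_cvg l w :
  (fun K => \sum_(k < K) pois l k * w ^+ k) @ \oo --> expR (- (l * (1 - w))).
Proof.
have -> : expR (- (l * (1 - w))) = expR (- l) * expR (l * w).
  by rewrite -expRD; congr expR; ring.
rewrite (_ : (fun K => _) = fun K => expR (- l) * \sum_(k < K) (l * w) ^+ k / k`!%:R).
  by apply: cvgMr; exact: series_exp_cvg.
apply/funext => K; rewrite mulr_sumr; apply: eq_bigr => k _.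
by rewrite /pois exprMn -!mulrA; do 2 congr (_ * _); rewrite mulrC.
Qed.

Lemma pois_sum_cvg l : (fun K => \sum_(k < K) pois l k) @ \oo --> (1 : R).
Proof.
have := @pois_gen_cvg l 1; rewrite subrr mulr0 oppr0 expR0.
by under eq_fun do under eq_bigr do rewrite expr1n mulr1.
Qed.

Lemma sum_le_nondecreasing (u : nat -> R) K K' : (forall k, 0 <= u k) -> (K <= K')%N ->
  \sum_(k < K) u k <= \sum_(k < K') u k.
Proof.
move=> u0 /subnK <-; rewrite addnC; elim: (_ - _)%N => [|n IH]; first by rewrite addn0.
by rewrite addnS big_ord_recr /= (le_trans IH) // lerDl.
Qed.

Lemma cvgn_le_eps (u : nat -> R) (b e : R) : u @ \oo --> b -> 0 < e ->
  exists N, forall n, (N <= n)%N -> `|u n - b| <= e.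
Proof.
move=> /cvgrPdist_lt h e0; have [N _ hN] := h e e0.
by exists N => n hn; rewrite distrC ltW // hN.
Qed.

Lemma sum_le_lim (u : nat -> R) (b : R) K : (forall k, 0 <= u k) ->
  (fun K => \sum_(k < K) u k) @ \oo --> b -> \sum_(k < K) u k <= b.
Proof.
move=> u0 c; apply: (cvgr_to_ge c); exists K => // n /= hn.
exact: sum_le_nondecreasing.
Qed.

Lemma pois_sum_le1 l K : 0 <= l -> \sum_(k < K) pois l k <= 1.
Proof.
move=> l0; apply: (sum_le_lim (u := pois l)); last exact: pois_sum_cvg.
by move=> k; exact: pois_ge0.
Qed.

Lemma pois_le1 l k : 0 <= l -> pois l k <= 1.
Proof.
move=> l0; apply: le_trans (pois_sum_le1 k.+1 l0).
by rewrite big_ord_recr /= lerDr sumr_ge0 // => i _; exact: pois_ge0.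
Qed.

(** The second centred moment; the correction term is what truncating the
    sum at [K.+1] leaves behind. *)
Lemma exp_moment2 l K :
  \sum_(k < K.+1) (k%:R - l) ^+ 2 * (l ^+ k / k`!%:R) =
  l * \sum_(k < K.+1) (l ^+ k / k`!%:R) + l ^+ K.+1 / K`!%:R * (l - K.+1%:R).
Proof.
elim: K => [|K IH].
  by rewrite !big_ord_recr !big_ord0 /= fact0 expr0; field.
rewrite big_ord_recr IH [in RHS]big_ord_recr /= factS natrM.
have h1 : K`!%:R != 0 :> R by rewrite pnatr_eq0 -lt0n fact_gt0.
have h2 : K.+1%:R != 0 :> R by rewrite pnatr_eq0.
rewrite -[K.+2%:R]natr1 !exprS.
set E := l ^+ K; set n := K.+1%:R in h2 *; set F := K`!%:R in h1 *.
by field; rewrite nat1r h1 h2.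
Qed.

Lemma pois_variance l K : 0 <= l -> \sum_(k < K) (k%:R - l) ^+ 2 * pois l k <= l.
Proof.
move=> l0; pose K' := maxn K (Num.truncn l).+1.
have h0 k : 0 <= (k%:R - l) ^+ 2 * (l ^+ k / k`!%:R).
  by rewrite mulr_ge0 ?sqr_ge0 // divr_ge0 // exprn_ge0.
have -> : \sum_(k < K) (k%:R - l) ^+ 2 * pois l k =
    expR (- l) * \sum_(k < K) (k%:R - l) ^+ 2 * (l ^+ k / k`!%:R).
  by rewrite mulr_sumr; apply: eq_bigr => k _; rewrite mulrCA.
apply: (@le_trans _ _ (expR (- l) * (l * expR l))); last first.
  by rewrite mulrCA -expRD addNr expR0 mulr1.
apply: ler_wpM2l; first exact: expR_ge0.
apply: (le_trans (sum_le_nondecreasing h0 (leq_maxl K (Num.truncn l).+1))).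
rewrite -/K' /=; have K'0 : (0 < K')%N by rewrite leq_max orbT.
rewrite -(prednK K'0) exp_moment2 prednK //.
rewrite -[leRHS]addr0; apply: lerD.
  apply: ler_wpM2l => //.
  apply: (sum_le_lim (u := fun k => l ^+ k / k`!%:R)); last exact: series_exp_cvg.
  by move=> k; rewrite divr_ge0 // exprn_ge0.
apply: mulr_ge0_le0; first by rewrite divr_ge0 // exprn_ge0.
rewrite subr_le0 (le_trans (ltW (truncnS_gt l))) // ler_nat.
exact: leq_maxr.
Qed.

Lemma continuous_pois (N : R) k : continuous (fun s : R => pois (s * N) k).
Proof.
have c : continuous (fun s : R => s * N).
  by move=> s; apply: cvgMl; exact: cvg_id.
move=> s; apply: cvgM.
  apply: (@continuous_comp R R R (fun s => - (s * N)) expR); last exact: continuous_expR.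
  by apply: cvgN; exact: c.
apply: cvgMl.
apply: (@continuous_comp R R R (fun s => s * N) (fun x => x ^+ k)); first exact: c.
exact: exprn_continuous.
Qed.

Lemma bm_pois (N : R) k : 0 <= N -> bm (fun s => pois (s * N) k).
Proof.
move=> N0; apply: (bm_continuous (B := 1)); first exact: continuous_pois.
by move=> s s0; rewrite ger0_norm ?pois_ge0 ?pois_le1 ?mulr_ge0.
Qed.

End Poisson.

(** * Bounded semigroups *)

Section Semigroup.
Context {R : realType} {X : completeNormedModType R[i]}.
Variables (T : R -> {linear X -> X}) (M : R).
Hypothesis hT : C0_semigroup T.
Hypothesis TM : forall t x, 0 <= t -> rnorm (T t x) <= M * rnorm x.

(** Strong continuity at [0] passes to all times with one modulus, because
    [T s] enlarges norms at most by the factor [M]. *)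
Lemma semigroup_modulus x (e : R) : 0 < e -> exists2 d : R, 0 < d &
  forall s r, 0 <= s -> 0 <= r -> `|s - r| < d -> rnorm (T s x - T r x) <= e.
Proof.
move=> e0; pose M' := `|M| + 1.
have M'0 : 0 < M' by rewrite ltr_pwDr.
have cx : T t x @[t --> 0^'+] --> x by exact: (C0_strong hT).
move/cvg_rnormP: cx => /(_ (e / M')).
rewrite divr_gt0 // => /(_ isT) [d /= d0 hd]; exists d => //.
have key s r : 0 <= s -> s <= r -> `|s - r| < d -> rnorm (T s x - T r x) <= e.
  move=> s0; rewrite le_eqVlt => /orP[/eqP <- _|sr hsr].
    by rewrite subrr rnorm0 ltW.
  have -> : T r x = T s (T (r - s) x).
    by rewrite -(C0_add hT) ?subr_ge0 ?(ltW sr) // addrC subrK.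
  rewrite -linearB /= (le_trans (TM _ s0)) // rdistC.
  have h : rnorm (T (r - s) x - x) < e / M'.
    apply: hd; last by rewrite subr_gt0.
    by rewrite /= sub0r normrN distrC; move: hsr; rewrite distrC.
  rewrite (@le_trans _ _ (M' * (e / M'))) //; last by rewrite mulrCA divff ?mulr1 // gt_eqF.
  rewrite (@le_trans _ _ (M' * rnorm (T (r - s) x - x))) //.
    by rewrite ler_wpM2r ?rnorm_ge0 // (le_trans (ler_norm M)) // lerDl.
  by rewrite ler_wpM2l ?(ltW M'0) // ltW.
move=> s r s0 r0 hsr; have [sr|/ltW rs] := leP s r; first exact: key.
by rewrite rdistC; apply: key => //; rewrite distrC.
Qed.

(** Orbits are continued by their initial value, so as to be continuous on the line. *)
Definition orb x (s : R) : X := T (Num.max 0 s) x.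

Lemma orbE x s : 0 <= s -> orb x s = T s x.
Proof. by move=> s0; rewrite /orb max_r. Qed.

Lemma continuous_orb x : continuous (orb x).
Proof.
move=> s; apply/cvg_rnormP => e e0.
have [d d0 hd] := semigroup_modulus x (divr_gt0 e0 (ltr0Sn R 1)).
exists d => // r /= hr; apply: le_lt_trans (_ : e / 2 < e); last by rewrite ltr_pdivrMr // ltr_pMr ?ltr1n.
apply: hd; rewrite ?le_max ?lexx //.
apply: le_lt_trans hr; rewrite distrC.
case: (leP 0 s) => hs; case: (leP 0 r) => hr; rewrite ?subrr ?normr0 ?subr0 ?sub0r ?normrN //.
- by rewrite !ger0_norm //; [lra|rewrite subr_ge0; lra].
- by rewrite ger0_norm // distrC ger0_norm; lra.
Qed.

Lemma orb_bound x s : 0 <= s -> rnorm (orb x s) <= M * rnorm x.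
Proof. by move=> s0; rewrite orbE // TM. Qed.

End Semigroup.

(** * Cauchy products and uniqueness of power series *)

Section Cauchy.
Context {R : realType}.
Implicit Types A B : nat -> R.

Lemma bounded_sum_tail A (V e : R) : (forall k, 0 <= A k) ->
  (forall K, \sum_(k < K) A k <= V) -> 0 < e ->
  exists n0, forall m n, (n0 <= m)%N -> (m <= n)%N ->
    \sum_(k < n) A k - \sum_(k < m) A k <= e.
Proof.
move=> A0 AV e0.
have nd : {homo (fun n => \sum_(k < n) A k) : n m / (n <= m)%N >-> n <= m}.
  by move=> n m nm; exact: sum_le_nondecreasing.
have cv : cvgn (fun n => \sum_(k < n) A k).
  by apply: nondecreasing_is_cvgn => //; exists V => _ [n _ <-].
have [n0 h] := cvgn_le_eps cv e0.
exists n0 => m n hm hmn; have := h _ hm; rewrite ler_norml => /andP[h1 _].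
by have := nondecreasing_cvgn_le nd cv n; lra.
Qed.

Lemma triangle_sum (W : zmodType) (m : nat -> nat -> W) K :
  \sum_(k < K) \sum_(i < k.+1) m i (k - i)%N = \sum_(i < K) \sum_(j < (K - i)) m i j.
Proof.
elim: K => [|K IH]; first by rewrite !big_ord0.
rewrite big_ord_recr /= IH.
have -> : \sum_(i < K.+1) \sum_(j < (K.+1 - i)) m i j =
    \sum_(i < K.+1) (\sum_(j < (K - i)) m i j + m i (K - i)%N).
  by apply: eq_bigr => i _; rewrite subSn -1?ltnS // big_ord_recr.
rewrite big_split /=; congr (_ + _).
by rewrite big_ord_recr /= subnn big_ord0 addr0.
Qed.

(** The indices in the square and outside the triangle have a large coordinate, so
    their contribution is a tail of one of the two majorants. *)
Lemma square_minus_triangle (W : normedModType R[i]) (m : nat -> nat -> W) A B (VA VB : R) :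
  (forall k, 0 <= A k) -> (forall k, 0 <= B k) ->
  (forall K, \sum_(k < K) A k <= VA) -> (forall K, \sum_(k < K) B k <= VB) ->
  (forall i j, rnorm (m i j) <= A i * B j) ->
  forall e : R, 0 < e -> exists K0, forall K, (K0 <= K)%N ->
    rnorm (\sum_(k < K) \sum_(i < k.+1) m i (k - i)%N - \sum_(i < K) \sum_(j < K) m i j) <= e.
Proof.
move=> A0 B0 hA hB hm e e0.
have VA0 : 0 <= VA by have := hA 0%N; rewrite big_ord0.
have VB0 : 0 <= VB by have := hB 0%N; rewrite big_ord0.
pose d := e / (VA + VB + 1).
have D0 : 0 < VA + VB + 1 by lra.
have d0 : 0 < d by rewrite divr_gt0.
have [nA tA] := bounded_sum_tail A0 hA d0.
have [nB tB] := bounded_sum_tail B0 hB d0.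
pose n0 := maxn nA nB; exists (n0 + n0)%N => K hK.
rewrite triangle_sum -sumrB; apply: le_trans (rnorm_sum _ _ _) _.
pose SA n := \sum_(k < n) A k; pose SB n := \sum_(k < n) B k.
have row (i : 'I_K) : rnorm (\sum_(j < (K - i)) m i j - \sum_(j < K) m i j) <=
    A i * (SB K - SB (K - i)%N).
  rewrite /SB -!(big_mkord xpredT (m i)) -!(big_mkord xpredT B).
  rewrite !(big_cat_nat (leq0n (K - i)) (leq_subr i K)) /=.
  rewrite opprD addNKr rnormN [X in A i * (X - _)]addrC addrK mulr_sumr.
  by apply: le_trans (rnorm_sum _ _ _) _; apply: ler_sum => j _; exact: hm.
apply: le_trans (ler_sum _ (fun i _ => row i)) _.
rewrite -(big_mkord xpredT (fun i => A i * (SB K - SB (K - i)%N))).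
rewrite (big_cat_nat (leq0n (K - n0)) (leq_subr n0 K)) /=.
have -> : e = (VA + VB + 1) * d by rewrite mulrCA divff ?mulr1 // gt_eqF.
apply: (@le_trans _ _ (VA * d + d * VB)); last by rewrite !mulrDl mul1r; lra.
apply: lerD.
  apply: (@le_trans _ _ (SA (K - n0)%N * d)); last by rewrite ler_wpM2r ?hA // ltW.
  rewrite /SA -(big_mkord xpredT A) mulr_suml !big_nat; apply: ler_sum => i /andP[_ hi].
  rewrite ler_wpM2l // tB ?leq_subr //.
  by rewrite (leq_trans (leq_maxr nA nB)) // -/n0 leq_subRL ?(leq_trans (ltnW hi)) ?leq_subr //; rewrite addnC -leq_subRL ?(leq_trans _ hK) ?leq_addr // ltnW.
apply: (@le_trans _ _ ((SA K - SA (K - n0)%N) * VB)).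
  rewrite /SA -!(big_mkord xpredT A) (big_cat_nat (leq0n (K - n0)) (leq_subr n0 K)) /=.
  rewrite [X in _ <= (X - _) * _]addrC addrK mulr_suml; apply: ler_sum => i _.
  rewrite ler_wpM2l // lerBlDr (le_trans (hB K)) // lerDl.
  by apply: sumr_ge0.
rewrite ler_wpM2r // tA ?leq_subr //.
by rewrite (leq_trans (leq_maxl nA nB)) // -/n0 leq_subRL ?(leq_trans _ hK) ?leq_addr.
Qed.

End Cauchy.

(** Dividing by the lowest power present and letting the variable tend to [0]
    isolates the lowest nonzero coefficient. *)
Lemma power_series_eq0 (K : numFieldType) (d : nat -> K) (B : K) :
  (forall k, `|d k| <= B) ->
  (forall e : K, 0 < e -> exists w, 0 < `|w| < e /\
     (fun n => \sum_(k < n) d k * w ^+ k) @ \oo --> (0 : K)) ->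
  forall k, d k = 0.
Proof.
move=> dB dw k; elim/ltn_ind: k => m IH.
have B0 : 0 <= B := le_trans (normr_ge0 _) (dB 0%N).
apply/eqP; rewrite -normr_eq0; apply/negP => /negP dm0.
have dm : 0 < `|d m| by rewrite lt_def dm0 normr_ge0.
have B1 : 0 < B + 1 by rewrite ltr_wpDl.
pose e := `|d m| / (4%:R * (B + 1)).
have e0 : 0 < e by rewrite divr_gt0 // mulr_gt0.
have eh : e <= 4%:R^-1.
  rewrite ler_pdivrMr ?mulr_gt0 // mulrA mulVf ?pnatr_eq0 // mul1r.
  by rewrite (le_trans (dB m)) // lerDl.
have [w [/andP[w0 we] cw]] := dw e e0.
have w4 : `|w| <= 4%:R^-1 := le_trans (ltW we) eh.
have w1 : `|w| < 1.
  by rewrite (le_lt_trans w4) // invf_lt1 // ltr1n.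
pose x := `|w|; have x0 : 0 <= x by exact: normr_ge0.
have geo n : (1 - x) * \sum_(k < n) x ^+ k <= 1.
  by rewrite -opprB mulNr -subrX1 opprB lerBlDr lerDl exprn_ge0.
have x1 : 0 < 1 - x by rewrite subr_gt0.
have xh : 2%:R^-1 <= 1 - x.
  rewrite lerBrDr -lerBrDl (le_trans w4) //.
  have -> : 1 - 2%:R^-1 = 2%:R^-1 :> K by field.
  by rewrite lef_pV2 ?posrE // ler_nat.
have tail n : `|\sum_(k < n) d (m.+1 + k)%N * w ^+ k| <= 2%:R * B.
  apply: le_trans (ler_norm_sum _ _ _) _.
  apply: (@le_trans _ _ (B * \sum_(k < n) x ^+ k)).
    rewrite mulr_sumr; apply: ler_sum => k _.
    by rewrite normrM normrX ler_wpM2r // exprn_ge0.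
  rewrite mulrC ler_wpM2r // -(ler_pM2l x1) (le_trans (geo n)) //.
  rewrite (@le_trans _ _ (2%:R^-1 * 2%:R)) ?mulVf ?pnatr_eq0 //.
  by rewrite -[X in X <= _](mulVf (x := 2%:R)) ?pnatr_eq0 // ler_wpM2r.
have low n : \sum_(k < m.+1 + n) d k * w ^+ k =
    w ^+ m * (d m + w * \sum_(k < n) d (m.+1 + k)%N * w ^+ k).
  rewrite big_split_ord /= big_ord_recr /= big1 ?add0r; last first.
    by move=> j _; rewrite IH ?mul0r.
  rewrite mulrDr mulrC; congr (_ + _); rewrite !mulr_sumr; apply: eq_bigr => j _.
  by rewrite /= exprD exprS; ring.
have bd n : x ^+ m * (`|d m| / 2%:R) <= `|\sum_(k < m.+1 + n) d k * w ^+ k|.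
  rewrite low normrM normrX ler_wpM2l ?exprn_ge0 //.
  apply: le_trans (lerB_normD _ _); rewrite lerBrDl normrM.
  apply: (@le_trans _ _ (e * (2%:R * (B + 1)) + `|d m| / 2%:R)).
    rewrite lerD2r ler_pM //; first exact: ltW.
    by rewrite (le_trans (tail n)) // ler_wpM2l // lerDl.
  rewrite /e le_eqVlt; apply/orP; left; apply/eqP; field.
  by rewrite gt_eqF.
move/cvgrPdist_lt: cw => /(_ (x ^+ m * (`|d m| / 2%:R))) [|N _ hN].
  by rewrite mulr_gt0 ?exprn_gt0 // divr_gt0.
have := hN (m.+1 + N)%N (leq_addl _ _); rewrite sub0r normrN => /(le_lt_trans (bd N)).
by rewrite ltxx.
Qed.

(** * Discretization of the integrals over a semigroup *)

Lemma cvg_sum_ord {R : realType} K (u : nat -> nat -> R) (l : nat -> R) :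
  (forall k, u k @ \oo --> l k) ->
  (fun J => \sum_(k < K) u k J) @ \oo --> \sum_(k < K) l k.
Proof.
move=> h; elim: K => [|K IH].
  rewrite big_ord0 (_ : (fun J => _) = fun=> 0); first exact: cvg_cst.
  by apply/funext => J; rewrite big_ord0.
rewrite big_ord_recr (_ : (fun J => _) = fun J => \sum_(k < K) u k J + u K J).
  exact: cvgD.
by apply/funext => J; rewrite big_ord_recr.
Qed.

Section Combination.
Context {R : realType} {V : normedModType R[i]}.
Implicit Types (p : finmeas R) (h : R -> V).

Lemma riemann_comb p (b : nat -> R -> R) (v : nat -> V) h K J :
  riemann p (fun s => \sum_(k < K) (b k s)%:C *: v k - h s) J =
  \sum_(k < K) (riemannR p (b k) J)%:C *: v k - riemann p h J.
Proof.
rewrite /riemann /riemannR.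
under eq_bigr do rewrite scalerBr scaler_sumr.
rewrite sumrB exchange_big /=; congr (_ - _); apply: eq_bigr => k _.
rewrite rmorph_sum /= scaler_suml; apply: eq_bigr => j _.
by rewrite scalerA -rmorphM.
Qed.

Lemma riemann_norm p h J : rnorm (riemann p h J) <= riemannR p (@rnorm R V \o h) J.
Proof.
apply: le_trans (rnorm_sum _ _ _) _; apply: ler_sum => j _.
by rewrite rnormZr ger0_norm // Iplus_ge0 // => s _; rewrite indicE.
Qed.

Lemma continuous_real_scale (b : R -> R) (v : V) : continuous b ->
  continuous (fun s => (b s)%:C *: v).
Proof.
move=> cb s; apply: (@cvg_rnorm_le _ _ _ _ _ _ _ (fun r => `|b r - b s| * rnorm v)).
  by move=> r; rewrite -scalerBl -rmorphB rnormZr.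
rewrite -[X in _ --> X](mul0r (rnorm v)); apply: cvgMl.
have c : (fun r => `|b r - b s|) @ s --> `|b s - b s|.
  by apply: cvg_norm; apply: cvgB; [exact: cb|exact: cvg_cst].
by rewrite subrr normr0 in c.
Qed.

Lemma continuous_comb (b : nat -> R -> R) (v : nat -> V) K :
  (forall k, continuous (b k)) -> continuous (fun s => \sum_(k < K) (b k s)%:C *: v k).
Proof.
move=> cb; elim: K => [|K IH].
  by under eq_fun do rewrite big_ord0; move=> s; exact: cvg_cst.
under eq_fun do rewrite big_ord_recr /=.
by move=> s; apply: cvgD; [exact: IH|exact: continuous_real_scale].
Qed.

(** The Bochner integral of [h] is as close to that of a finite combination of
    constant vectors as the functions are in the mean; with [K = 0] this is the
    norm bound. *)
Lemma bochner_comb p (b : nat -> R -> R) (v : nat -> V) h (B : R) K y :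
  (forall k, continuous (b k)) -> (forall k s, 0 <= s -> `|b k s| <= 1) ->
  continuous h -> (forall s, 0 <= s -> rnorm (h s) <= B) ->
  riemann p h @ \oo --> y ->
  rnorm (\sum_(k < K) (Iplus p (b k))%:C *: v k - y) <=
  Iplus p (fun s => rnorm (\sum_(k < K) (b k s)%:C *: v k - h s)).
Proof.
move=> cb b1 ch hB cy.
pose f s := \sum_(k < K) (b k s)%:C *: v k - h s.
have cf : continuous f.
  by move=> s; apply: cvgB; [exact: continuous_comb|exact: ch].
have crf : continuous (@rnorm R V \o f).
  have := continuous_rnorm_comp (v := 0) cf.
  by rewrite (_ : (fun x => _) = @rnorm R V \o f) //; apply/funext => s /=; rewrite subr0.
have fB s : 0 <= s -> rnorm (f s) <= \sum_(k < K) rnorm (v k) + B.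
  move=> s0; rewrite (le_trans (rnormB _ _)) // lerD ?hB //.
  rewrite (le_trans (rnorm_sum _ _ _)) //; apply: ler_sum => k _.
  by rewrite rnormZr ler_piMl ?rnorm_ge0 // b1.
pose r J := \sum_(k < K) `|Iplus p (b k) - riemannR p (b k) J| * rnorm (v k) +
  (riemannR p (@rnorm R V \o f) J + rnorm (riemann p h J - y)).
have cr : r @ \oo --> \sum_(k < K) `|Iplus p (b k) - Iplus p (b k)| * rnorm (v k) +
    (Iplus p (@rnorm R V \o f) + 0).
  apply: cvgD; last first.
    apply: cvgD; last by move/cvg_rnorm: cy.
    apply: riemannR_cvg => // s s0 /=.
    by rewrite ger0_norm; [exact: fB|exact: rnorm_ge0].
  apply: (cvg_sum_ord (u := fun k J => `|Iplus p (b k) - riemannR p (b k) J| * rnorm (v k))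
    (l := fun k => `|Iplus p (b k) - Iplus p (b k)| * rnorm (v k))) => k; apply: cvgMl; apply: cvg_norm; apply: cvgB.
    exact: cvg_cst.
  apply: (riemannR_cvg _ (B := 1)) => // s s0; exact: b1.
have E : \sum_(k < K) `|Iplus p (b k) - Iplus p (b k)| * rnorm (v k) +
    (Iplus p (@rnorm R V \o f) + 0) = Iplus p (@rnorm R V \o f).
  by rewrite big1 ?add0r ?addr0 // => k _; rewrite subrr normr0 mul0r.
rewrite -[leRHS]E; apply: (cvgr_to_ge cr); apply: nearW => J.
have -> : \sum_(k < K) (Iplus p (b k))%:C *: v k - y =
  \sum_(k < K) (Iplus p (b k) - riemannR p (b k) J)%:C *: v k +
  (riemann p f J + (riemann p h J - y)).
  rewrite riemann_comb subrKA addrA; congr (_ - _).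
  by rewrite -big_split /=; apply: eq_bigr => k _; rewrite -scalerDl -rmorphD subrK.
apply: le_trans (rnormD _ _) _; apply: lerD.
  apply: le_trans (rnorm_sum _ _ _) _; apply: ler_sum => k _.
  by rewrite rnormZr.
apply: le_trans (rnormD _ _) _; apply: lerD => //.
exact: riemann_norm.
Qed.

End Combination.

Section HillePhillips.
Context {R : realType} {X : completeNormedModType R[i]}.
Variables (T : R -> {linear X -> X}) (M : R).
Hypothesis hT : C0_semigroup T.
Hypothesis M0 : 0 <= M.
Hypothesis TM : forall t x, 0 <= t -> rnorm (T t x) <= M * rnorm x.
Implicit Types (p : finmeas R) (x : X).

(** Total by choice; [hpintP] shows that the integral exists and is unique. *)
Definition hpint p x : X :=
  xget 0 [set y | bochner_integral p (fun s => T s x) y].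

Let continuous_orb x : continuous (orb T x) := continuous_orb hT TM (x := x).

Lemma hpint_riemann p x : riemann p (orb T x) @ \oo --> hpint p x.
Proof.
have bound s : 0 <= s -> rnorm (orb T x s) <= M * rnorm x := @orb_bound _ _ _ _ TM x s.
have e s : 0 <= s -> orb T x s = T s x := @orbE _ _ T x s.
have [y [hy c]] := bochner_riemann p (@continuous_orb x) bound.
rewrite /hpint; case: xgetP => [y' _ /= hy'|/(_ y) []]; last first.
  exact: bochner_integral_ext hy.
suff -> : y' = y by [].
apply: (bochner_integral_unique (bmv_continuous (@continuous_orb x) bound)) hy.
by apply: bochner_integral_ext hy' => s s0; rewrite e.
Qed.

Lemma hpintP p x y : bochner_integral p (fun s => T s x) y <-> y = hpint p x.
Proof.
have bound s : 0 <= s -> rnorm (orb T x s) <= M * rnorm x := @orb_bound _ _ _ _ TM x s.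
have e s : 0 <= s -> orb T x s = T s x := @orbE _ _ T x s.
split.
  move=> hy; have hy' : bochner_integral p (orb T x) y.
    by apply: bochner_integral_ext hy => s s0; rewrite e.
  have c := bochner_riemann_cvg (@continuous_orb x) bound hy'.
  exact: cvg_unique c (hpint_riemann (p := p) (x := x)).
move=> ->; have [y' [hy' c]] := bochner_riemann p (@continuous_orb x) bound.
rewrite (cvg_unique _ (@hpint_riemann p x) c) //.
exact: bochner_integral_ext hy'.
Qed.

Lemma hpint_norm p x : rnorm (hpint p x) <= M * mass p * rnorm x.
Proof.
have bound s : 0 <= s -> rnorm (orb T x s) <= M * rnorm x := @orb_bound _ _ _ _ TM x s.
have c0 (k : nat) : continuous (fun _ : R => (0 : R)) by move=> s; exact: cvg_cst.
have b0 (k : nat) (s : R) : 0 <= s -> `|(fun _ : R => (0 : R)) s| <= 1.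
  by rewrite normr0.
have := @bochner_comb _ _ p (fun _ _ => 0) (fun=> 0) _ _ 0%N _ c0 b0 (@continuous_orb x) bound
  (@hpint_riemann p x).
rewrite big_ord0 sub0r rnormN => /le_trans; apply.
rewrite mulrAC -Iplus_cst; apply: Iplus_le.
- rewrite (_ : (fun s => _) = (fun s => rnorm (orb T x s - 0))).
    exact: (bmv_continuous (@continuous_orb x) bound).
  by apply/funext => s; rewrite big_ord0 sub0r subr0 rnormN.
- exact: bm_cst.
- by move=> s s0; rewrite big_ord0 sub0r rnormN bound.
Qed.

(** The Poisson law of mean [s * (N+1)], scaled down by [N+1], concentrates at [s];
    these are the masses of the mixture of such laws under [p]. *)
Definition pois_coef p (N k : nat) : R := Iplus p (fun s => pois (s * N.+1%:R) k).

Definition tpt (N k : nat) : R := k%:R / N.+1%:R.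

Lemma tpt_ge0 N k : 0 <= tpt N k.
Proof. by rewrite divr_ge0. Qed.

(** Operators of the form [sum_k a N k *: T (k / (N+1))] converging strongly to
    [u], the truncation [K] being chosen after the mesh. *)
Definition approx (a : nat -> nat -> R) (u : X -> X) := forall x (e : R), 0 < e ->
  exists N0, forall N, (N0 <= N)%N -> exists K0, forall K, (K0 <= K)%N ->
    rnorm (\sum_(k < K) (a N k)%:C *: T (tpt N k) x - u x) <= e.

(** Chebyshev's inequality for the Poisson law of mean [s * N.+1]. *)
Lemma pois_orbit_dist x (d e : R) N K s :
  (forall s r, 0 <= s -> 0 <= r -> `|s - r| < d -> rnorm (T s x - T r x) <= e) ->
  0 < d -> 0 <= e -> 0 <= s ->
  rnorm (\sum_(k < K) (pois (s * N.+1%:R) k)%:C *: T (tpt N k) x - orb T x s) <=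
  e + Num.min (2 * (M * rnorm x)) (2 * (M * rnorm x) / d ^+ 2 * s * N.+1%:R^-1) +
  M * rnorm x * (1 - \sum_(k < K) pois (s * N.+1%:R) k).
Proof.
move=> hd d0 e0 s0; rewrite orbE //.
set l := s * N.+1%:R; set D := M * rnorm x.
have N0 : 0 < N.+1%:R :> R by rewrite ltr0n.
have l0 : 0 <= l by rewrite mulr_ge0.
have D0 : 0 <= D by rewrite mulr_ge0 ?rnorm_ge0.
have S1 := pois_sum_le1 K l0.
have P0 k := pois_ge0 k l0.
have -> : \sum_(k < K) (pois l k)%:C *: T (tpt N k) x - T s x =
  \sum_(k < K) (pois l k)%:C *: (T (tpt N k) x - T s x) -
  (1 - \sum_(k < K) pois l k)%:C *: T s x.
  under [in RHS]eq_bigr do rewrite scalerBr.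
  rewrite sumrB -scaler_suml -rmorph_sum rmorphB /= rmorph1 scalerBl scale1r.
  by rewrite opprB addrA subrK.
apply: le_trans (rnormB _ _) _; apply: lerD; last first.
  by rewrite rnormZr ger0_norm ?subr_ge0 // mulrC ler_wpM2r ?subr_ge0 // TM.
apply: le_trans (rnorm_sum _ _ _) _.
have F2 k : rnorm (T (tpt N k) x - T s x) <= 2 * D.
  rewrite (le_trans (rnormB _ _)) //; have := TM x (tpt_ge0 N k); have := TM x s0.
  rewrite -/D; lra.
have sE k : tpt N k - s = (k%:R - l) / N.+1%:R.
  by rewrite /tpt /l mulrBl mulfK // gt_eqF.
have C0 : 0 <= 2 * D / d ^+ 2 by rewrite divr_ge0 ?sqr_ge0 // mulr_ge0.
have key k : rnorm (T (tpt N k) x - T s x) <=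
    e + 2 * D / d ^+ 2 * ((k%:R - l) / N.+1%:R) ^+ 2.
  have [hk|hk] := ltP `|tpt N k - s| d.
    rewrite (le_trans (hd _ _ (tpt_ge0 N k) s0 hk)) // lerDl.
    by rewrite mulr_ge0 ?sqr_ge0.
  rewrite (le_trans (F2 k)) // -[leLHS]add0r lerD //.
  rewrite -[leLHS](divfK (x := d ^+ 2)); last by rewrite gt_eqF ?exprn_gt0.
  rewrite ler_wpM2l // -sE.
  by rewrite -[leRHS]real_normK ?num_real // ler_pXn2r ?nnegrE // ltW.
have [h|h] := leP (2 * D) (2 * D / d ^+ 2 * s * N.+1%:R^-1).
  apply: (@le_trans _ _ (\sum_(k < K) pois l k * (2 * D))).
    apply: ler_sum => k _; rewrite rnormZr (ger0_norm (P0 k)).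
    by rewrite ler_wpM2l.
  by rewrite -mulr_suml -[leLHS]add0r lerD // ler_piMl // mulr_ge0.
apply: (@le_trans _ _ (\sum_(k < K)
    (pois l k * e + 2 * D / d ^+ 2 / N.+1%:R ^+ 2 * ((k%:R - l) ^+ 2 * pois l k)))).
  apply: ler_sum => k _; rewrite rnormZr (ger0_norm (P0 k)).
  apply: le_trans (ler_wpM2l (P0 k) (key k)) _; rewrite mulrDr lerD2l exprMn exprVn.
  by rewrite le_eqVlt; apply/orP; left; apply/eqP; ring.
rewrite big_split /=; apply: lerD; first by rewrite -mulr_suml ler_piMl.
rewrite -mulr_sumr.
apply: (@le_trans _ _ (2 * D / d ^+ 2 / N.+1%:R ^+ 2 * l)).
  by rewrite ler_wpM2l ?pois_variance // divr_ge0 ?sqr_ge0.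
rewrite le_eqVlt; apply/orP; left; apply/eqP; rewrite /l.
by field; rewrite nat1r (gt_eqF d0) (gt_eqF N0).
Qed.

Lemma bm_orbit_comb (b : nat -> R -> R) (v : nat -> X) x K :
  (forall k, continuous (b k)) -> (forall k s, 0 <= s -> `|b k s| <= 1) ->
  bm (fun s => rnorm (\sum_(k < K) (b k s)%:C *: v k - orb T x s)).
Proof.
move=> cb b1.
apply: (bm_continuous (B := \sum_(k < K) rnorm (v k) + M * rnorm x)).
  have cf : continuous (fun s => \sum_(k < K) (b k s)%:C *: v k - orb T x s).
    by move=> s; apply: cvgB; [exact: continuous_comb|exact: continuous_orb].
  have := continuous_rnorm_comp (v := 0) cf.
  by under eq_fun do rewrite subr0.
move=> s s0; rewrite ger0_norm ?rnorm_ge0 // (le_trans (rnormB _ _)) //.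
apply: lerD; last by rewrite orbE // TM.
rewrite (le_trans (rnorm_sum _ _ _)) //; apply: ler_sum => k _.
by rewrite rnormZr ler_piMl ?rnorm_ge0 // b1.
Qed.

Lemma hpint_near p x v :
  rnorm ((mass p)%:C *: v - hpint p x) <= Iplus p (fun s => rnorm (v - T s x)).
Proof.
have bound s : 0 <= s -> rnorm (orb T x s) <= M * rnorm x := @orb_bound _ _ _ _ TM x s.
have c1 (k : nat) : continuous (fun _ : R => (1 : R)) by move=> s; exact: cvg_cst.
have b1 (k : nat) (s : R) : 0 <= s -> `|(fun _ : R => (1 : R)) s| <= 1.
  by rewrite normr1.
have := @bochner_comb _ _ p (fun _ _ => 1) (fun=> v) _ _ 1%N _ c1 b1 (@continuous_orb x) bound
  (@hpint_riemann p x).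
rewrite big_ord1 Iplus_cst mul1r => /le_trans; apply.
rewrite le_eqVlt; apply/orP; left; apply/eqP; apply: Iplus_eq => s s0.
by rewrite big_ord1 scale1r orbE.
Qed.

(** The weights [pois_coef] depend on [p] through its Laplace transform alone, which
    makes this approximation the source of uniqueness and multiplicativity. *)
Lemma hpint_approx p : approx (pois_coef p) (hpint p).
Proof.
move=> x e e0; pose D := M * rnorm x; pose m := mass p.
have D0 : 0 <= D by rewrite mulr_ge0 ?rnorm_ge0.
have m0 : 0 <= m := mass_ge0 p.
pose e1 := e / (3%:R * (m + 1)).
have m1 : 0 < 3%:R * (m + 1) by rewrite mulr_gt0 // ltr_wpDl.
have e10 : 0 < e1 by rewrite divr_gt0.
have e1m : e1 * m <= e / 3%:R.
  rewrite /e1 mulrAC ler_pdivrMr // mulrA divfK ?pnatr_eq0 // mulrDr mulr1.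
  by rewrite lerDl ltW.
have [d d0 hd] := semigroup_modulus hT TM x e10.
pose C := 2 * D / d ^+ 2.
have C0 : 0 <= C by rewrite divr_ge0 ?sqr_ge0 // mulr_ge0.
pose g N (s : R) := Num.min (2 * D) (C * s * N.+1%:R^-1).
have gp N s : 0 <= s -> 0 <= g N s.
  move=> s0; rewrite le_min mulr_ge0 //=.
  by apply: mulr_ge0; [exact: mulr_ge0|rewrite invr_ge0].
have gB N s : 0 <= s -> `|g N s| <= 2 * D.
  move=> s0; rewrite ger0_norm; first by rewrite ge_min lexx.
  exact: gp.
have bg N : bm (g N).
  split; last by exists (2 * D); exact: gB.
  apply: measurable_minr; first exact: measurable_cst.
  by do 2 (apply: measurable_funM => //); exact: measurable_cst.
have g0 : (fun N => Iplus p (g N)) @ \oo --> (0 : R).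
  rewrite -[X in _ --> X](mul0r m) -Iplus_cst.
  apply: (@Iplus_dct _ _ _ _ (2 * D)) => //; first exact: bm_cst.
  move=> s s0; apply: (@squeeze_cvgr _ _ _ _ (fun=> 0) (fun N => C * s * N.+1%:R^-1)).
  - apply: nearW => N; rewrite ge_min lexx orbT andbT.
    exact: gp.
  - exact: cvg_cst.
  - rewrite -[X in _ --> X](mulr0 (C * s)); apply: cvgMr; exact: cvg_harmonic.
have e3 : 0 < e / 3%:R by rewrite divr_gt0.
have [N0 hN0] := cvgn_le_eps g0 e3.
exists N0 => N hN.
have Np : 0 <= N.+1%:R :> R by [].
have bP k := @bm_pois R N.+1%:R k Np.
pose t K (s : R) := D * (1 - \sum_(k < K) pois (s * N.+1%:R) k).
have bt K : bm (t K).
  by apply: bmZ; apply: bmB; [exact: bm_cst|exact: bm_sum].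
have tB K s : 0 <= s -> 0 <= t K s <= D.
  move=> s0; have sN : 0 <= s * N.+1%:R by rewrite mulr_ge0.
  rewrite mulr_ge0 ?subr_ge0 ?pois_sum_le1 //= ler_piMr // lerBlDr lerDl.
  by apply: sumr_ge0 => k _; exact: pois_ge0.
have t0 : (fun K => Iplus p (t K)) @ \oo --> (0 : R).
  rewrite -[X in _ --> X](mul0r m) -Iplus_cst.
  apply: (@Iplus_dct _ _ _ _ D) => //; first exact: bm_cst.
    by move=> K s s0; have /andP[h1 h2] := tB K s s0; rewrite ger0_norm.
  move=> s s0; rewrite -[X in _ --> X](mulr0 D) -[X in D * X](subrr 1); apply: cvgMr.
  by apply: cvgB; [exact: cvg_cst|exact: pois_sum_cvg].
have [K0 hK0] := cvgn_le_eps t0 e3.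
exists K0 => K hK.
have bound s : 0 <= s -> rnorm (orb T x s) <= M * rnorm x := @orb_bound _ _ _ _ TM x s.
have cP k : continuous (fun s : R => pois (s * N.+1%:R) k) := @continuous_pois R N.+1%:R k.
have P1 k s : 0 <= s -> `|(fun s : R => pois (s * N.+1%:R) k) s| <= 1.
  by move=> s0; rewrite ger0_norm ?pois_ge0 ?pois_le1 ?mulr_ge0.
have := @bochner_comb _ _ p (fun k s => pois (s * N.+1%:R) k) (fun k => T (tpt N k) x)
  _ _ K _ cP P1 (@continuous_orb x) bound (@hpint_riemann p x).
move=> /le_trans; apply.
apply: (@le_trans _ _ (Iplus p (fun s => e1 + g N s + t K s))).
  apply: Iplus_le.
  - exact: (@bm_orbit_comb (fun k s => pois (s * N.+1%:R) k) (fun k => T (tpt N k) x)).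
  - by apply: bmD => //; apply: bmD => //; exact: bm_cst.
  - by move=> s s0; apply: pois_orbit_dist => //; exact: ltW.
rewrite IplusD //; last by apply: bmD => //; exact: bm_cst.
rewrite IplusD //; last exact: bm_cst.
rewrite Iplus_cst -/m.
have := hN0 N hN; have := hK0 K hK; rewrite !subr0 => /ler_normlW h1 /ler_normlW h2.
by have -> : e = e / 3%:R + e / 3%:R + e / 3%:R; [field|rewrite lerD // lerD].
Qed.

End HillePhillips.

(** * The operational calculus *)

Section Laplace.
Context {R : realType}.
Implicit Types (p : finmeas R) (z : R).

Definition Lap p z : R := Iplus p (fun s => expR (- (s * z))).

Lemma bm_exp z : 0 <= z -> bm (fun s : R => expR (- (s * z))).
Proof.
move=> z0; apply: (bm_continuous (B := 1)).
  move=> s; apply: (@continuous_comp R R R (fun s => - (s * z)) expR).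
    by apply: cvgN; apply: cvgMl; exact: cvg_id.
  exact: continuous_expR.
move=> s s0; rewrite ger0_norm ?expR_ge0 // -[leRHS]expR0 ler_expR oppr_le0.
exact: mulr_ge0.
Qed.

(** Coefficients, for each mesh [1/(N+1)], of a power series in [T (1/(N+1))];
    their generating function is [phi] in the variable [(1 - w) * (N+1)]. *)
Definition disc (V : R) (phi : R -> R) (a : nat -> nat -> R) :=
  (forall N K, \sum_(k < K) `|a N k| <= V) /\
  forall N w, 0 <= w < 1 ->
    (fun K => \sum_(k < K) a N k * w ^+ k) @ \oo --> phi ((1 - w) * N.+1%:R).

Lemma disc_pois p : disc (mass p) (Lap p) (pois_coef p).
Proof.
have Np (N : nat) : 0 <= N.+1%:R :> R by [].
have bP N k := @bm_pois R N.+1%:R k (Np N).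
split=> [N K|N w /andP[w0 w1]].
  have -> : \sum_(k < K) `|pois_coef p N k| =
      Iplus p (fun s => \sum_(k < K) pois (s * N.+1%:R) k).
    rewrite Iplus_sum //; apply: eq_bigr => k _; rewrite ger0_norm //.
    by apply: Iplus_ge0 => s s0; rewrite pois_ge0 // mulr_ge0.
  rewrite -[leRHS]mul1r -Iplus_cst; apply: Iplus_le.
  - exact: bm_sum.
  - exact: bm_cst.
  - by move=> s s0; rewrite pois_sum_le1 // mulr_ge0.
rewrite (_ : (fun K => _) = fun K => Iplus p (fun s =>
    \sum_(k < K) w ^+ k * pois (s * N.+1%:R) k)); last first.
  apply/funext => K; rewrite Iplus_sum; last by move=> k; exact: bmZ.
  by apply: eq_bigr => k _; rewrite mulrC IplusZ.
apply: (@Iplus_dct _ _ _ _ 1).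
- by move=> K; apply: bm_sum => k; exact: bmZ.
- by apply: bm_exp; rewrite mulr_ge0 // subr_ge0 ltW.
- move=> K s s0; have sN : 0 <= s * N.+1%:R by rewrite mulr_ge0.
  rewrite ger0_norm; last first.
    by apply: sumr_ge0 => k _; rewrite mulr_ge0 ?exprn_ge0 ?pois_ge0.
  apply: le_trans (pois_sum_le1 K sN); apply: ler_sum => k _.
  by rewrite ler_piMl ?pois_ge0 // exprn_ile1 // ltW.
- move=> s s0; have -> : s * ((1 - w) * N.+1%:R) = s * N.+1%:R * (1 - w) by ring.
  have := @pois_gen_cvg R (s * N.+1%:R) w.
  by under eq_fun do under eq_bigr do rewrite mulrC.
Qed.

Lemma discB V W phi psi a b : disc V phi a -> disc W psi b ->
  disc (V + W) (fun z => phi z - psi z) (fun N k => a N k - b N k).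
Proof.
move=> [a1 a2] [b1 b2]; split=> [N K|N w hw].
  apply: le_trans (lerD (a1 N K) (b1 N K)); rewrite -big_split /=.
  by apply: ler_sum => k _; exact: ler_normB.
rewrite (_ : (fun K => _) = fun K => \sum_(k < K) a N k * w ^+ k - \sum_(k < K) b N k * w ^+ k).
  by apply: cvgB; [exact: a2|exact: b2].
by apply/funext => K /=; rewrite -sumrB; apply: eq_bigr => k _; rewrite mulrBl.
Qed.

(** A power series is determined by its values near [0]. *)
Lemma disc_unique V W phi psi a b : disc V phi a -> disc W psi b ->
  (forall z, 0 < z -> phi z = psi z) -> forall N k, a N k = b N k.
Proof.
move=> [a1 a2] [b1 b2] e N k; apply/eqP; rewrite -subr_eq0; apply/eqP.
apply: (@power_series_eq0 R (fun k => a N k - b N k) (V + W)).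
  have abs (c : nat -> R) (B : R) (j : nat) : (forall K, \sum_(k < K) `|c k| <= B) -> `|c j| <= B.
    by move/(_ j.+1); rewrite big_ord_recr /=; apply: le_trans; rewrite lerDr sumr_ge0.
  move=> j; apply: le_trans (ler_normB _ _) _.
  by apply: lerD; [exact: (abs (a N))|exact: (abs (b N))].
move=> e0 e00; pose w := Num.min (e0 / 2) (1 / 2).
have w0 : 0 < w by rewrite lt_min !divr_gt0.
have w1 : w < 1 by rewrite gt_min [X in _ || X]ltr_pdivrMr // mul1r ltr1n orbT.
exists w; split.
  rewrite ger0_norm ?ltW // w0 /= gt_min [X in X || _]ltr_pdivrMr //.
  by rewrite ltr_pMr // ltr1n.
have hw : 0 <= w < 1 by rewrite w1 ltW.
rewrite (_ : (fun n => _) = fun K => \sum_(k < K) a N k * w ^+ k - \sum_(k < K) b N k * w ^+ k).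
  have c : (fun K => \sum_(k < K) a N k * w ^+ k - \sum_(k < K) b N k * w ^+ k) @ \oo -->
      phi ((1 - w) * N.+1%:R) - psi ((1 - w) * N.+1%:R).
    by apply: cvgB; [exact: a2|exact: b2].
  by rewrite e ?subrr in c => //; rewrite mulr_gt0 // subr_gt0.
by apply/funext => K /=; rewrite -sumrB; apply: eq_bigr => j _; rewrite mulrBl.
Qed.

Definition cauchy_prod (a b : nat -> nat -> R) (N k : nat) : R :=
  \sum_(i < k.+1) a N i * b N (k - i)%N.

Lemma discM V W phi psi a b : disc V phi a -> disc W psi b ->
  disc (V * W) (fun z => phi z * psi z) (cauchy_prod a b).
Proof.
move=> [a1 a2] [b1 b2].
have W0 : 0 <= W by have := b1 0%N 0%N; rewrite big_ord0.
split=> [N K|N w /andP[w0 w1]].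
  apply: (@le_trans _ _ (\sum_(k < K) \sum_(i < k.+1) `|a N i| * `|b N (k - i)%N|)).
    apply: ler_sum => k _; apply: le_trans (ler_norm_sum _ _ _) _.
    by apply: ler_sum => i _; rewrite normrM.
  rewrite (triangle_sum (fun i j => `|a N i| * `|b N j|)).
  apply: (@le_trans _ _ (\sum_(i < K) `|a N i| * W)).
    by apply: ler_sum => i _; rewrite -mulr_sumr ler_wpM2l.
  by rewrite -mulr_suml ler_wpM2r.
have hw : 0 <= w < 1 by rewrite w0.
have cab : (fun K => (\sum_(k < K) a N k * w ^+ k) * (\sum_(k < K) b N k * w ^+ k)) @ \oo -->
    phi ((1 - w) * N.+1%:R) * psi ((1 - w) * N.+1%:R).
  by apply: cvgM; [exact: a2|exact: b2].
apply/cvgrPdist_le => e e0; have e2 : 0 < e / 2 by rewrite divr_gt0.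
pose m i j : R[i]^o := (a N i * b N j * w ^+ (i + j))%:C.
have hm i j : rnorm (m i j) <= `|a N i| * `|b N j|.
  rewrite -[m i j]mulr1 -[_ * 1]/(_ *: (1 : R[i]^o)) rnormZr.
  rewrite [rnorm _]/rnorm normr1 mulr1 !normrM ler_piMr ?mulr_ge0 //.
  by rewrite ger0_norm ?exprn_ge0 // exprn_ile1 // ltW.
have [K0 hK0] := square_minus_triangle (fun k => normr_ge0 (a N k))
  (fun k => normr_ge0 (b N k)) (a1 N) (b1 N) hm e2.
have [K1 hK1] := cvgn_le_eps cab e2.
exists (maxn K0 K1) => // K /=; rewrite geq_max => /andP[/hK0 h0 /hK1 h1].
have E : \sum_(k < K) \sum_(i < k.+1) m i (k - i)%N - \sum_(i < K) \sum_(j < K) m i j =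
  (\sum_(k < K) cauchy_prod a b N k * w ^+ k -
    (\sum_(k < K) a N k * w ^+ k) * (\sum_(k < K) b N k * w ^+ k))%:C.
  rewrite rmorphB !rmorph_sum /=; congr (_ - _).
    apply: eq_bigr => k _; rewrite /cauchy_prod mulr_suml rmorph_sum; apply: eq_bigr => i _.
    by rewrite /m subnKC // -ltnS.
  rewrite mulr_suml rmorph_sum; apply: eq_bigr => i _.
  rewrite mulr_sumr rmorph_sum; apply: eq_bigr => j _.
  by rewrite /m exprD /=; congr (_%:C); ring.
rewrite E -[X in rnorm X]mulr1 -[_ * 1]/(_ *: (1 : R[i]^o)) rnormZr in h0.
rewrite [rnorm _]/rnorm normr1 mulr1 in h0.
rewrite /= in h1.
rewrite (le_trans (ler_distD ((\sum_(k < K) a N k * w ^+ k) * (\sum_(k < K) b N k * w ^+ k)) _ _)) //.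
by rewrite [leRHS]splitr lerD // distrC.
Qed.

End Laplace.

Section Approx.
Context {R : realType} {X : completeNormedModType R[i]}.
Variables (T : R -> {linear X -> X}) (M : R).
Hypothesis hT : C0_semigroup T.
Hypothesis M0 : 0 <= M.
Hypothesis TM : forall t x, 0 <= t -> rnorm (T t x) <= M * rnorm x.
Implicit Types (p q : finmeas R) (x y : X) (u v : X -> X).

Lemma approxB a b u v : approx T a u -> approx T b v ->
  approx T (fun N k => a N k - b N k) (fun x => u x - v x).
Proof.
move=> ha hb x e e0; have e2 : 0 < e / 2 by rewrite divr_gt0.
have [Na hNa] := ha x _ e2; have [Nb hNb] := hb x _ e2.
exists (maxn Na Nb) => N; rewrite geq_max => /andP[/hNa [Ka hKa] /hNb [Kb hKb]].
exists (maxn Ka Kb) => K; rewrite geq_max => /andP[/hKa h1 /hKb h2].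
have -> : \sum_(k < K) (a N k - b N k)%:C *: T (tpt N k) x - (u x - v x) =
  (\sum_(k < K) (a N k)%:C *: T (tpt N k) x - u x) -
  (\sum_(k < K) (b N k)%:C *: T (tpt N k) x - v x).
  rewrite (eq_bigr (fun k : 'I_K => (a N k)%:C *: T (tpt N k) x - (b N k)%:C *: T (tpt N k) x)).
    by rewrite sumrB !opprD !opprK addrACA.
  by move=> k _; rewrite rmorphB scalerBl.
by rewrite (le_trans (rnormB _ _)) // [leRHS]splitr lerD.
Qed.

Lemma approx_unique a b u v : approx T a u -> approx T b v ->
  (forall N k, a N k = b N k) -> forall x, u x = v x.
Proof.
move=> ha hb ab x; apply: rnorm_le_eps => e e0.
have e2 : 0 < e / 2 by rewrite divr_gt0.
have [Na hNa] := ha x _ e2; have [Nb hNb] := hb x _ e2.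
have [Ka hKa] := hNa _ (leq_maxl Na Nb); have [Kb hKb] := hNb _ (leq_maxr Na Nb).
have h1 := hKa _ (leq_maxl Ka Kb); have h2 := hKb _ (leq_maxr Ka Kb).
pose S := \sum_(k < maxn Ka Kb) (a (maxn Na Nb) k)%:C *: T (tpt (maxn Na Nb) k) x.
apply: le_trans (rnorm_triangle S _ _) _; rewrite [leRHS]splitr; apply: lerD.
  by rewrite rdistC.
by rewrite /S; under eq_bigr do rewrite ab.
Qed.

Lemma approx_linear a u : approx T a u ->
  forall (c : R[i]) x y, u (c *: x + y) = c *: u x + u y.
Proof.
move=> ha c x y; apply: rnorm_le_eps => e e0.
pose C := complex.Re `|c| + 2.
have c0 : 0 <= complex.Re `|c| by have := @rnorm_ge0 R (R[i]^o) c.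
have C0 : 0 < C by rewrite ltr_wpDl.
have e2 : 0 < e / C by rewrite divr_gt0.
have [N1 h1] := ha (c *: x + y) _ e2; have [N2 h2] := ha x _ e2.
have [N3 h3] := ha y _ e2.
pose N := maxn N1 (maxn N2 N3).
have [K1 k1] := h1 N (leq_maxl _ _).
have [K2 k2] : exists K0, forall K, (K0 <= K)%N ->
    rnorm (\sum_(k < K) (a N k)%:C *: T (tpt N k) x - u x) <= e / C.
  by apply: h2; rewrite /N !leq_max leqnn !orbT.
have [K3 k3] : exists K0, forall K, (K0 <= K)%N ->
    rnorm (\sum_(k < K) (a N k)%:C *: T (tpt N k) y - u y) <= e / C.
  by apply: h3; rewrite /N !leq_max leqnn !orbT.
pose K := maxn K1 (maxn K2 K3).
have {}k1 := k1 K (leq_maxl _ _).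
have {}k2 : rnorm (\sum_(k < K) (a N k)%:C *: T (tpt N k) x - u x) <= e / C.
  by apply: k2; rewrite /K !leq_max leqnn !orbT.
have {}k3 : rnorm (\sum_(k < K) (a N k)%:C *: T (tpt N k) y - u y) <= e / C.
  by apply: k3; rewrite /K !leq_max leqnn !orbT.
set S := \sum_(k < K) (a N k)%:C *: T (tpt N k) (c *: x + y) in k1.
set Sx := \sum_(k < K) (a N k)%:C *: T (tpt N k) x in k2.
set Sy := \sum_(k < K) (a N k)%:C *: T (tpt N k) y in k3.
have SE : S = c *: Sx + Sy.
  rewrite /Sx scaler_sumr -big_split /=; apply: eq_bigr => k _.
  by rewrite linearP /= scalerDr !scalerA mulrC.
have -> : u (c *: x + y) - (c *: u x + u y) =
    - (S - u (c *: x + y)) + (c *: (Sx - u x) + (Sy - u y)).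
  by rewrite opprB scalerBr SE [X in _ = _ + X]addrACA subrKA opprD.
apply: le_trans (rnormD _ _) _; rewrite rnormN.
have -> : e = e / C + (complex.Re `|c| * (e / C) + e / C).
  by rewrite /C; field; rewrite gt_eqF.
apply: lerD => //; apply: le_trans (rnormD _ _) _; apply: lerD => //.
by rewrite rnormZ ler_wpM2l.
Qed.

Lemma tptD N i j : tpt N (i + j) = tpt N i + tpt N j :> R.
Proof. by rewrite /tpt natrD mulrDl. Qed.

(** The Cauchy product of power series in [T (1/(N+1))]; at this level the semigroup
    law is the addition of exponents. *)
Lemma approxM V W phi psi a b u v : disc V phi a -> disc W psi b ->
  approx T a u -> approx T b v -> approx T (cauchy_prod a b) (u \o v).
Proof.
move=> [a1 _] [b1 _] ha hb x e e0; have e3 : 0 < e / 3%:R by rewrite divr_gt0.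
have V0 : 0 <= V by have := a1 0%N 0%N; rewrite big_ord0.
have VM : 0 < V * M + 1 by rewrite ltr_wpDl // mulr_ge0.
have [Na hNa] := ha (v x) _ e3.
have eb : 0 < e / 3%:R / (V * M + 1) by rewrite divr_gt0.
have [Nb hNb] := hb x _ eb.
exists (maxn Na Nb) => N; rewrite geq_max => /andP[/hNa [Ka hKa] /hNb [Kb hKb]].
pose A k := M * rnorm x * `|a N k|.
have x0 := rnorm_ge0 x.
pose m i j := (a N i * b N j)%:C *: T (tpt N (i + j)) x.
have hm i j : rnorm (m i j) <= A i * `|b N j|.
  rewrite /m rnormZr normrM /A mulrC -mulrA.
  have := TM x (tpt_ge0 N (i + j)).
  by move=> /ler_wpM2r -/(_ _ (mulr_ge0 (normr_ge0 (a N i)) (normr_ge0 (b N j)))); rewrite mulrA.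
have A0 k : 0 <= A k by rewrite mulr_ge0 // mulr_ge0.
have A1 K : \sum_(k < K) A k <= M * rnorm x * V.
  by rewrite -mulr_sumr ler_wpM2l // mulr_ge0.
have [Km hKm] := square_minus_triangle A0 (fun k => normr_ge0 (b N k)) A1 (b1 N) hm e3.
exists (maxn Ka (maxn Kb Km)) => K.
rewrite !geq_max => /andP[/hKa h1 /andP[/hKb h2 /hKm h3]].
have E1 : \sum_(k < K) (cauchy_prod a b N k)%:C *: T (tpt N k) x =
    \sum_(k < K) \sum_(i < k.+1) m i (k - i)%N.
  apply: eq_bigr => k _; rewrite /cauchy_prod rmorph_sum scaler_suml.
  by apply: eq_bigr => i _; rewrite /m subnKC // -ltnS.
pose y := \sum_(j < K) (b N j)%:C *: T (tpt N j) x.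
have E2 : \sum_(i < K) \sum_(j < K) m i j = \sum_(i < K) (a N i)%:C *: T (tpt N i) y.
  apply: eq_bigr => i _; rewrite linear_sum scaler_sumr; apply: eq_bigr => j _.
  rewrite /m tptD (C0_add hT) ?tpt_ge0 //.
  by rewrite linearZ /= scalerA rmorphM.
rewrite E1; rewrite E2 in h3.
have h2' : rnorm (\sum_(i < K) (a N i)%:C *: T (tpt N i) y -
    \sum_(i < K) (a N i)%:C *: T (tpt N i) (v x)) <= e / 3%:R.
  rewrite -sumrB; apply: le_trans (rnorm_sum _ _ _) _.
  apply: (@le_trans _ _ (\sum_(i < K) `|a N i| * (M * (e / 3%:R / (V * M + 1))))).
    apply: ler_sum => i _; rewrite -scalerBr -linearB rnormZr ler_wpM2l //.
    by rewrite (le_trans (TM _ (tpt_ge0 N i))) // ler_wpM2l.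
  rewrite -mulr_suml (@le_trans _ _ (V * (M * (e / 3%:R / (V * M + 1))))) //.
    by rewrite ler_wpM2r // mulr_ge0 // ltW.
  by rewrite mulrA mulrA ler_pdivrMr // mulrC ler_wpM2l ?ltW // ltrDl.
have -> : e = e / 3%:R + (e / 3%:R + e / 3%:R) by field.
apply: le_trans (rnorm_triangle (\sum_(i < K) (a N i)%:C *: T (tpt N i) y) _ _) _.
apply: lerD => //.
apply: le_trans (rnorm_triangle (\sum_(i < K) (a N i)%:C *: T (tpt N i) (v x)) _ _) _.
exact: lerD.
Qed.

End Approx.

(** * Constructions of finite measures on the half-line *)

Section Density.
Context d (S : measurableType d) (R : realType).
Local Open Scope ereal_scope.
Import HBNNSimple.

Lemma density_measure (m : {measure set S -> \bar R}) (w : S -> R) :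
  (forall x, 0 <= w x)%R -> measurable_fun setT w ->
  exists m' : {measure set S -> \bar R}, forall A, m' A = \int[m]_(x in A) (w x)%:E.
Proof.
move=> w0 mw; pose nu A := \int[m]_(x in A) (w x)%:E.
have nu0 : nu set0 = 0 by rewrite /nu integral_set0.
have nuge A : 0 <= nu A by apply: integral_ge0 => x _; rewrite lee_fin.
have nus : semi_sigma_additive nu.
  move=> /= F mF tF mUF; rewrite /nu; apply: cvg_toP.
    apply: ereal_nondecreasing_is_cvgn => k n kn.
    by apply: lee_sum_nneg_natr => // j _ _; exact: nuge.
  rewrite ge0_integral_bigcup //.
  - by apply/measurable_EFinP; apply: measurable_funTS.
  - by move=> x _; rewrite lee_fin.
pose M' := isMeasure.Build _ _ _ nu nu0 nuge nus.
by exists (HB.pack_for {measure set S -> \bar R} nu M').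
Qed.

Lemma density_integral (m m' : {measure set S -> \bar R}) (w : S -> R) D (g : S -> \bar R) :
  (forall x, 0 <= w x)%R -> measurable_fun setT w ->
  (forall A, m' A = \int[m]_(x in A) (w x)%:E) ->
  measurable D -> measurable_fun D g -> (forall x, D x -> 0 <= g x) ->
  \int[m']_(x in D) g x = \int[m]_(x in D) ((w x)%:E * g x).
Proof.
move=> w0 mw m'E mD mg g0; pose f := nnsfun_approx mD mg.
have mwE : measurable_fun D (EFin \o w).
  by apply/measurable_EFinP; apply: measurable_funTS.
have cf x : D x -> (f n x)%:E @[n --> \oo] --> g x by move=> Dx; exact: cvg_nnsfun_approx.
transitivity (limn (fun n => \int[m']_(x in D) (f n x)%:E)).
  rewrite -monotone_convergence //.
  - by apply: eq_integral => y /[!inE] yD; apply/esym/cvg_lim => //; exact: cf.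
  - by move=> n; exact/measurable_EFinP/measurable_funTS.
  - by move=> n y _; rewrite lee_fin.
  - by move=> y _ a b ab; rewrite lee_fin; exact/lefP/nd_nnsfun_approx.
rewrite [X in limn X](_ : _ = fun n => \int[m]_(x in D) ((w x)%:E * (f n x)%:E)).
  rewrite -monotone_convergence //.
  - apply: eq_integral => y /[!inE] yD; apply/cvg_lim => //.
    by apply: cvgeZl => //; exact: cf.
  - move=> n; apply: emeasurable_funM => //; exact/measurable_EFinP/measurable_funTS.
  - by move=> n y _; rewrite mule_ge0 ?lee_fin.
  - move=> y _ a b ab; rewrite lee_wpmul2l ?lee_fin //; exact/lefP/nd_nnsfun_approx.
apply/funext => n.
under [LHS]eq_integral do rewrite fimfunE -fsumEFin//.
rewrite [LHS]ge0_integral_fsum//; last 2 first.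
  - by move=> r; exact/measurable_EFinP/measurableT_comp.
  - by move=> k x _; rewrite EFinM nnfun_muleindic_ge0.
under [RHS]eq_integral.
  move=> x xD; rewrite fimfunE -fsumEFin// ge0_mule_fsumr; last first.
    by move=> r; rewrite EFinM nnfun_muleindic_ge0.
  over.
rewrite [RHS]ge0_integral_fsum//; last 2 first.
  - move=> r; apply: emeasurable_funM => //.
    by apply/measurable_EFinP; apply/measurableT_comp.
  - move=> k x _; apply: mule_ge0; first by rewrite lee_fin.
    by rewrite EFinM nnfun_muleindic_ge0.
apply: eq_fsbigr => r; rewrite inE => -[t _ <-].
rewrite integralZl_indic_nnsfun //.
under [RHS]eq_integral do rewrite EFinM muleCA.
rewrite ge0_integralZl //; last 3 first.
- apply: emeasurable_funM => //; apply/measurable_EFinP; exact: measurable_funTS.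
- by move=> x _; rewrite mule_ge0 ?lee_fin.
- by rewrite lee_fin.
congr (_ * _); rewrite integral_indic // m'E integral_mkcondl.
apply: eq_integral => x _; rewrite patchE indicE.
by case: ifPn => _; rewrite ?mule1 ?mule0.
Qed.

End Density.

Section PushMeasure.
Context d (S : measurableType d) {R : realType}.
Local Notation RR := (measurableTypeR R).
Local Open Scope ereal_scope.

(** Scalings, convolutions, mixtures and laws with a density are all weighted images. *)
Lemma push_measure (m : {measure set S -> \bar R}) (D : set S) (w f : S -> R) :
  measurable D -> measurable_fun setT w -> measurable_fun setT f ->
  (forall x, 0 <= w x)%R -> (forall x, D x -> 0 <= f x)%R ->
  exists q : {measure set RR -> \bar R}, forall g : R -> R, (forall s, 0 <= g s)%R ->
    measurable_fun setT g ->
    \int[q]_(s in @Rplus R) (g s)%:E = \int[m]_(x in D) (w x * g (f x))%:E.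
Proof.
move=> mD mw mf w0 f0.
have [m' m'E] := density_measure m w0 mw.
(* The points outside D are sent to -1, which [Rplus] does not see. *)
pose f' x : RR := if x \in D then f x else (-1)%R.
have mf' : measurable_fun setT f'.
  apply: measurable_fun_ifT => //; apply: (measurable_fun_bool true) => //.
  rewrite setTI (_ : _ @^-1` _ = D) //.
  by apply/seteqP; split=> x /=; [move=> /set_mem|move=> /mem_set].
have fD : f' @^-1` (@Rplus R) = D.
  apply/seteqP; split=> x; rewrite /f' /Rplus /=; last by move=> Dx; rewrite mem_set // f0.
  by case: ifPn => [/set_mem //|_]; rewrite ler0N1.
pose q0 := (pushforward m' f' : {measure set RR -> \bar R}).
exists (q0 mf') => g g0 mg.
rewrite (ge0_integral_pushforward mf') //; last 3 first.
- exact: measurable_Rplus.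
- by apply/measurable_EFinP; exact: measurable_funTS.
- by move=> s _; rewrite lee_fin.
rewrite fD (density_integral (m := m) w0 mw m'E) //; last 2 first.
- apply/measurable_EFinP; apply: measurable_funTS; exact: measurableT_comp.
- by move=> x _; rewrite lee_fin.
by apply: eq_integral => x; rewrite inE => Dx; rewrite /= /f' mem_set.
Qed.

Lemma push_exists (m : {measure set S -> \bar R}) (D : set S) (w f : S -> R) :
  measurable D -> measurable_fun setT w -> measurable_fun setT f ->
  (forall x, 0 <= w x)%R -> (forall x, D x -> 0 <= f x)%R ->
  \int[m]_(x in D) (w x)%:E < +oo ->
  exists r : finmeas R, forall g : R -> R, (forall s, 0 <= g s)%R ->
    measurable_fun setT g ->
    \int[r]_(s in @Rplus R) (g s)%:E = \int[m]_(x in D) (w x * g (f x))%:E.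
Proof.
move=> mD mw mf w0 f0 fin; have [q hq] := push_measure m mD mw mf w0 f0.
have qfin : q (@Rplus R) < +oo.
  have <- : \int[q]_(s in @Rplus R) (cst 1%R s)%:E = q (@Rplus R).
    by rewrite -[RHS]mul1e -integral_cst //; exact: measurable_Rplus.
  rewrite hq; [|by move=> s; exact: ler01|exact: measurable_cst].
  by under eq_integral do rewrite mulr1.
exists (mfrestr measurable_Rplus qfin) => g g0 mg.
rewrite (eq_measure_integral q) => [|A mA AR]; last first.
  by rewrite /= /mfrestr /mrestr setIidl.
exact: hq.
Qed.

End PushMeasure.

Section LaplaceMeasures.
Context {R : realType}.
Local Notation RR := (measurableTypeR R).
Implicit Types (p q r : finmeas R) (z : R).
Local Open Scope ereal_scope.

Lemma Lap0 p : Lap p 0 = mass p.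
Proof.
rewrite -[RHS]mul1r -Iplus_cst; apply: Iplus_eq => s _.
by rewrite mulr0 oppr0 expR0.
Qed.

Lemma Lap_EFin p z : (0 <= z)%R ->
  \int[p]_(s in @Rplus R) (expR (- (s * z)))%:E = (Lap p z)%:E.
Proof. by move=> z0; rewrite Iplus_EFin //; exact: bm_exp. Qed.

Lemma Lap_ge0 p z : (0 <= Lap p z)%R.
Proof. by apply: Iplus_ge0 => s _; exact: expR_ge0. Qed.

Lemma measurable_expNM z : measurable_fun setT (fun s : RR => expR (- (s * z))).
Proof.
apply: (@measurableT_comp _ _ _ _ _ _ expR) => //.
by apply: measurable_funN; apply: measurable_funM => //; exact: measurable_cst.
Qed.

Lemma push_Lap d (S : measurableType d) (m : {measure set S -> \bar R}) (D : set S)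
    (w f : S -> R) :
  measurable D -> measurable_fun setT w -> measurable_fun setT f ->
  (forall x, 0 <= w x)%R -> (forall x, D x -> 0 <= f x)%R ->
  \int[m]_(x in D) (w x)%:E < +oo ->
  exists r : finmeas R, forall z, (0 <= z)%R ->
    (Lap r z)%:E = \int[m]_(x in D) (w x * expR (- (f x * z)))%:E.
Proof.
move=> mD mw mf w0 f0 fin; have [r hr] := push_exists mD mw mf w0 f0 fin.
exists r => z z0; rewrite -Lap_EFin //.
apply: (hr (fun s => expR (- (s * z)))); last exact: measurable_expNM.
by move=> s; exact: expR_ge0.
Qed.

Lemma fubini_rect (p q : finmeas R) (A B : set RR) (G : RR * RR -> R) :
  measurable A -> measurable B -> measurable_fun setT G -> (forall x, 0 <= G x)%R ->
  \int[p \x q]_(x in A `*` B) (G x)%:E =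
  \int[p]_(x in A) \int[q]_(y in B) (G (x, y))%:E.
Proof.
move=> mA mB mG G0; have mAB := measurableX mA mB.
rewrite integral_mkcond (fubini_tonelli1 ((EFin \o G) \_ (A `*` B))) /fubini_F; last 2 first.
- apply: (measurable_restrictT _ mAB).1; apply/measurable_EFinP; exact: measurable_funTS.
- by move=> x; rewrite patchE; case: ifPn => // _; rewrite lee_fin.
rewrite [RHS]integral_mkcond; apply: eq_integral => x _; rewrite patchE.
case: ifPn => [xA|xA].
  rewrite [RHS]integral_mkcond; apply: eq_integral => y _; rewrite !patchE.
  rewrite (_ : ((x, y) \in A `*` B) = (y \in B)) //.
  apply/idP/idP => [/set_mem [_ /mem_set] //|/set_mem yB].
  by apply/mem_set; split=> //; exact/set_mem.
rewrite integral0_eq // => y _; rewrite patchE memNset // => -[/mem_set].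
by rewrite (negbTE xA).
Qed.

(** The convolution is the image of the product measure under addition. *)
Lemma conv_exists p q : exists r, forall z, (0 <= z)%R ->
  Lap r z = (Lap p z * Lap q z)%R.
Proof.
pose D := @Rplus R `*` @Rplus R : set (RR * RR).
have mD : measurable D by apply: measurableX; exact: measurable_Rplus.
pose f (x : RR * RR) : R := (x.1 + x.2)%R.
have mf : measurable_fun setT f.
  by apply: measurable_funD; [exact: measurable_fst|exact: measurable_snd].
have f0 x : D x -> (0 <= f x)%R by move=> [h1 h2]; rewrite addr_ge0.
have fin : \int[p \x q]_(x in D) ((fun=> 1%R) x)%:E < +oo.
  rewrite fubini_rect //; try exact: measurable_Rplus.
  rewrite (eq_integral (cst (q (@Rplus R)))); last first.
    by move=> x _; rewrite (integral_cst q measurable_Rplus 1) mul1e.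
  rewrite (integral_cst p measurable_Rplus).
  apply: le_lt_trans (ltry (mass q * mass p)%R).
  by rewrite EFinM -!mass_fin.
have [r hr] := push_Lap mD (measurable_cst _) mf (fun=> ler01) f0 fin.
exists r => z z0; apply: EFin_inj; rewrite hr //.
pose G x := (1 * expR (- (f x * z)))%R.
have mG : measurable_fun setT G.
  apply: measurable_funM; first exact: measurable_cst.
  exact: (measurableT_comp (measurable_expNM z) mf).
rewrite -[LHS]/(\int[p \x q]_(x in D) (G x)%:E) fubini_rect //; try exact: measurable_Rplus.
  transitivity (\int[p]_(x in @Rplus R) ((Lap q z)%:E * (expR (- (x * z)))%:E)).
    apply: eq_integral => x _; rewrite /G /f /=.
    transitivity (\int[q]_(y in @Rplus R) ((expR (- (x * z)))%:E * (expR (- (y * z)))%:E)).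
      by apply: eq_integral => y _; rewrite mul1r -EFinM -expRD; congr (expR _)%:E; ring.
    rewrite ge0_integralZl_EFin ?expR_ge0 //.
    - by rewrite Lap_EFin // muleC.
    - exact: measurable_Rplus.
    - apply/measurable_EFinP; apply: measurable_funTS; exact: measurable_expNM.
  rewrite ge0_integralZl_EFin ?Lap_ge0 //.
  - by rewrite Lap_EFin // -EFinM mulrC.
  - exact: measurable_Rplus.
  - apply/measurable_EFinP; apply: measurable_funTS; exact: measurable_expNM.
by move=> x; rewrite mulr_ge0 // expR_ge0.
Qed.

(** Scaling by a random factor: the image of [w * m] times [q] under
    [(tau, s) |-> s / tau]. Stieltjes kernels are mixtures of this kind. *)
Lemma mix_exists (m : {measure set RR -> \bar R}) (D : set RR) (w : R -> R) q :
  measurable D -> D `<=` [set x | 0 < x]%R -> measurable_fun setT w ->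
  (forall x, 0 <= w x)%R -> \int[m]_(x in D) (w x)%:E < +oo ->
  exists r, forall z, (0 <= z)%R ->
    (Lap r z)%:E = \int[m]_(x in D) (w x * Lap q (z / x))%:E.
Proof.
move=> mD Dpos mw w0 fin.
have [rho hrho] := push_exists mD mw (@measurable_id _ RR setT) w0
  (fun x Dx => ltW (Dpos x Dx)) fin.
pose A : set RR := [set` `]0, +oo[%R].
have mA : measurable A by exact: measurable_itv.
pose E := A `*` @Rplus R : set (RR * RR).
have mE : measurable E by apply: measurableX => //; exact: measurable_Rplus.
pose f (x : RR * RR) : R := (x.2 * x.1 `^ (-1))%R.
have mf : measurable_fun setT f.
  apply: measurable_funM; first exact: measurable_snd.
  apply: (@measurableT_comp _ _ _ _ _ _ (fun x => x `^ (-1))%R); last exact: measurable_fst.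
  exact: measurable_powR.
have f0 x : E x -> (0 <= f x)%R by move=> [h1 h2]; rewrite mulr_ge0 // powR_ge0.
have finE : \int[rho \x q]_(x in E) ((fun=> 1%R) x)%:E < +oo.
  rewrite fubini_rect //; try exact: measurable_Rplus.
  rewrite (eq_integral (cst (q (@Rplus R)))); last first.
    by move=> x _; rewrite (integral_cst q measurable_Rplus 1) mul1e.
  rewrite (integral_cst rho mA).
  apply: le_lt_trans (ltry (mass q * mass rho)%R).
  rewrite EFinM -!mass_fin; apply: lee_wpmul2l; first exact: measure_ge0.
  apply: le_measure; rewrite ?inE //; first exact: measurable_Rplus.
  by move=> x; rewrite /A /= in_itv /= andbT /Rplus /= => /ltW.
have [r hr] := push_Lap mE (measurable_cst _) mf (fun=> ler01) f0 finE.
exists r => z z0; rewrite hr //.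
pose G x := (1 * expR (- (f x * z)))%R.
have mG : measurable_fun setT G.
  apply: measurable_funM; first exact: measurable_cst.
  exact: (measurableT_comp (measurable_expNM z) mf).
have G0 x : (0 <= G x)%R by rewrite mulr_ge0 // expR_ge0.
rewrite -[LHS]/(\int[rho \x q]_(x in E) (G x)%:E) fubini_rect //; last exact: measurable_Rplus.
have inner x : A x -> \int[q]_(y in @Rplus R) (G (x, y))%:E = (Lap q (z / x))%:E.
  rewrite /A /= in_itv /= andbT => x0; rewrite -Lap_EFin; last by rewrite divr_ge0 // ltW.
  apply: eq_integral => y _; rewrite /G /f /= mul1r powR_inv1 ?ltW //.
  by congr (expR _)%:E; field; rewrite gt_eqF.
pose g x := (\1_A x * Lap q (z / x))%R.
have mg : measurable_fun setT g.
  apply/measurable_EFinP.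
  rewrite (_ : _ \o _ = fubini_F q ((EFin \o G) \_ E)).
    apply: measurable_fun_fubini_tonelli_F.
    - apply: (measurable_restrictT _ mE).1; apply/measurable_EFinP; exact: measurable_funTS.
    - by move=> x; rewrite patchE; case: ifPn => // _; rewrite lee_fin.
  apply/funext => x; rewrite /fubini_F /g /= indicE.
  case: (boolP (x \in A)) => [/set_mem xA|/negP xA].
    rewrite mul1r -inner // [LHS]integral_mkcond; apply: eq_integral => y _; rewrite !patchE.
    rewrite (_ : ((x, y) \in E) = (y \in @Rplus R)) //.
    apply/idP/idP => [/set_mem [_ /mem_set] //|/set_mem yB].
    by apply/mem_set; split.
  rewrite mul0r integral0_eq // => y _; rewrite patchE memNset // => -[/mem_set].
  by [].
have g0 x : (0 <= g x)%R by rewrite mulr_ge0 ?Lap_ge0 // indicE.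
transitivity (\int[rho]_(x in @Rplus R) (g x)%:E).
  rewrite [LHS]integral_mkcond [RHS]integral_mkcond; apply: eq_integral => x _.
  rewrite !patchE /g indicE; case: (boolP (x \in A)) => [/set_mem xA|xA].
    rewrite mem_set ?mul1r ?inner //.
    by move: xA; rewrite /A /Rplus /= in_itv /= andbT => /ltW.
  by case: ifPn; rewrite ?mul0r.
rewrite hrho //; apply: eq_integral => x; rewrite inE => Dx.
rewrite /g indicE mem_set ?mul1r //.
by rewrite /A /= in_itv /= andbT; exact: Dpos.
Qed.

End LaplaceMeasures.

(** * The algebra of Laplace transforms *)

Section LapAlgebra.
Context {R : realType}.
Local Notation RR := (measurableTypeR R).
Implicit Types (p q r : finmeas R) (z : R) (phi psi : R -> R).

(** [V] bounds the mass of some representation as a difference of positive measures.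
    This already bounds the norm of the operator, and is easily followed through
    sums and products. *)
Definition lap (V : R) phi := exists p q : finmeas R,
  mass p + mass q <= V /\ forall z, 0 < z -> phi z = Lap p z - Lap q z.

Lemma measurable_exp_id z :
  measurable_fun (@Rplus R) (fun x : RR => (expR (- (x * z)))%:E).
Proof. by apply/measurable_EFinP; apply: measurable_funTS; exact: measurable_expNM. Qed.

Lemma add_exists p q : exists r, forall z, 0 <= z -> Lap r z = Lap p z + Lap q z.
Proof.
have fin : (\int[measure_add p q]_(x in @Rplus R) ((fun=> 1) x)%:E < +oo)%E.
  rewrite (integral_cst _ measurable_Rplus 1) mul1e.
  apply: le_lt_trans (ltry (mass p + mass q)).
  by rewrite EFinD -!mass_fin -measure_addE.
have [r hr] := push_Lap measurable_Rplus (measurable_cst _) (@measurable_id _ RR setT)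
  (fun=> ler01) (fun x h => h) fin.
exists r => z z0; apply: EFin_inj; rewrite hr // EFinD -!Lap_EFin //.
rewrite -ge0_integral_measure_add //.
- by apply: eq_integral => x _; rewrite mul1r.
- exact: measurable_Rplus.
- exact: measurable_exp_id.
Qed.

Lemma scale_exists p (c h : R) : 0 <= c -> 0 <= h ->
  exists r, forall z, 0 <= z -> Lap r z = c * Lap p (h * z).
Proof.
move=> c0 h0.
have fin : (\int[p]_(x in @Rplus R) ((fun=> c) x)%:E < +oo)%E.
  rewrite (integral_cst _ measurable_Rplus c%:E).
  by apply: le_lt_trans (ltry (c * mass p)); rewrite EFinM -!mass_fin.
have mh : measurable_fun setT (fun x : RR => h * x).
  by apply: measurable_funM => //; exact: measurable_cst.
have [r hr] := push_Lap measurable_Rplus (measurable_cst _) mh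
  (fun=> c0) (fun x hx => mulr_ge0 h0 hx) fin.
exists r => z z0; apply: EFin_inj; rewrite hr // EFinM -Lap_EFin ?mulr_ge0 //.
rewrite -ge0_integralZl_EFin //.
- by apply: eq_integral => x _; rewrite -EFinM mulrCA mulrA.
- exact: measurable_Rplus.
- exact: measurable_exp_id.
Qed.

Lemma dirac_exists (t : R) : 0 <= t ->
  exists r, forall g : R -> R, (forall s, 0 <= g s) -> measurable_fun setT g ->
    Iplus r g = g t.
Proof.
move=> t0.
pose dt : {measure set RR -> \bar R} := @dirac _ RR t R.
have I (f : RR -> \bar R) : measurable_fun (@Rplus R : set RR) f ->
    (\int[dt]_(x in @Rplus R) f x = f t)%E.
  move=> mf; transitivity (@dirac _ RR t R (@Rplus R : set RR) * f t)%E.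
    exact: (@integral_dirac _ RR t R (@Rplus R) measurable_Rplus f mf).
  by rewrite diracE mem_set // mul1e.
have fin : (\int[dt]_(x in @Rplus R) ((fun=> 1) x)%:E < +oo)%E.
  by rewrite I ?ltry.
have [r hr] := push_exists measurable_Rplus (measurable_cst _) (@measurable_id _ RR setT)
  (fun=> ler01) (fun x h => h) fin.
exists r => g g0 mg; rewrite /Iplus /Rintegral hr // I /= ?mul1r //.
by apply/measurable_EFinP; apply: measurable_funTS; apply: measurable_funM.
Qed.

Lemma lap_measure p : lap (mass p) (Lap p).
Proof.
have [n hn] := scale_exists p (lexx 0) (lexx 0).
exists p, n; split=> [|z z0]; last by rewrite hn ?ltW // mul0r subr0.
by rewrite -(Lap0 n) hn // mul0r addr0.
Qed.

Lemma lap_ext V phi psi : lap V phi -> (forall z, 0 < z -> psi z = phi z) -> lap V psi.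
Proof. by move=> [p [q [h1 h2]]] e; exists p, q; split=> // z z0; rewrite e // h2. Qed.

Lemma lap_le V W phi : lap V phi -> V <= W -> lap W phi.
Proof. by move=> [p [q [h1 h2]]] VW; exists p, q; split=> //; exact: le_trans VW. Qed.

Lemma lapN V phi : lap V phi -> lap V (fun z => - phi z).
Proof.
move=> [p [q [h1 h2]]]; exists q, p; rewrite addrC; split=> // z z0.
by rewrite h2 // opprB.
Qed.

Lemma lapD V W phi psi : lap V phi -> lap W psi -> lap (V + W) (fun z => phi z + psi z).
Proof.
move=> [p [q [h1 h2]]] [p' [q' [h1' h2']]].
have [r hr] := add_exists p p'; have [n hn] := add_exists q q'.
exists r, n; split=> [|z z0]; last by rewrite h2 // h2' // hr ?ltW // hn ?ltW //; ring.
rewrite -!Lap0 hr // hn // !Lap0; apply: le_trans (lerD h1 h1'); lra.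
Qed.

Lemma lapB V W phi psi : lap V phi -> lap W psi -> lap (V + W) (fun z => phi z - psi z).
Proof. by move=> h1 h2; apply: lapD => //; exact: lapN. Qed.

Lemma lapZ V phi (c : R) : lap V phi -> lap (`|c| * V) (fun z => c * phi z).
Proof.
have pos d : 0 <= d -> lap V phi -> lap (d * V) (fun z => d * phi z).
  move=> d0 [p [q [h1 h2]]].
  have [r hr] := scale_exists p d0 ler01; have [n hn] := scale_exists q d0 ler01.
  exists r, n; split=> [|z z0].
    by rewrite -!Lap0 hr // hn // !mulr0 !Lap0 -mulrDr ler_wpM2l.
  by rewrite h2 // hr ?ltW // hn ?ltW // !mul1r mulrBr.
move=> h; have [c0|c0] := leP 0 c; first by rewrite ger0_norm //; exact: pos.
rewrite ltr0_norm //; apply: (lap_ext (lapN (pos _ _ h))); first by rewrite oppr_ge0 ltW.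
by move=> z _; rewrite mulNr opprK.
Qed.

(** In the expansion of a product of differences, the masses of the four
    convolutions add up to the product of the total masses. *)
Lemma lapM V W phi psi : lap V phi -> lap W psi -> lap (V * W) (fun z => phi z * psi z).
Proof.
move=> [p [q [h1 h2]]] [p' [q' [h1' h2']]].
have [pp hpp] := conv_exists p p'; have [qq hqq] := conv_exists q q'.
have [pq hpq] := conv_exists p q'; have [qp hqp] := conv_exists q p'.
have [r hr] := add_exists pp qq; have [n hn] := add_exists pq qp.
exists r, n; split=> [|z z0].
  rewrite -!Lap0 hr // hn // hpp // hqq // hpq // hqp // !Lap0.
  have m1 := mass_ge0 p; have m2 := mass_ge0 q; have m3 := mass_ge0 p'.
  have m4 := mass_ge0 q'.
  apply: (@le_trans _ _ ((mass p + mass q) * (mass p' + mass q'))).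
    by rewrite le_eqVlt; apply/orP; left; apply/eqP; ring.
  by apply: ler_pM => //; exact: addr_ge0.
have z0' := ltW z0.
by rewrite h2 // h2' // hr // hn // hpp // hqq // hpq // hqp //; ring.
Qed.

Lemma lap_scale V phi (h : R) : 0 < h -> lap V phi -> lap V (fun z => phi (h * z)).
Proof.
move=> h0 [p [q [h1 h2]]]; have h0' := ltW h0.
have [r hr] := scale_exists p ler01 h0'; have [n hn] := scale_exists q ler01 h0'.
exists r, n; split=> [|z z0].
  by rewrite -!Lap0 hr // hn // !mulr0 !Lap0 !mul1r.
by rewrite h2 ?mulr_gt0 // hr ?ltW // hn ?ltW // !mul1r.
Qed.

Lemma lap_exp (t : R) : 0 <= t -> lap 1 (fun z => expR (- (t * z))).
Proof.
move=> t0; have [r hr] := dirac_exists t0.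
have -> : 1 = mass r.
  rewrite -[RHS]mul1r -Iplus_cst hr //; exact: measurable_cst.
apply: (lap_ext (lap_measure r)) => z z0; rewrite /Lap hr //.
exact: measurable_expNM.
Qed.

Lemma lap_cst (c : R) : lap `|c| (fun=> c).
Proof.
rewrite -[`|c|]mulr1; apply: (lap_ext (lapZ c (lap_exp (lexx 0)))) => z _.
by rewrite mul0r oppr0 expR0 mulr1.
Qed.

Lemma lap_exprn V phi n : 0 <= V -> lap V phi -> lap (V ^+ n) (fun z => phi z ^+ n).
Proof.
move=> V0 h; elim: n => [|n IH].
  by rewrite expr0 -[1]normr1; apply: (lap_ext (lap_cst 1)) => z _; rewrite expr0.
by rewrite exprS; apply: (lap_ext (lapM h IH)) => z _; rewrite exprS.
Qed.

Lemma lap_sum n (V : R) (F : nat -> R -> R) : (forall k, (k < n)%N -> lap V (F k)) ->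
  lap (n%:R * V) (fun z => \sum_(k < n) F k z).
Proof.
elim: n => [|n IH] h.
  have h0 : lap (0%:R * V) (fun=> 0) by rewrite mul0r; have := lap_cst 0; rewrite normr0.
  by apply: (lap_ext h0) => z _; rewrite big_ord0.
have -> : n.+1%:R * V = n%:R * V + V by rewrite -[n.+1%:R]natr1 mulrDl mul1r.
apply: (lap_ext (lapD (IH (fun k kn => h k (ltnW kn))) (h n (ltnSn n)))) => z _.
by rewrite big_ord_recr.
Qed.

(** ** The exponential, uniform and triangular densities *)

Notation mu := (@lebesgue_measure R).

Lemma integral_exp_half_line (c : R) : 0 < c ->
  (\int[mu]_(x in `[0%R, +oo[) (expR (- (x * c)))%:E = (c^-1)%:E)%E.
Proof.
move=> c0.
have h : (\int[mu]_(x in `[0%R, +oo[) (c * expR (- (x * c)))%:E = 1)%E.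
  rewrite -(integral_exponential_pdf c0) [LHS]integral_mkcond; apply: eq_integral => x _.
  rewrite /exponential_pdf !patchE; case: ifPn => // _.
  by congr (_ * expR _)%:E; ring.
have : (c%:E * \int[mu]_(x in `[0%R, +oo[) (expR (- (x * c)))%:E = 1)%E.
  rewrite -h; under [RHS]eq_integral do rewrite EFinM.
  rewrite ge0_integralZl_EFin //; first last.
  - exact: ltW.
  - by apply/measurable_EFinP; apply: measurable_funTS; exact: measurable_expNM.
move=> h'; rewrite -[LHS]mul1e -[X in (X%:E * _)%E](mulVf (x := c)) ?gt_eqF //.
by rewrite EFinM -muleA h' mule1.
Qed.

Lemma exponential_exists : exists r : finmeas R, forall z, 0 <= z -> Lap r z = (1 + z)^-1.
Proof.
have mw : measurable_fun setT (fun x : RR => expR (- x)).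
  by have := @measurable_expNM R 1; under eq_fun do rewrite mulr1.
have itvE : `[0%R, +oo[%classic = @Rplus R :> set RR.
  by apply/seteqP; split=> x /=; rewrite /Rplus /= in_itv /= andbT.
have E z : 0 <= z -> (\int[mu]_(x in @Rplus R) (expR (- x) * expR (- (x * z)))%:E = ((1 + z)^-1)%:E)%E.
  move=> z0; rewrite -(@integral_exp_half_line (1 + z)) ?ltr_pwDl // itvE.
  by apply: eq_integral => x _; rewrite -expRD; congr (expR _)%:E; ring.
have fin : (\int[mu]_(x in @Rplus R) (expR (- x))%:E < +oo)%E.
  apply: le_lt_trans (ltry (1 + 0)^-1); rewrite -E //.
  rewrite le_eqVlt; apply/orP; left; apply/eqP.
  by apply: eq_integral => x _; rewrite mulr0 oppr0 expR0 mulr1.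
have [r hr] := push_Lap (m := mu) measurable_Rplus mw (@measurable_id _ RR setT)
  (fun=> expR_ge0 _) (fun x h => h) fin.
by exists r => z z0; apply: EFin_inj; rewrite hr // E.
Qed.

Lemma lap_resolvent1 : lap 1 (fun z => (1 + z)^-1).
Proof.
have [r LE] := exponential_exists.
have mr : mass r = 1 by rewrite -Lap0 LE // addr0 invr1.
have := lap_measure r; rewrite mr => h.
by apply: (lap_ext h) => z /ltW z0; rewrite LE.
Qed.

(** The last clause serves to compare the average of an orbit over a short interval
    with its initial value. *)
Lemma lap_uniform : exists r : finmeas R,
  (forall z, 0 < z -> Lap r z = (1 - expR (- z)) / z) /\ mass r = 1 /\
  forall (g : R -> R) e, bm g -> (forall s, 0 <= g s) -> measurable_fun setT g ->
    (forall s, 0 <= s <= 1 -> g s <= e) -> Iplus r g <= e.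
Proof.
pose D : set RR := `[0%R, 1%R]%classic.
have mD : measurable D by exact: measurable_itv.
have muD : mu D = 1%E.
  by rewrite /D lebesgue_measure_itv /= lte_fin ltr01 oppr0 adde0.
have ID (c : R) : (\int[mu]_(x in D) cst c%:E x = c%:E)%E.
  transitivity (c%:E * mu D)%E; first exact: (integral_cst mu mD).
  by rewrite muD mule1.
have fin : (\int[mu]_(x in D) ((fun=> 1) x)%:E < +oo)%E.
  by rewrite (ID 1) ltry.
have D0 x : D x -> 0 <= x by rewrite /D /= in_itv /= => /andP[].
have [r hr] := push_exists (m := mu) mD (measurable_cst _) (@measurable_id _ RR setT)
  (fun=> ler01) D0 fin.
have massr : mass r = 1.
  rewrite -[LHS]mul1r -Iplus_cst /Iplus /Rintegral hr //.
  rewrite (_ : (\int[mu]_(x in D) (1 * 1)%:E)%E = (\int[mu]_(x in D) cst 1%E x)%E).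
    by rewrite (ID 1).
  by apply: eq_integral => x _; rewrite mulr1.
exists r; split=> [z z0|].
  apply: EFin_inj; rewrite -Lap_EFin ?ltW // hr; last 2 first.
  - by move=> s; exact: expR_ge0.
  - exact: measurable_expNM.
  have := exponential_prob_itv0c z (ltr01 : 0 < 1 :> R); rewrite mulr1 /exponential_prob => h.
  have h' : (\int[mu]_(x in D) (z * expR (- (x * z)))%:E = (1 - expR (- z))%:E)%E.
    rewrite EFinB -h; apply: eq_integral => x; rewrite inE => Dx.
    by rewrite exponential_pdfE ?D0 //; congr (_ * expR _)%:E; ring.
  under eq_integral do rewrite mul1r.
  rewrite mulrC EFinM -h'; under [in RHS]eq_integral do rewrite EFinM.
  rewrite ge0_integralZl_EFin //; first last.
  - exact: ltW.
  - by apply/measurable_EFinP; apply: measurable_funTS; exact: measurable_expNM.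
  by rewrite muleA -EFinM mulVf ?mul1e // gt_eqF.
split=> // g e bg g0 mg ge.
rewrite -lee_fin -Iplus_EFin // hr //.
apply: (@le_trans _ _ (\int[mu]_(x in D) e%:E)%E).
  apply: ge0_le_integral => //.
  - by move=> x Dx; rewrite lee_fin mul1r.
  - by apply/measurable_EFinP; apply: measurable_funTS; apply: measurable_funM.
  - move=> x Dx; rewrite lee_fin mul1r; apply: ge.
    by move: Dx; rewrite /D /= in_itv.
by rewrite (ID e).
Qed.

Lemma lap_uniform_scaled (h : R) : 0 < h -> exists r : finmeas R,
  (forall z, 0 < z -> Lap r z = (1 - expR (- (h * z))) / (h * z)) /\ mass r = 1 /\
  forall (g : R -> R) e, (forall s, 0 <= g s) -> bm g -> measurable_fun setT g ->
    (forall s, 0 <= s <= h -> g s <= e) -> Iplus r g <= e.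
Proof.
move=> h0; have [q [q1 [q2 q3]]] := lap_uniform; have h0' := ltW h0.
have mh : measurable_fun setT (fun x : RR => h * x).
  by apply: measurable_funM => //; exact: measurable_cst.
have fin : (\int[q]_(x in @Rplus R) ((fun=> 1) x)%:E < +oo)%E.
  rewrite (integral_cst _ measurable_Rplus 1%:E).
  by apply: le_lt_trans (ltry (1 * mass q)); rewrite EFinM -!mass_fin.
have [r hr] := push_exists measurable_Rplus (measurable_cst _) mh
  (fun=> ler01) (fun x hx => mulr_ge0 h0' hx) fin.
have I (g : R -> R) : (forall s, 0 <= g s) -> measurable_fun setT g ->
    Iplus r g = Iplus q (fun s => g (h * s)).
  move=> g0 mg; rewrite /Iplus /Rintegral hr //; congr fine.
  by apply: eq_integral => x _; rewrite mul1r.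
exists r; split=> [z z0|].
  rewrite /Lap I //; last exact: measurable_expNM.
  rewrite -q1 ?mulr_gt0 //; apply: Iplus_eq => s _; congr expR; ring.
split; first by rewrite -q2 -[LHS]mul1r -[RHS]mul1r -!Iplus_cst I.
move=> g e g0 [_ [B gB]] mg ge; rewrite I //; apply: q3 => //.
- split; last by exists B => s s0; apply: gB; rewrite mulr_ge0.
  by apply: measurable_funTS; exact: (measurableT_comp mg mh).
- exact: (measurableT_comp mg mh).
- by move=> s /andP[s0 s1]; apply: ge; rewrite mulr_ge0 // ler_piMr.
Qed.

Lemma integral_unit_FTC (f F : R -> R) : continuous f ->
  (forall x : R, is_derive x 1 F (f x)) ->
  (\int[mu]_(x in `[0%R, 1%R]) (f x)%:E = (F 1 - F 0)%:E)%E.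
Proof.
move=> cf dF; have cF : continuous F.
  by move=> x; apply: differentiable_continuous; apply/derivable1_diffP; have [] := dF x.
rewrite EFinB; apply: continuous_FTC2 => //.
- by apply: continuous_subspaceT.
- split.
  + by move=> x _; have [] := dF x.
  + by apply: cvg_at_right_filter; exact: cF.
  + by apply: cvg_at_left_filter; exact: cF.
- by move=> x _; rewrite derive1E; have [_ ] := dF x.
Qed.

Lemma integral_triangle z : 0 < z ->
  (\int[mu]_(x in `[0%R, 1%R]) ((1 - x) * expR (- (x * z)))%:E =
    (expR (- z) / z ^+ 2 + 1 / z - 1 / z ^+ 2)%:E)%E.
Proof.
move=> z0; have zn : z != 0 by rewrite gt_eqF.
pose F x : R := expR (- (x * z)) * (- ((1 - x) / z) + 1 / z ^+ 2).
have dF (x : R) : is_derive x 1 F ((1 - x) * expR (- (x * z))).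
  apply: is_derive_eq; rewrite /GRing.scale /=.
  by field.
have cf : continuous (fun x : R => (1 - x) * expR (- (x * z))).
  have cl : continuous (fun x : R => - (x * z)).
    by move=> x; apply: cvgN; apply: cvgMl; exact: cvg_id.
  move=> x; apply: cvgM.
    by apply: cvgB; [exact: cvg_cst|exact: cvg_id].
  by apply: (@continuous_comp R R R (fun x => - (x * z)) expR); [exact: cl|exact: continuous_expR].
rewrite (integral_unit_FTC cf dF) /F mul1r mul0r oppr0 expR0; congr (_%:E).
by field.
Qed.

Lemma integral_triangle0 : (\int[mu]_(x in `[0%R, 1%R]) (1 - x)%:E = (1 / 2)%:E)%E.
Proof.
pose F x : R := x - x ^+ 2 / 2.
have dF (x : R) : is_derive x 1 F (1 - x).
  by apply: is_derive_eq; rewrite /GRing.scale /=; field.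
have cf : continuous (fun x : R => 1 - x).
  by move=> x; apply: cvgB; [exact: cvg_cst|exact: cvg_id].
by rewrite (integral_unit_FTC cf dF) /F; congr (_%:E); field.
Qed.

(** Second order Taylor remainder: the exponential and the point mass at [1] have
    the same mean, and the difference of their transforms, divided by [z ^+ 2], is
    the transform of a positive density of mass one half. *)
Lemma lap_taylor2 : lap (1 / 2) (fun z => ((1 + z)^-1 - expR (- z)) / z ^+ 2).
Proof.
pose tri (x : R) : R := Num.max 0 (1 - x).
have mtri : measurable_fun setT (tri : RR -> R).
  apply: measurable_maxr; first exact: measurable_cst.
  by apply: measurable_funB => //; exact: measurable_cst.
pose w x : R := Num.max 0 (expR (- x) - tri x).
have mexp : measurable_fun setT (fun x : RR => expR (- x)).
  by have := @measurable_expNM R 1; under eq_fun do rewrite mulr1.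
have mw : measurable_fun setT (w : RR -> R).
  by apply: measurable_maxr; [exact: measurable_cst|exact: measurable_funB].
have wE x : 0 <= x -> w x + tri x = expR (- x).
  move=> x0; rewrite /w max_r ?subrK // subr_ge0 /tri ge_max expR_ge0 /=.
  exact: expR_ge1Dx.
have tri0 x : 0 <= tri x by rewrite le_max lexx.
have w0 x : 0 <= w x by rewrite le_max lexx.
have itvE : @Rplus R = `[0%R, +oo[%classic :> set RR.
  by apply/seteqP; split=> x /=; rewrite /Rplus /= in_itv /= andbT.
have mz z := @measurable_expNM R z.
have mwz z : measurable_fun (@Rplus R) (fun x : RR => (w x * expR (- (x * z)))%:E).
  by apply/measurable_EFinP; apply: measurable_funTS; apply: measurable_funM; [exact: mw|exact: mz].
have mtz z : measurable_fun (@Rplus R) (fun x : RR => (tri x * expR (- (x * z)))%:E).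
  by apply/measurable_EFinP; apply: measurable_funTS; apply: measurable_funM; [exact: mtri|exact: mz].
have triE z : (\int[mu]_(x in @Rplus R) (tri x * expR (- (x * z)))%:E =
    \int[mu]_(x in `[0%R, 1%R]) ((1 - x) * expR (- (x * z)))%:E)%E.
  rewrite integral_mkcond [RHS]integral_mkcond; apply: eq_integral => x _.
  rewrite !patchE itvE /tri; case: ifPn => [/set_mem|]; rewrite /= ?in_itv /= ?andbT => hx.
    case: ifPn => [/set_mem|].
      by rewrite /= in_itv /= hx /= => x1; rewrite max_r // subr_ge0.
    move=> /negP hn; rewrite max_l ?mul0r //.
    have [x1|/ltW x1] := leP x 1; last by rewrite subr_le0.
    by case: hn; apply/mem_set; rewrite /= in_itv /= hx.
  rewrite ifF //; apply/negP => /set_mem; rewrite /= in_itv /= => /andP[x0 _].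
  by move/negP: hx; apply; apply/mem_set; rewrite /= in_itv /= x0.
have sum z : 0 <= z -> (\int[mu]_(x in @Rplus R) (w x * expR (- (x * z)))%:E +
    \int[mu]_(x in `[0%R, 1%R]) ((1 - x) * expR (- (x * z)))%:E = ((1 + z)^-1)%:E)%E.
  move=> z0; rewrite -triE.
  have pw x : @Rplus R x -> (0 <= (w x * expR (- (x * z)))%:E)%E.
    by move=> _; rewrite lee_fin; apply: mulr_ge0; [exact: w0|exact: expR_ge0].
  have pt x : @Rplus R x -> (0 <= (tri x * expR (- (x * z)))%:E)%E.
    by move=> _; rewrite lee_fin; apply: mulr_ge0; [exact: tri0|exact: expR_ge0].
  rewrite -(ge0_integralD mu measurable_Rplus pw (mwz z) pt (mtz z)).
  rewrite -(@integral_exp_half_line (1 + z)) ?ltr_pwDl // -itvE.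
  apply: eq_integral => x; rewrite inE => x0; rewrite -EFinD -mulrDl wE // -expRD.
  by congr (expR _)%:E; ring.
have sum0 : (\int[mu]_(x in @Rplus R) (w x)%:E = (1 / 2)%:E)%E.
  have := sum 0 (lexx 0); rewrite addr0 invr1.
  rewrite (_ : (\int[mu]_(x in @Rplus R) (w x * expR (- (x * 0)))%:E)%E =
    (\int[mu]_(x in @Rplus R) (w x)%:E)%E); last first.
    by apply: eq_integral => x _; rewrite mulr0 oppr0 expR0 mulr1.
  rewrite (_ : (\int[mu]_(x in `[0%R, 1%R]) ((1 - x) * expR (- (x * 0)))%:E)%E =
    (\int[mu]_(x in `[0%R, 1%R]) (1 - x)%:E)%E); last first.
    by apply: eq_integral => x _; rewrite mulr0 oppr0 expR0 mulr1.
  rewrite integral_triangle0 => h.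
  have -> : 1 / 2 = 1 - 1 / 2 :> R by field.
  by rewrite EFinB -h addeK.
have fin : (\int[mu]_(x in @Rplus R) (w x)%:E < +oo)%E by rewrite sum0 ltry.
have [r hr] := push_Lap (m := mu) measurable_Rplus mw (@measurable_id _ RR setT)
  w0 (fun x h => h) fin.
have mr : mass r = 1 / 2.
  apply: EFin_inj; rewrite -Lap0 hr // -sum0.
  by apply: eq_integral => x _; rewrite mulr0 oppr0 expR0 mulr1.
have := lap_measure r; rewrite mr => h.
apply: (lap_ext h) => z z0; apply: EFin_inj; rewrite hr ?ltW //.
have := sum z (ltW z0); rewrite integral_triangle // => e.
have -> : (\int[mu]_(x in @Rplus R) (w x * expR (- (id x * z)))%:E)%E =
  ((1 + z)^-1 - (expR (- z) / z ^+ 2 + 1 / z - 1 / z ^+ 2))%:E.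
  by rewrite EFinB -e addeK.
congr (_%:E); field.
by rewrite !gt_eqF // ltr_pwDl // ltW.
Qed.

End LapAlgebra.

(** * The operators of the calculus *)

Section Rep.
Context {R : realType} {X : completeNormedModType R[i]}.
Variables (T : R -> {linear X -> X}) (M : R).
Hypothesis hT : C0_semigroup T.
Hypothesis M0 : 0 <= M.
Hypothesis TM : forall t x, 0 <= t -> rnorm (T t x) <= M * rnorm x.
Implicit Types (p q : finmeas R) (x y : X) (u v : X -> X) (phi psi : R -> R).

(** The symbol enters by its values on the positive half-line, which determine the
    operator by [rep_unique]. *)
Definition rep phi u := exists p q : finmeas R,
  (forall z, 0 < z -> phi z = Lap p z - Lap q z) /\
  forall x, u x = hpint T p x - hpint T q x.

Lemma rep_lap phi u : rep phi u -> exists V, lap V phi.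
Proof. by move=> [p [q [h _]]]; exists (mass p + mass q), p, q. Qed.

Lemma rep_ext phi psi u v : rep phi u -> (forall z, 0 < z -> psi z = phi z) ->
  (forall x, v x = u x) -> rep psi v.
Proof.
move=> [p [q [h1 h2]]] e1 e2; exists p, q; split=> [z z0|x]; first by rewrite e1 // h1.
by rewrite e2 h2.
Qed.

Lemma lap_rep V phi : lap V phi -> exists u, rep phi u /\
  forall x, rnorm (u x) <= M * V * rnorm x.
Proof.
move=> [p [q [h1 h2]]]; exists (fun x => hpint T p x - hpint T q x); split.
  by exists p, q.
move=> x; apply: le_trans (rnormB _ _) _.
apply: le_trans (lerD (hpint_norm hT TM p x) (hpint_norm hT TM q x)) _.
rewrite -mulrDl -mulrDr ler_wpM2r ?rnorm_ge0 // ler_wpM2l //.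
Qed.

Lemma rep_disc phi u : rep phi u -> exists V a, disc V phi a /\ approx T a u.
Proof.
move=> [p [q [h1 h2]]]; exists (mass p + mass q), (fun N k => pois_coef p N k - pois_coef q N k).
split.
  have [d1 d2] := discB (disc_pois p) (disc_pois q); split=> // N w /andP[w0 w1].
  rewrite h1; last by rewrite mulr_gt0 // subr_gt0.
  by apply: d2; rewrite w0.
move=> x e e0; rewrite h2.
exact: (approxB (hpint_approx hT M0 TM p) (hpint_approx hT M0 TM q)).
Qed.

(** Equal transforms have equal discretizations, of which both operators are limits. *)
Lemma rep_unique phi psi u v : rep phi u -> rep psi v ->
  (forall z, 0 < z -> phi z = psi z) -> forall x, u x = v x.
Proof.
move=> /rep_disc [V [a [d1 a1]]] /rep_disc [W [b [d2 b1]]] e.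
exact: approx_unique a1 b1 (disc_unique d1 d2 e).
Qed.

Lemma rep_linear phi u : rep phi u -> forall (c : R[i]) x y, u (c *: x + y) = c *: u x + u y.
Proof. by move=> /rep_disc [V [a [_ a1]]]; exact: approx_linear a1. Qed.

Lemma rep_sub phi u : rep phi u -> forall x y, u (x - y) = u x - u y.
Proof.
by move=> h x y; rewrite addrC -scaleN1r (rep_linear h) scaleN1r addrC.
Qed.

Lemma rep_scale phi u : rep phi u -> forall (c : R[i]) x, u (c *: x) = c *: u x.
Proof.
move=> h c x; have := rep_sub h 0 0; rewrite !subrr => u0.
by have := rep_linear h c x 0; rewrite u0 !addr0.
Qed.

(** [lapM] provides a measure for the product of the transforms; its operator and
    [u \o v] are limits of the same Cauchy products. *)
Lemma repM phi psi u v : rep phi u -> rep psi v -> rep (fun z => phi z * psi z) (u \o v).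
Proof.
move=> hu hv; have [V lu] := rep_lap hu; have [W lv] := rep_lap hv.
have [w [hw _]] := lap_rep (lapM lu lv).
apply: (rep_ext hw) => // x.
have [V1 [a [d1 a1]]] := rep_disc hu; have [V2 [b [d2 b1]]] := rep_disc hv.
have [V3 [c [d3 c1]]] := rep_disc hw.
have := approx_unique (approxM hT M0 TM d1 d2 a1 b1) c1; apply.
exact: disc_unique (discM d1 d2) d3 _.
Qed.

Lemma repB phi psi u v : rep phi u -> rep psi v ->
  rep (fun z => phi z - psi z) (fun x => u x - v x).
Proof.
move=> hu hv; have [V lu] := rep_lap hu; have [W lv] := rep_lap hv.
have [w [hw _]] := lap_rep (lapB lu lv).
apply: (rep_ext hw) => // x.
have [V1 [a [d1 a1]]] := rep_disc hu; have [V2 [b [d2 b1]]] := rep_disc hv.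
have [V3 [c [d3 c1]]] := rep_disc hw.
have := approx_unique (approxB a1 b1) c1; apply.
exact: disc_unique (discB d1 d2) d3 _.
Qed.

Lemma rep_comm phi psi u v : rep phi u -> rep psi v -> forall x, u (v x) = v (u x).
Proof. by move=> hu hv; apply: (rep_unique (repM hu hv) (repM hv hu)) => z _; rewrite mulrC. Qed.

Lemma rep_bounded phi u : rep phi u -> exists2 B, 0 <= B & forall x, rnorm (u x) <= B * rnorm x.
Proof.
move=> hu; have [V lu] := rep_lap hu.
have [w [hw wB]] := lap_rep lu; exists (`|M * V|) => // x.
rewrite (rep_unique hu hw) // (le_trans (wB x)) // ler_wpM2r ?rnorm_ge0 //.
exact: ler_norm.
Qed.

Lemma zero_measure : exists p : finmeas R, (forall z, 0 <= z -> Lap p z = 0) /\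
  forall x, hpint T p x = 0.
Proof.
have [r _] := dirac_exists (lexx (0 : R)).
have [p hp] := scale_exists r (lexx 0) (lexx 0).
exists p; split=> [z z0|x]; first by rewrite hp // mul0r.
apply: rnorm_eq0; apply/eqP; rewrite eq_le rnorm_ge0 andbT.
by rewrite (le_trans (hpint_norm hT TM p x)) // -Lap0 hp // mul0r mulr0 mul0r.
Qed.

Lemma rep_measure p : rep (Lap p) (hpint T p).
Proof.
have [n [n1 n2]] := zero_measure; exists p, n; split=> [z z0|x].
  by rewrite n1 ?subr0 // ltW.
by rewrite n2 subr0.
Qed.

Lemma measurable_orb_dist x (v : X) : measurable_fun setT (fun s : measurableTypeR R => rnorm (v - orb T x s)).
Proof.
apply: continuous_measurable_fun.
have := continuous_rnorm_comp (v := v) (continuous_orb hT TM (x := x)).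
by under eq_fun do rewrite rdistC.
Qed.

Lemma rep_semigroup t : 0 <= t -> rep (fun z => expR (- (t * z))) (T t).
Proof.
move=> t0; have [r hr] := dirac_exists t0.
apply: (rep_ext (rep_measure r)) => [z z0|x].
  rewrite /Lap hr //; exact: measurable_expNM.
have mr : mass r = 1 by rewrite -[LHS]mul1r -Iplus_cst hr.
apply: rnorm_le_eps => e e0.
have := hpint_near hT TM r x (T t x); rewrite mr scale1r => /le_trans; apply.
rewrite (Iplus_eq r (g2 := fun s => rnorm (T t x - orb T x s))); last first.
  by move=> s s0; rewrite orbE.
rewrite hr; first by rewrite orbE // subrr rnorm0 ltW.
- by move=> s; exact: rnorm_ge0.
- exact: measurable_orb_dist.
Qed.

Lemma rep_id : rep (fun=> 1) id.
Proof.
apply: (rep_ext (rep_semigroup (lexx 0))) => [z _|x]; first by rewrite mul0r oppr0 expR0.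
by rewrite (C0_zero hT).
Qed.

Lemma rep_cst (c : R) : rep (fun=> c) (fun y => c%:C *: y).
Proof.
have [S [hS _]] := lap_rep (lap_cst c); apply: (rep_ext hS) => // y.
have [V [a [d1 a1]]] := rep_disc hS; have [V' [b [d2 b1]]] := rep_disc rep_id.
have dc : disc (`|c| * V') (fun=> c) (fun N k => c * b N k).
  have [b2 b3] := d2; split=> [N K|N w hw].
    rewrite (eq_bigr (fun k : 'I_K => `|c| * `|b N k|)); last by move=> k _; rewrite normrM.
    by rewrite -mulr_sumr; apply: ler_wpM2l; [exact: normr_ge0|exact: b2].
  rewrite (_ : (fun K => _) = fun K => c * \sum_(k < K) b N k * w ^+ k).
    by rewrite -[X in _ --> X]mulr1; apply: cvgMr; exact: b3.
  by apply/funext => K; rewrite mulr_sumr; apply: eq_bigr => k _; rewrite mulrA.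
have ac : approx T (fun N k => c * b N k) (fun y => c%:C *: y).
  move=> z e e0; have c0 : 0 < `|c| + 1 by rewrite ltr_wpDl.
  have [N0 hN] := b1 z _ (divr_gt0 e0 c0).
  exists N0 => N /hN [K0 hK]; exists K0 => K /hK hk.
  rewrite (eq_bigr (fun k : 'I_K => c%:C *: ((b N k)%:C *: T (tpt N k) z))).
    rewrite -scaler_sumr -scalerBr rnormZr.
    apply: le_trans (ler_wpM2l (normr_ge0 c) hk) _.
    rewrite mulrCA -[leRHS]mulr1; apply: ler_wpM2l; first exact: ltW.
    by rewrite ler_pdivrMr // mul1r lerDl.
  by move=> k _; rewrite scalerA -rmorphM.
by apply/esym; apply: (approx_unique a1 ac); exact: disc_unique d1 dc _.
Qed.

Lemma repX phi u n : rep phi u -> rep (fun z => phi z ^+ n) (iter n u).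
Proof.
move=> h; elim: n => [|n IH]; first exact: rep_ext rep_id _ _.
by apply: (rep_ext (repM h IH)) => // z _; rewrite exprS.
Qed.

End Rep.

(** * Resolvents and injectivity *)

Section Resolvent.
Context {R : realType} {X : completeNormedModType R[i]}.
Variables (T : R -> {linear X -> X}) (A : operator X) (M : R).
Hypothesis hT : C0_semigroup T.
Hypothesis hA : forall x y, op_opp A x y <-> generator T x y.
Hypothesis M0 : 0 <= M.
Hypothesis TM : forall t x, 0 <= t -> rnorm (T t x) <= M * rnorm x.
Implicit Types (x y : X) (u v : X -> X).

Local Notation rep := (rep T).

Lemma resolvent_exists (h : R) : 0 < h -> exists E,
  rep (fun z => (1 + h * z)^-1) E /\ forall x, rnorm (E x) <= M * rnorm x.
Proof.
move=> h0; have [E [hE EM]] := lap_rep hT M0 TM (lap_scale h0 lap_resolvent1).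
by exists E; split=> // x; have := EM x; rewrite mulr1.
Qed.

(** [h (1 - T r) E = U (1 - E)] where [U] averages the orbit over [[0, r]]; letting
    [r] tend to [0] identifies the generator on the range of [E]. *)
Lemma generator_resolvent (h : R) E x : 0 < h -> rep (fun z => (1 + h * z)^-1) E ->
  generator T (E x) (- ((h^-1)%:C *: (x - E x))).
Proof.
move=> h0 hE; pose v := x - E x.
apply/cvg_rnormP => e e0; have eh : 0 < e * h / 2 by rewrite divr_gt0 // mulr_gt0.
have [d d0 hd] := semigroup_modulus hT TM v eh.
exists d => // r /= hr r0; rewrite sub0r normrN gtr0_norm // in hr.
have r0' := ltW r0.
have [q [q1 [q2 q3]]] := lap_uniform_scaled r0.
have hU := rep_measure hT TM q; set U := hpint T q in hU.
have near : rnorm (v - U v) <= e * h / 2.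
  have := hpint_near hT TM q v v; rewrite q2 scale1r => /le_trans; apply.
  rewrite (Iplus_eq q (g2 := fun s => rnorm (v - orb T v s))); last first.
    by move=> s s0; rewrite orbE.
  apply: q3.
  - by move=> s; exact: rnorm_ge0.
  - have b := bmv_continuous (continuous_orb hT TM (x := v)) (@orb_bound _ _ _ _ TM v).
    by have := b v; under eq_fun do rewrite rdistC.
  - exact: (measurable_orb_dist hT TM).
  - move=> s /andP[s0 sr]; rewrite orbE // -[X in X - _](C0_zero hT); apply: hd => //.
    by rewrite sub0r normrN ger0_norm // (le_lt_trans sr).
have key : E x - T r (E x) = (h^-1 * r)%:C *: U v.
  have hS := rep_cst hT M0 TM (h^-1 * r).
  have rl := repM hT M0 TM (repB hT M0 TM (rep_id hT TM) (rep_semigroup hT TM r0')) hE.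
  have rr := repM hT M0 TM hS (repM hT M0 TM hU (repB hT M0 TM (rep_id hT TM) hE)).
  have := rep_unique hT M0 TM rl rr; rewrite /= => /(_ _ x) -> //.
  move=> z z0; rewrite q1 //; field.
  have hz : 0 < 1 + h * z by rewrite addr_gt0 // mulr_gt0.
  by rewrite !gt_eqF.
have -> : (r^-1)%:C *: (T r (E x) - E x) - - ((h^-1)%:C *: v) = (h^-1)%:C *: (v - U v).
  rewrite opprK -[T r (E x) - E x]opprB key scalerN scalerA -rmorphM mulrCA mulVf ?gt_eqF //.
  by rewrite mulr1 [in RHS]scalerBr addrC.
rewrite rnormZr ger0_norm ?invr_ge0 ?ltW // mulrC ltr_pdivrMr //.
by apply: le_lt_trans near _; rewrite ltr_pdivrMr // ltr_pMr ?mulr_gt0 // ltr1n.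
Qed.

Lemma resolvent_op (h : R) E x : 0 < h -> rep (fun z => (1 + h * z)^-1) E ->
  A (E x) ((h^-1)%:C *: (x - E x)).
Proof.
move=> h0 hE; have /hA := generator_resolvent (x := x) h0 hE.
by rewrite /op_opp opprK.
Qed.

Lemma resolvent_of_op (h : R) E x y : 0 < h -> rep (fun z => (1 + h * z)^-1) E ->
  A x y -> E y = (h^-1)%:C *: (x - E x).
Proof.
move=> h0 hE Axy; have g1 : generator T x (- y) by apply/hA; rewrite /op_opp opprK.
have g2 := generator_resolvent (x := x) h0 hE.
have [B B0 EB] := rep_bounded hT M0 TM hE.
have c : (t^-1)%:C *: (T t (E x) - E x) @[t --> 0^'+] --> E (- y).
  apply/cvg_rnormP => e e0; have eB : 0 < e / (B + 1) by rewrite divr_gt0 // ltr_wpDl.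
  move/cvg_rnormP : g1 => /(_ _ eB) [d /= d0 hd]; exists d => // r /= hr r0.
  have r0' := ltW r0.
  have -> : T r (E x) = E (T r x).
    by rewrite (rep_comm hT M0 TM (rep_semigroup hT TM r0') hE).
  rewrite -(rep_sub hT M0 TM hE) -(rep_scale hT M0 TM hE) -(rep_sub hT M0 TM hE).
  apply: le_lt_trans (EB _) _.
  apply: (@le_lt_trans _ _ (B * (e / (B + 1)))).
    by rewrite ler_wpM2l // ltW // hd.
  rewrite mulrCA -[ltRHS]mulr1 ltr_pM2l // ltr_pdivrMr ?mul1r ?ltrDl //.
  by rewrite ltr_wpDl.
have EN : E (- y) = - E y.
  by rewrite -scaleN1r (rep_scale hT M0 TM hE) scaleN1r.
by apply: oppr_inj; rewrite -EN; exact: cvg_unique c g2.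
Qed.

Lemma op_invE (h : R) E x y : 0 < h -> rep (fun z => (1 + h * z)^-1) E ->
  op_inv (op_add (op_fun id) (op_scale h%:C A)) x y <-> y = E x.
Proof.
move=> h0 hE; have hh : h%:C * (h^-1)%:C = 1 :> R[i].
  by rewrite -rmorphM mulfV ?gt_eqF.
split.
  move=> [_ [_ [-> [w Ayw ->] ->]]]; rewrite (addrC y) (rep_linear hT M0 TM hE).
  by rewrite (resolvent_of_op h0 hE Ayw) scalerA hh scale1r subrK.
move=> ->; exists (E x), (x - E x); split=> //; last by rewrite addrC subrK.
exists ((h^-1)%:C *: (x - E x)); first exact: resolvent_op.
by rewrite scalerA hh scale1r.
Qed.

Lemma op_powE (B : operator X) (F : X -> X) n x y : (forall x y, B x y <-> y = F x) ->
  op_pow B n x y <-> y = iter n F x.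
Proof.
move=> BF; elim: n y => [|n IH] y //=; split.
  by move=> [w /IH -> /BF].
by move=> ->; exists (iter n F x); [exact/IH|exact/BF].
Qed.

Lemma Delta_rep n t : (0 < n)%N -> 0 < t -> exists D,
  rep (fun z => (1 + t / n%:R * z)^-1 ^+ n - expR (- (t * z))) D /\
  forall x w, Delta T A n t x w <-> w = D x.
Proof.
move=> n0 t0; have h0 : 0 < t / n%:R by rewrite divr_gt0 // ltr0n.
have [E [hE _]] := resolvent_exists h0.
exists (fun x => iter n E x - T t x); split.
  exact: (repB hT M0 TM (repX hT M0 TM n hE) (rep_semigroup hT TM (ltW t0))).
have powE x y := @op_powE _ E n x y (fun x y => op_invE x y h0 hE).
move=> x w; split.
  by move=> [a [b [/powE -> hb ->]]]; move: hb; rewrite /op_opp /op_fun => <-; rewrite opprK.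
by move=> ->; exists (iter n E x), (- T t x); split=> //; [exact/powE|rewrite /op_opp opprK].
Qed.

(** Mean ergodic theorem: as [h] grows, [E_h] tends to [0] on the range of [A],
    hence everywhere, while it fixes the kernel of [u]. *)
Lemma range_dense_injective u : closure (op_ran A) = setT ->
  rep (fun z => z / (1 + z)) u -> forall x, u x = 0 -> x = 0.
Proof.
move=> dense hu x ux0; apply: rnorm_le_eps => e e0; rewrite subr0.
have eM : 0 < e / (2 * (M + 1)) by rewrite divr_gt0 // mulr_gt0 // ltr_wpDl.
have [v [[z Azv] xv]] : exists v : X, op_ran A v /\ rnorm (x - v) < e / (2 * (M + 1)).
  have : closure (op_ran A) x by rewrite dense.
  have eC : 0 < (e / (2 * (M + 1)))%:C :> R[i] by rewrite ltcR.
  move=> /(_ _ (nbhsx_ballx x _ eC)) [v [rv]].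
  by rewrite -ball_normE /ball_ /= rnormE ltcR => hv; exists v.
pose h := 2 * (1 + M) * (rnorm z + 1) / e.
have m1 : 0 < 1 + M by rewrite ltr_pwDl.
have z1 : 0 < rnorm z + 1 by rewrite ltr_wpDl ?rnorm_ge0.
have h0 : 0 < h by rewrite divr_gt0 // mulr_gt0 // mulr_gt0.
have [E [hE EM]] := resolvent_exists h0.
(* The factor C of 1 - (1 + h s)^-1 = C s / (1 + s); it shows that E fixes x. *)
have lC : lap (`|1| + `|h - 1| * 1) (fun s => 1 + (h - 1) * (1 + h * s)^-1).
  apply: lapD; first exact: lap_cst.
  by apply: lapZ; exact: (lap_scale h0 lap_resolvent1).
have [C [hC _]] := lap_rep hT M0 TM lC.
have Ex : E x = x.
  have r1 := repB hT M0 TM (rep_id hT TM) hE.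
  have := rep_unique hT M0 TM r1 (repM hT M0 TM hC hu) _ x.
  rewrite /= ux0 => H; apply/esym/eqP; rewrite -subr_eq0 H; last first.
    move=> s s0; field.
    have s1 : 0 < 1 + s by rewrite addr_gt0.
    have hs : 0 < 1 + h * s by rewrite addr_gt0 // mulr_gt0.
    by rewrite !gt_eqF.
  by have := rep_sub hT M0 TM hC 0 0; rewrite !subrr => ->.
have Ev := resolvent_of_op h0 hE Azv.
rewrite -Ex -[X in E X](subrK v) -[X in _ + X]scale1r addrC (rep_linear hT M0 TM hE) scale1r.
apply: le_trans (rnormD _ _) _; rewrite [leRHS]splitr; apply: lerD; last first.
  apply: le_trans (EM _) _.
  apply: (@le_trans _ _ (M * (e / (2 * (M + 1))))); first by rewrite ler_wpM2l // ltW.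
  have m1' : 0 < M + 1 by rewrite addrC.
  have -> : M * (e / (2 * (M + 1))) = e / 2 * (M / (M + 1)) by field; rewrite gt_eqF.
  rewrite -[leRHS]mulr1; apply: ler_wpM2l; first by rewrite divr_ge0 // ltW.
  by rewrite ler_pdivrMr // mul1r lerDl.
have hi : 0 <= h^-1 by rewrite invr_ge0 ltW.
rewrite Ev rnormZr (ger0_norm hi) mulrC ler_pdivrMr //.
apply: le_trans (rnormB _ _) _.
apply: (@le_trans _ _ ((1 + M) * rnorm z)).
  by rewrite mulrDl mul1r lerD2l EM.
have -> : e / 2 * h = (1 + M) * (rnorm z + 1) by rewrite /h; field; rewrite gt_eqF.
by rewrite ler_wpM2l ?addr_ge0 // lerDl.
Qed.

Lemma regularizer_injective u : closure (op_ran A) = setT ->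
  rep (fun z => (z / (1 + z)) ^+ 2) u -> forall x y, u x = u y -> x = y.
Proof.
move=> dense hu x y uxy.
have [E [hE _]] := resolvent_exists (ltr01 : 0 < 1 :> R).
have hB := repB hT M0 TM (rep_id hT TM) hE.
have hB' : rep (fun z => z / (1 + z)) (fun x => x - E x).
  apply: (rep_ext hB) => // z z0 /=; field.
  have s1 : 0 < 1 + z by rewrite addr_gt0.
  by rewrite !gt_eqF.
have uB := rep_unique hT M0 TM hu (repM hT M0 TM hB' hB') (fun z z0 => expr2 _).
apply/eqP; rewrite -subr_eq0; apply/eqP.
apply: (range_dense_injective dense hB'); apply: (range_dense_injective dense hB').
have := uB (x - y); rewrite /= => <-.
by rewrite (rep_sub hT M0 TM hu) uxy subrr.
Qed.

End Resolvent.

(** * Stieltjes functions *)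

Section Stieltjes.
Context {R : realType}.
Local Notation RR := (measurableTypeR R).

Lemma powRN2 (x : R) : 0 < x -> x `^ (- 2) = x ^- 2.
Proof. by move=> x0; rewrite powRN powR_mulrn // ltW. Qed.

Variable mu : {measure set RR -> \bar R}.

Lemma measurable_inv_add (z : R) : measurable_fun setT (fun x : RR => (z + x) `^ (- 1)).
Proof.
apply: (@measurableT_comp _ _ _ _ _ _ (fun x => x `^ (- 1))); first exact: measurable_powR.
by apply: measurable_funD => //; exact: measurable_cst.
Qed.

Lemma measurable_inv_add2 (z : R) : measurable_fun setT (fun x : RR => (z + x) `^ (- 2)).
Proof.
apply: (@measurableT_comp _ _ _ _ _ _ (fun x => x `^ (- 2))); first exact: measurable_powR.
by apply: measurable_funD => //; exact: measurable_cst.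
Qed.

Lemma ge0_integralZl_fin (D : set RR) (c : R) (g : R -> R) : measurable D -> 0 <= c ->
  (forall x, D x -> 0 <= g x) -> measurable_fun setT (g : RR -> R) ->
  (\int[mu]_(x in D) (c * g x)%:E = c%:E * \int[mu]_(x in D) (g x)%:E)%E.
Proof.
move=> mD c0 g0 mg; under [LHS]eq_integral do rewrite EFinM.
apply: ge0_integralZl_EFin => //.
by apply/measurable_EFinP; apply: measurable_funTS.
Qed.

(** Mass far from the origin: [(z + tau)^-2] is [tau^-2] times the transform of a
    Gamma law, and [tau^-2 <= 4 * (c + tau)^-2] there. *)
Lemma lap_stieltjes_far (c : R) (J : R -> R) : 0 < c ->
  (forall z, 0 < z -> (\int[mu]_(x in `]c, +oo[) ((z + x) `^ (- 2))%:E = (J z)%:E)%E) ->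
  lap (4 * J c) J.
Proof.
move=> c0 hJ; pose D : set RR := [set` `]c, +oo[%R].
have mD : measurable D by exact: measurable_itv.
have Dc x : D x -> c < x by rewrite /D /= in_itv /= andbT.
have Dpos : D `<=` [set x | 0 < x] by move=> x /Dc /=; exact: lt_trans.
have [q hq] := @exponential_exists R; have [q2 hq2] := conv_exists q q.
pose w (x : R) := x `^ (- 2).
have mw : measurable_fun setT (w : RR -> R) by exact: measurable_powR.
have w0 x : 0 <= w x := powR_ge0 _ _.
have bound : (\int[mu]_(x in D) (w x)%:E <= (4 * J c)%:E)%E.
  rewrite EFinM -(hJ c c0).
  rewrite -(ge0_integralZl_fin mD _ (fun x _ => powR_ge0 (c + x) (- 2)) (measurable_inv_add2 c)) //.
  apply: ge0_le_integral => //.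
  - by move=> x _; rewrite lee_fin.
  - by apply/measurable_EFinP; apply: measurable_funTS.
  - apply/measurable_EFinP; apply: measurable_funTS; apply: measurable_funM.
      exact: measurable_cst.
    exact: measurable_inv_add2.
  - move=> x Dx; have cx := Dc x Dx; have x0 := lt_trans c0 cx.
    have cx0 : 0 < c + x by exact: addr_gt0.
    rewrite lee_fin /w (powRN2 x0) (powRN2 cx0) ler_pdivlMr ?exprn_gt0 // mulrC.
    rewrite ler_pdivrMr ?exprn_gt0 // -subr_ge0.
    have -> : 4 * x ^+ 2 - (c + x) ^+ 2 = (x - c) * (3 * x + c) by ring.
    by apply: mulr_ge0; lra.
have fin := le_lt_trans bound (ltry _).
have [r hr] := mix_exists q2 mD Dpos mw w0 fin.
have rE z : 0 < z -> Lap r z = J z.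
  move=> z0; apply: EFin_inj; rewrite hr ?ltW // -hJ //.
  apply: eq_integral => x; rewrite inE => /Dpos /= x0.
  have q0 : 0 <= z / x by apply: divr_ge0; exact: ltW.
  have zx : 0 < z + x by exact: addr_gt0.
  rewrite hq2 // !hq // /w (powRN2 x0) (powRN2 zx).
  congr (_%:E); field.
  have h1 : 0 < x + z by rewrite addr_gt0.
  have h2 : 0 < z + x by rewrite addr_gt0.
  by rewrite ?(gt_eqF h1) ?(gt_eqF h2) ?(gt_eqF x0).
have mr : mass r <= 4 * J c.
  rewrite -lee_fin -Lap0 hr //; apply: le_trans bound; rewrite le_eqVlt; apply/orP; left.
  by apply/eqP; apply: eq_integral => x _; rewrite mul0r hq2 // !hq // addr0 invr1 !mulr1.
apply: (lap_le _ mr); apply: (lap_ext (lap_measure r)) => z z0.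
by rewrite rE.
Qed.

(** Mass near the origin: [z ^+ 2 / (z + tau) ^+ 2 = (1 - tau / (z + tau)) ^+ 2] has
    total variation at most [4]. *)
Lemma lap_stieltjes_near (c : R) (J : R -> R) : 0 < c ->
  (forall z, 0 < z -> (\int[mu]_(x in `[0%R, c]) ((z + x) `^ (- 2))%:E = (J z)%:E)%E) ->
  lap (16 * c ^+ 2 * J c) (fun z => z ^+ 2 * J z).
Proof.
move=> c0 hJ; pose D : set RR := [set` `[0, c]%R]; pose D' : set RR := [set` `]0, c]%R].
have mD : measurable D by exact: measurable_itv.
have mD' : measurable D' by exact: measurable_itv.
have D0 x : D x -> 0 <= x by rewrite /D /= in_itv /= => /andP[].
have Dc x : D x -> x <= c by rewrite /D /= in_itv /= => /andP[].
have Dpos : D' `<=` [set x | 0 < x] by move=> x; rewrite /D' /= in_itv /= => /andP[].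
have D'D : D' `<=` D.
  by move=> x; rewrite /D /D' /= !in_itv /= => /andP[/ltW -> ->].
have [q hq] := @exponential_exists R; have [q2 hq2] := conv_exists q q.
have muD : (mu D <= (4 * c ^+ 2 * J c)%:E)%E.
  rewrite EFinM -(hJ c c0).
  have c4 : 0 <= 4 * c ^+ 2 by rewrite mulr_ge0 ?sqr_ge0.
  rewrite -(ge0_integralZl_fin mD c4 (fun x _ => powR_ge0 (c + x) (- 2)) (measurable_inv_add2 c)).
  rewrite -[leLHS]mul1e -(integral_cst mu mD 1%E).
  apply: ge0_le_integral => //.
  - apply/measurable_EFinP; apply: measurable_funTS; apply: measurable_funM.
      exact: measurable_cst.
    exact: measurable_inv_add2.
  - move=> x Dx; have x0 := D0 x Dx; have xc := Dc x Dx.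
    have cx : 0 < c + x by rewrite ltr_pwDl.
    rewrite lee_fin powRN2 // ler_pdivlMr ?exprn_gt0 // mul1r.
    rewrite -subr_ge0; have -> : 4 * c ^+ 2 - (c + x) ^+ 2 = (c - x) * (3 * c + x) by ring.
    by apply: mulr_ge0; lra.
have muDfin : (mu D < +oo)%E := le_lt_trans muD (ltry _).
pose m0 := fine (mu D).
have m0E : mu D = m0%:E by rewrite fineK // ge0_fin_numE.
have muD'fin : (mu D' <= m0%:E)%E by rewrite -m0E le_measure ?inE.
have fin : (\int[mu]_(x in D') ((fun=> 1) x)%:E < +oo)%E.
  rewrite (integral_cst mu mD' 1%E) mul1e; exact: le_lt_trans muD'fin (ltry _).
have [r1 hr1] := mix_exists q mD' Dpos (measurable_cst _) (fun=> ler01) fin.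
have [r2 hr2] := mix_exists q2 mD' Dpos (measurable_cst _) (fun=> ler01) fin.
pose g z (x : R) := x * (z + x) `^ (- 1).
have mg z : measurable_fun setT (g z : RR -> R).
  by apply: measurable_funM => //; exact: measurable_inv_add.
have g0 z x : D x -> 0 <= g z x by move=> /D0 x0; rewrite mulr_ge0 // powR_ge0.
have gE z x : 0 < z -> D' x -> (1 + z / x)^-1 = g z x.
  move=> z0 /Dpos /= x0; have zx : 0 < z + x by rewrite addr_gt0.
  have xz : 0 < x + z by rewrite addr_gt0.
  rewrite /g powR_inv1 ?ltW //; field.
  by rewrite ?(gt_eqF zx) ?(gt_eqF xz) ?(gt_eqF x0).
have g00 z : g z 0 = 0 by rewrite /g mul0r.
have toD (k : R -> R) : k 0 = 0 -> (\int[mu]_(x in D') (k x)%:E = \int[mu]_(x in D) (k x)%:E)%E.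
  move=> k0; rewrite integral_mkcond [RHS]integral_mkcond; apply: eq_integral => x _.
  rewrite !patchE; have [->|xn] := eqVneq x 0.
    by rewrite k0; case: ifP; case: ifP.
  rewrite (_ : (x \in D') = (x \in D)) //.
  apply/idP/idP => /set_mem h; apply/mem_set; first exact: D'D.
  by move: h; rewrite /D /D' /= !in_itv /= lt_def xn.
have r1E z : 0 < z -> (Lap r1 z)%:E = (\int[mu]_(x in D) (g z x)%:E)%E.
  move=> z0; rewrite hr1 ?ltW // -toD //; apply: eq_integral => x; rewrite inE => Dx.
  have x0 := Dpos x Dx.
  by rewrite mul1r hq ?gE // divr_ge0 // ltW.
have r2E z : 0 < z -> (Lap r2 z)%:E = (\int[mu]_(x in D) (g z x ^+ 2)%:E)%E.
  move=> z0; rewrite hr2 ?ltW // -toD ?g00 ?expr0n //.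
  apply: eq_integral => x; rewrite inE => Dx; have x0 := Dpos x Dx.
  have q0 : 0 <= z / x by apply: divr_ge0; exact: ltW.
  by rewrite mul1r hq2 // !hq // gE // expr2.
have key z : 0 < z -> z ^+ 2 * J z = m0 + Lap r2 z - 2 * Lap r1 z.
  move=> z0.
  have mgE : measurable_fun D (fun x => (2 * g z x)%:E).
    by apply/measurable_EFinP; apply: measurable_funTS; apply: measurable_funM => //; exact: measurable_cst.
  have m2E : measurable_fun D (fun x => (g z x ^+ 2)%:E).
    by apply/measurable_EFinP; apply: measurable_funTS; exact: measurable_funX.
  have mzE : measurable_fun D (fun x => (z ^+ 2 * (z + x) `^ (- 2))%:E).
    apply/measurable_EFinP; apply: measurable_funTS; apply: measurable_funM.
      exact: measurable_cst.
    exact: measurable_inv_add2.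
  have e1 : (z ^+ 2 * J z)%:E = (\int[mu]_(x in D) (z ^+ 2 * (z + x) `^ (- 2))%:E)%E.
    rewrite (ge0_integralZl_fin mD (sqr_ge0 z) (fun x _ => powR_ge0 (z + x) (- 2))
      (measurable_inv_add2 z)).
    by rewrite hJ.
  have e2 : (2 * Lap r1 z)%:E = (\int[mu]_(x in D) (2 * g z x)%:E)%E.
    rewrite (ge0_integralZl_fin mD _ (g0 z) (mg z)) //.
    by rewrite -r1E.
  have e3 : (m0%:E = \int[mu]_(x in D) (cst 1%E x))%E.
    by rewrite (integral_cst mu mD 1%E) mul1e m0E.
  suff : ((z ^+ 2 * J z)%:E + (2 * Lap r1 z)%:E = m0%:E + (Lap r2 z)%:E)%E.
    rewrite -!EFinD => h; have := EFin_inj h; lra.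
  have pz x : D x -> (0 <= (z ^+ 2 * (z + x) `^ (- 2))%:E)%E.
    by move=> _; rewrite lee_fin; apply: mulr_ge0; [exact: sqr_ge0|exact: powR_ge0].
  have pg x : D x -> (0 <= (2 * g z x)%:E)%E.
    by move=> Dx; rewrite lee_fin mulr_ge0 // g0.
  have p1 x : D x -> (0 <= cst 1%E x :> \bar R)%E by [].
  have p2 x : D x -> (0 <= (g z x ^+ 2)%:E)%E by rewrite lee_fin sqr_ge0.
  rewrite e1 e2 e3 r2E // -(ge0_integralD mu mD pz mzE pg mgE).
  rewrite -(ge0_integralD mu mD p1 (measurable_cst _) p2 m2E).
  apply: eq_integral => x; rewrite inE => /D0 x0.
  have zx : 0 < z + x by rewrite ltr_pwDl.
  rewrite -!EFinD /g powRN2 // powR_inv1 ?ltW //; congr (_%:E); field.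
  by rewrite gt_eqF.
have massr1 : mass r1 <= m0.
  rewrite -lee_fin -Lap0 hr1 //; apply: le_trans muD'fin.
  rewrite (_ : (\int[mu]_(x in D') (1 * Lap q (0 / x))%:E)%E = (\int[mu]_(x in D') cst 1%E x)%E).
    by rewrite (integral_cst mu mD' 1%E) mul1e.
  by apply: eq_integral => x _; rewrite mul0r hq // addr0 invr1 mulr1.
have massr2 : mass r2 <= m0.
  rewrite -lee_fin -Lap0 hr2 //; apply: le_trans muD'fin.
  rewrite (_ : (\int[mu]_(x in D') (1 * Lap q2 (0 / x))%:E)%E = (\int[mu]_(x in D') cst 1%E x)%E).
    by rewrite (integral_cst mu mD' 1%E) mul1e.
  by apply: eq_integral => x _; rewrite mul0r hq2 // !hq // addr0 invr1 !mulr1.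
have m00 : 0 <= m0 by rewrite fine_ge0.
have hm0 : m0 <= 4 * c ^+ 2 * J c by rewrite -lee_fin -m0E.
have l1 := lapB (lapD (lap_cst m0) (lap_measure r2)) (lapZ 2 (lap_measure r1)).
apply: (lap_ext (lap_le l1 _)); last by move=> z z0; rewrite key.
rewrite !ger0_norm //; apply: (@le_trans _ _ (4 * m0)); first by lra.
rewrite -[leRHS]mulrA; rewrite -mulrA in hm0; lra.
Qed.

End Stieltjes.

Section StieltjesSplit.
Context {R : realType}.
Local Notation RR := (measurableTypeR R).

(** Cutting the measure at [c] puts all its mass at a distance of at most [c] from
    the origin into [J0], which becomes a transform after multiplication by [z ^+ 2];
    both bounds are expressed by values at [c]. *)
Lemma stieltjes_split (f : R -> R) (c : R) : stieltjes 2 f -> 0 < c ->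
  exists (a : R) (J0 J1 : R -> R),
  [/\ 0 <= a, 0 <= J0 c, 0 <= J1 c, forall z, 0 < z -> f z = a + J0 z + J1 z &
    lap (16 * c ^+ 2 * J0 c) (fun z => z ^+ 2 * J0 z) /\ lap (4 * J1 c) J1].
Proof.
move=> [a [mu [a0 _ hf]]] c0.
pose D0 : set RR := [set` `[0, c]%R]; pose D1 : set RR := [set` `]c, +oo[%R].
have mD0 : measurable D0 by exact: measurable_itv.
have mD1 : measurable D1 by exact: measurable_itv.
have DU : @Rplus R = D0 `|` D1.
  apply/seteqP; split=> x; rewrite /Rplus /D0 /D1 /= !in_itv /= andbT.
    by move=> x0; rewrite x0 /=; have [xc|xc] := leP x c; [left|right].
  by move=> [/andP[]//|/ltW]; apply: le_trans; exact: ltW.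
have DI : [disjoint D0 & D1].
  apply/disj_setPLR => x; rewrite /D0 /D1 /= !in_itv /= andbT => /andP[_ xc].
  by apply/negP; rewrite -leNgt.
pose k z (x : R) : \bar R := ((z + x) `^ (- 2))%:E.
have mk z : measurable_fun setT (k z : RR -> \bar R).
  by apply/measurable_EFinP; exact: measurable_inv_add2.
have k0 z x : (0 <= k z x)%E by rewrite lee_fin powR_ge0.
have split z : (\int[mu]_(x in @Rplus R) k z x =
    \int[mu]_(x in D0) k z x + \int[mu]_(x in D1) k z x)%E.
  by rewrite DU ge0_integral_setU // -DU; apply: measurable_funTS.
pose J (D : set RR) z := fine (\int[mu]_(x in D) k z x)%E.
have fin z : 0 < z -> (\int[mu]_(x in @Rplus R) k z x < +oo)%E.
  move=> z0; have h : (f z)%:E = (a%:E + \int[mu]_(x in @Rplus R) k z x)%E := hf z z0.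
  by move: h; case: (\int[mu]_(x in @Rplus R) k z x)%E => [r _|//|//]; exact: ltry.
have JE D z : measurable D -> D `<=` @Rplus R -> 0 < z -> (\int[mu]_(x in D) k z x = (J D z)%:E)%E.
  move=> mD DR z0; rewrite /J fineK // ge0_fin_numE; last exact: integral_ge0.
  apply: le_lt_trans (fin z z0); apply: ge0_subset_integral => //.
  - exact: measurable_Rplus.
  - exact: measurable_funTS.
have D0R : D0 `<=` @Rplus R by rewrite DU; left.
have D1R : D1 `<=` @Rplus R by rewrite DU; right.
exists a, (J D0), (J D1); split => //.
- by apply: fine_ge0; apply: integral_ge0.
- by apply: fine_ge0; apply: integral_ge0.
- move=> z z0; apply: EFin_inj; rewrite hf // split !EFinD -addeA.
  by rewrite !JE.
split.
  by apply: (lap_stieltjes_near (mu := mu) c0) => z z0; exact: JE.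
by apply: (lap_stieltjes_far (mu := mu) c0) => z z0; exact: JE.
Qed.

(** The rational approximant and the exponential differ by a sum of products with the
    factor [(1 + h z)^-1 - e^(-h z)]. *)
Lemma lap_delta_square (n : nat) (t : R) : (0 < n)%N -> 0 < t ->
  lap (t ^+ 2 / (2 * n%:R)) (fun z => ((1 + t / n%:R * z)^-1 ^+ n - expR (- (t * z))) / z ^+ 2).
Proof.
move=> n0 t0; pose h := t / n%:R; have nR : 0 < n%:R :> R by rewrite ltr0n.
have h0 : 0 < h by rewrite divr_gt0.
have l1 := lapZ (h ^+ 2) (lap_scale h0 (@lap_taylor2 R)).
pose F k (z : R) := (1 + h * z)^-1 ^+ (n.-1 - k) * expR (- (h * z)) ^+ k.
have lF k : (k < n)%N -> lap 1 (F k).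
  move=> _; have := lapM (lap_exprn (n.-1 - k) ler01 (lap_scale h0 (@lap_resolvent1 R)))
    (lap_exprn k ler01 (lap_exp (ltW h0))).
  by rewrite !expr1n mulr1.
have := lapM l1 (lap_sum lF).
have -> : `|h ^+ 2| * (1 / 2) * (n%:R * 1) = t ^+ 2 / (2 * n%:R).
  by rewrite ger0_norm ?sqr_ge0 // /h; field; rewrite gt_eqF.
move=> l2; apply: (lap_ext l2) => z z0.
have -> : expR (- (t * z)) = expR (- (h * z)) ^+ n.
  rewrite -expRM_natl; congr expR; rewrite /h mulrN -mulrA mulrCA; congr (- _).
  by field; rewrite gt_eqF.
rewrite -/h subrXX /F mulrAC; congr (_ * _).
have h1 : 0 < 1 + h * z by rewrite addr_gt0 // mulr_gt0.
by field; rewrite !gt_eqF.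
Qed.

Lemma lap_delta (n : nat) (t : R) : (0 < n)%N -> 0 < t ->
  lap 2 (fun z => (1 + t / n%:R * z)^-1 ^+ n - expR (- (t * z))).
Proof.
move=> n0 t0; have h0 : 0 < t / n%:R by rewrite divr_gt0 // ltr0n.
have := lapB (lap_exprn n ler01 (lap_scale h0 (@lap_resolvent1 R))) (lap_exp (ltW t0)).
by rewrite expr1n.
Qed.

(** The near part is paired with [lap_delta_square] and the far part with the trivial
    bound [lap_delta]. At [c = sqrt n / t] one has [c ^+ 2 * t ^+ 2 / n = 1], and
    the three terms become [2 * a], [8 * J0 c] and [8 * J1 c]. *)
Lemma lap_stieltjes_delta (f : R -> R) (n : nat) (t : R) : stieltjes 2 f -> (0 < n)%N -> 0 < t ->
  lap (8 * f (Num.sqrt n%:R / t))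
    (fun z => f z * ((1 + t / n%:R * z)^-1 ^+ n - expR (- (t * z)))).
Proof.
move=> sf n0 t0; set c := Num.sqrt n%:R / t.
have nR : 0 < n%:R :> R by rewrite ltr0n.
have c0 : 0 < c by rewrite divr_gt0 // sqrtr_gt0.
have [a [J0 [J1 [a0 J00 J10 fE [l0 l1]]]]] := stieltjes_split sf c0.
have ld := lap_delta n0 t0; have ls := lap_delta_square n0 t0.
have l := lapD (lapD (lapM (lap_cst a) ld) (lapM l0 ls)) (lapM l1 ld).
apply: (lap_ext (lap_le l _)) => [|z z0]; last first.
  by rewrite fE //; field; rewrite gt_eqF.
rewrite fE // ger0_norm //.
have -> : 16 * c ^+ 2 * J0 c * (t ^+ 2 / (2 * n%:R)) = 8 * J0 c.
  rewrite /c expr_div_n sqr_sqrtr ?ltW //; field.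
  by rewrite !gt_eqF.
lra.
Qed.

(** The factor [z ^+ 2] of the regularizer absorbs the near part of the measure. *)
Lemma lap_stieltjes_regularized (f : R -> R) : stieltjes 2 f ->
  exists V, lap V (fun z => (z / (1 + z)) ^+ 2 * f z).
Proof.
move=> sf; have [a [J0 [J1 [a0 J00 J10 fE [l0 l1]]]]] := stieltjes_split sf (ltr01 : 0 < 1 :> R).
have lr := @lap_resolvent1 R.
have le := lap_exprn 2 (addr_ge0 (normr_ge0 1) ler01) (lapB (lap_cst 1) lr).
have l := lapD (lapM (lapD (lap_cst a) l1) le) (lapM (lap_exprn 2 ler01 lr) l0).
eexists; apply: (lap_ext l) => z z0.
by rewrite fE //; field; rewrite gt_eqF // addr_gt0.
Qed.

Lemma lap_regularizer : exists V, lap V (fun z : R => (z / (1 + z)) ^+ 2).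
Proof.
have le := lap_exprn 2 (addr_ge0 (normr_ge0 1) ler01) (lapB (lap_cst 1) (@lap_resolvent1 R)).
eexists; apply: (lap_ext le) => z z0.
by field; rewrite gt_eqF // addr_gt0.
Qed.

End StieltjesSplit.

(** * Power series over the complex numbers *)

Section ComplexSeries.
Context {R : realType}.
Local Notation C := (R[i]^o).
Implicit Types (z w : R[i]).

Definition cn z : R := rnorm (z : C).

Lemma cnE z : `|z| = (cn z)%:C.
Proof. exact: (@rnormE R C z). Qed.

Lemma cn_ge0 z : 0 <= cn z.
Proof. exact: rnorm_ge0. Qed.

Lemma cnM z w : cn (z * w) = cn z * cn w.
Proof. by apply: (@complexI R); rewrite -cnE normrM !cnE rmorphM. Qed.

Lemma cn_real (r : R) : cn r%:C = `|r|.
Proof. by apply: (@complexI R); rewrite -cnE normc_def /= expr0n addr0 sqrtr_sqr. Qed.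

Lemma cn1 : cn 1 = 1.
Proof. by rewrite -[1]/(1%:C) cn_real normr1. Qed.

Lemma cn0 : cn 0 = 0.
Proof. exact: rnorm0. Qed.

Lemma cn_eq0 z : cn z = 0 -> z = 0.
Proof. exact: rnorm_eq0. Qed.

Lemma cnX z k : cn (z ^+ k) = cn z ^+ k.
Proof. by elim: k => [|k IH]; rewrite ?expr0 ?cn1 // !exprS cnM IH. Qed.

Lemma cnD z w : cn (z + w) <= cn z + cn w.
Proof. exact: rnormD. Qed.

Lemma cnN z : cn (- z) = cn z.
Proof. exact: rnormN. Qed.

Lemma cn_sum (I : Type) (s : seq I) (P : pred I) (F : I -> R[i]) :
  cn (\sum_(i <- s | P i) F i) <= \sum_(i <- s | P i) cn (F i).
Proof. exact: (@rnorm_sum R C). Qed.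

Lemma cn_Re z : `|complex.Re z| <= cn z.
Proof. by have := normc_ge_Re z; rewrite cnE lecR. Qed.

Lemma cn_Im z : `|complex.Im z| <= cn z.
Proof.
have := cn_Re (z * 'i%C); rewrite cnM (_ : cn 'i%C = 1) ?mulr1.
  by rewrite ReiNIm normrN.
apply: (@complexI R); rewrite -cnE normc_def /= expr0n add0r expr1n sqrtr1 //.
Qed.

Lemma cn_le z : cn z <= `|complex.Re z| + `|complex.Im z|.
Proof.
rewrite [z in cn z]complexE; apply: le_trans (cnD _ _) _.
rewrite cn_real lerD2l cnM cn_real ler_piMl //.
by rewrite (_ : cn 'i%C = 1) //; apply: (@complexI R);
   rewrite -cnE normc_def /= expr0n add0r expr1n sqrtr1.
Qed.

Lemma ReB z w : complex.Re (z - w) = complex.Re z - complex.Re w.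
Proof. by case: z; case: w. Qed.

Lemma ImB z w : complex.Im (z - w) = complex.Im z - complex.Im w.
Proof. by case: z; case: w. Qed.

Lemma Re_sum (I : Type) (s : seq I) (P : pred I) (F : I -> R[i]) :
  complex.Re (\sum_(i <- s | P i) F i) = \sum_(i <- s | P i) complex.Re (F i).
Proof. by elim/big_rec2 : _ => // i y x _ <-; case: x (F i) => [a b] [c d]. Qed.

Lemma Im_sum (I : Type) (s : seq I) (P : pred I) (F : I -> R[i]) :
  complex.Im (\sum_(i <- s | P i) F i) = \sum_(i <- s | P i) complex.Im (F i).
Proof. by elim/big_rec2 : _ => // i y x _ <-; case: x (F i) => [a b] [c d]. Qed.

Lemma cvg_Re_Im (u : nat -> R[i]) z :
  (fun n => complex.Re (u n)) @ \oo --> complex.Re z ->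
  (fun n => complex.Im (u n)) @ \oo --> complex.Im z -> (u : nat -> C) @ \oo --> (z : C).
Proof.
move=> cr ci; apply: (@cvg_rnorm_le _ _ _ _ _ _ _
  (fun n => `|complex.Re (u n) - complex.Re z| + `|complex.Im (u n) - complex.Im z|)).
  by move=> n; rewrite -ReB -ImB; exact: cn_le.
have : (fun n => `|complex.Re (u n) - complex.Re z| + `|complex.Im (u n) - complex.Im z|)
    @ \oo --> `|complex.Re z - complex.Re z| + `|complex.Im z - complex.Im z|.
  by apply: cvgD; apply: cvg_norm; apply: cvgB => //; exact: cvg_cst.
by rewrite !subrr normr0 addr0.
Qed.

Lemma cexpD z w : cexp (z + w) = cexp z * cexp w.
Proof.
case: z => a b; case: w => c d; rewrite /cexp /= expRD cosD sinD; simpc.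
by congr (_ +i* _); ring.
Qed.

Lemma cexpE (a b : R) : cexp (a +i* b) = (expR a * cos b) +i* (expR a * sin b).
Proof. by rewrite /cexp /=; simpc. Qed.

Lemma cn_cexp z : cn (cexp z) = expR (complex.Re z).
Proof.
case: z => a b; rewrite /= cexpE; apply: (@complexI R); rewrite -cnE normc_def /=.
by rewrite !exprMn -mulrDr cos2Dsin2 mulr1 sqrtr_sqr ger0_norm // expR_ge0.
Qed.

Definition esum z K : R[i] := \sum_(k < K) z ^+ k / k`!%:R.

Lemma fact_real k : k`!%:R^-1 = (k`!%:R^-1)%:C :> R[i].
Proof. by rewrite rmorphV ?unitfE ?pnatr_eq0 -?lt0n ?fact_gt0 // rmorph_nat. Qed.

Lemma cn_exp_term z k : cn (z ^+ k / k`!%:R) = cn z ^+ k / k`!%:R.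
Proof. by rewrite cnM cnX fact_real cn_real ger0_norm ?invr_ge0. Qed.

Lemma esum_le z K : cn (esum z K) <= expR (cn z).
Proof.
apply: le_trans (cn_sum _ _ _) _.
rewrite (eq_bigr (fun k : 'I_K => cn z ^+ k / k`!%:R)); last by move=> k _; rewrite cn_exp_term.
apply: (sum_le_lim (u := fun k => cn z ^+ k / k`!%:R)); last exact: series_exp_cvg.
by move=> k; rewrite divr_ge0 // exprn_ge0 // cn_ge0.
Qed.

Lemma imag_expr (y : R) k :
  (0 +i* y) ^+ k / k`!%:R = cos_coeff y k +i* sin_coeff y k :> R[i].
Proof.
have h m : (0 +i* y) ^+ m.*2 = ((-1) ^+ m * y ^+ m.*2)%:C :> R[i].
  elim: m => [|m IH]; first by rewrite !expr0 mulr1.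
  by rewrite doubleS !exprS IH; simpc; congr (_ +i* _); ring.
rewrite fact_real /cos_coeff /sin_coeff /=; case: (boolP (odd k)) => ko /=.
  rewrite -{1}[k]odd_double_half ko add1n exprS h; simpc.
  congr (_ +i* _).
  have -> : k.-1./2 = k./2 by rewrite -{1}[k]odd_double_half ko add1n /= doubleK.
  have -> : y ^+ k = y * y ^+ k./2.*2 by rewrite -exprS -[in LHS](odd_double_half k) ko.
  by ring.
rewrite -{1}[k]odd_double_half (negbTE ko) add0n h; simpc.
congr (_ +i* _).
have -> : y ^+ k = y ^+ k./2.*2 by rewrite -[in LHS](odd_double_half k) (negbTE ko).
by rewrite ?mul1r.
Qed.

Lemma esum_imag_cvg (y : R) :
  (esum (0 +i* y) : nat -> C) @ \oo --> ((cos y +i* sin y : R[i]) : C).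
Proof.
apply: cvg_Re_Im => /=.
  rewrite (_ : (fun n => _) = series (cos_coeff y)).
    by rewrite unlock; exact: is_cvg_series_cos_coeff.
  apply/funext => n; rewrite /esum /series /= big_mkord.
  under eq_bigr do rewrite imag_expr.
  by rewrite Re_sum.
rewrite (_ : (fun n => _) = series (sin_coeff y)).
  by rewrite unlock; exact: is_cvg_series_sin_coeff.
apply/funext => n; rewrite /esum /series /= big_mkord.
under eq_bigr do rewrite imag_expr.
by rewrite Im_sum.
Qed.

End ComplexSeries.

(** * Local power series expansions *)

Section ComplexAnalytic.
Context {R : realType}.
Local Notation C := (R[i]^o).
Implicit Types (z w : R[i]).

Lemma cvg_cn (u : nat -> R[i]) z :
  (u : nat -> C) @ \oo --> (z : C) <-> forall e : R, 0 < e -> exists N, forall n, (N <= n)%N -> cn (u n - z) <= e.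
Proof.
split.
  move=> /cvg_rnormP h e e0; have [N _ hN] := h e e0.
  by exists N => n hn; apply: ltW; exact: hN.
move=> h; apply/cvg_rnormP => e e0; have [N hN] := h _ (divr_gt0 e0 (ltr0Sn R 1)).
exists N => // n hn; apply: le_lt_trans (hN n hn) _.
by rewrite ltr_pdivrMr // ltr_pMr // ltr1n.
Qed.

Lemma cvg_cnM (u v : nat -> R[i]) z w :
  (u : nat -> C) @ \oo --> (z : C) -> (v : nat -> C) @ \oo --> (w : C) ->
  ((fun n => u n * v n) : nat -> C) @ \oo --> (z * w : C).
Proof.
move=> /cvg_cn hu /cvg_cn hv; apply/cvg_cn => e e0.
pose D := cn z + cn w + 1.
have D0 : 0 < D by rewrite ltr_wpDl // addr_ge0 // cn_ge0.
pose d := Num.min 1 (e / (2 * D)).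
have d0 : 0 < d by rewrite lt_min ltr01 divr_gt0 // mulr_gt0.
have [N hN] := hu d d0; have [N' hN'] := hv d d0.
exists (maxn N N') => n; rewrite geq_max => /andP[/hN h1 /hN' h2].
have -> : u n * v n - z * w = (u n - z) * v n + z * (v n - w) by ring.
apply: le_trans (cnD _ _) _; rewrite !cnM.
have d1 : d <= 1 by rewrite ge_min lexx.
have d2 : d * (2 * D) <= e by rewrite -ler_pdivlMr ?mulr_gt0 // ge_min lexx orbT.
have v1 : cn (v n) <= cn w + 1.
  by rewrite -[v n](subrK w) (le_trans (cnD _ _)) // addrC lerD2l (le_trans h2).
have h3 : cn (u n - z) * cn (v n) <= d * (cn w + 1) by rewrite ler_pM // cn_ge0.
have h4 : cn z * cn (v n - w) <= d * cn z by rewrite mulrC ler_wpM2r // cn_ge0.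
apply: le_trans (lerD h3 h4) _; rewrite -mulrDr; apply: le_trans d2.
rewrite ler_wpM2l ?ltW // /D; have := cn_ge0 z; have := cn_ge0 w; lra.
Qed.

(** The product of the exponential series of [x] and of [i y], summed by squares, is
    known to converge; the binomial formula gives the sum by triangles. *)
Lemma esum_cvg z : (esum z : nat -> C) @ \oo --> (cexp z : C).
Proof.
case: z => x y; rewrite cexpE.
have -> : expR x * cos y +i* (expR x * sin y) = (expR x)%:C * (cos y +i* sin y).
  by simpc.
pose m i j : C := (x%:C ^+ i / i`!%:R) * ((0 +i* y) ^+ j / j`!%:R).
have t0 (a : R) k : 0 <= a -> 0 <= a ^+ k / k`!%:R.
  by move=> a0; rewrite divr_ge0 // exprn_ge0.
have bd (a : R) K : 0 <= a -> \sum_(k < K) a ^+ k / k`!%:R <= expR a.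
  move=> a0; apply: (sum_le_lim (u := fun k => a ^+ k / k`!%:R)).
    by move=> k; exact: t0.
  exact: series_exp_cvg.
have hm i j : rnorm (m i j) <= (`|x| ^+ i / i`!%:R) * (`|y| ^+ j / j`!%:R).
  rewrite -/(cn (m i j)) /m cnM !cn_exp_term cn_real.
  rewrite (_ : cn (0 +i* y) = `|y|) //.
  by apply: (@complexI R); rewrite -cnE normc_def /= expr0n add0r sqrtr_sqr.
have sq := square_minus_triangle (fun k => t0 _ k (normr_ge0 x)) (fun k => t0 _ k (normr_ge0 y))
  (fun K => bd _ K (normr_ge0 x)) (fun K => bd _ K (normr_ge0 y)) hm.
have cx : (esum x%:C : nat -> C) @ \oo --> ((expR x)%:C : C).
  have rE K : esum x%:C K = (\sum_(k < K) x ^+ k / k`!%:R)%:C.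
    rewrite /esum rmorph_sum; apply: eq_bigr => k _.
    by rewrite fact_real rmorphM rmorphXn.
  apply: cvg_Re_Im.
    rewrite (_ : (fun n => _) = fun K => \sum_(k < K) x ^+ k / k`!%:R).
      exact: series_exp_cvg.
    by apply/funext => K; rewrite rE.
  rewrite (_ : (fun n => _) = fun=> 0); first exact: cvg_cst.
  by apply/funext => K; rewrite rE.
have /cvg_cn prod := cvg_cnM cx (@esum_imag_cvg R y).
apply/cvg_cn => e e0; have e2 : 0 < e / 2 by rewrite divr_gt0.
have [K1 h1] := prod _ e2; have [K2 h2] := sq _ e2.
exists (maxn K1 K2) => K; rewrite geq_max => /andP[/h1 {}h1 /h2 {}h2].
have E1 : \sum_(i < K) \sum_(j < K) m i j = esum x%:C K * esum (0 +i* y) K.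
  by rewrite /esum mulr_suml; apply: eq_bigr => i _; rewrite mulr_sumr.
have E2 : \sum_(k < K) \sum_(i < k.+1) m i (k - i)%N = esum (x +i* y) K.
  apply: eq_bigr => k _.
  have -> : x +i* y = (0 +i* y) + x%:C :> R[i] by simpc.
  rewrite exprDn mulr_suml; apply: eq_bigr => i _.
  have ik : (i <= k)%N by rewrite -ltnS.
  have f0 j : j`!%:R != 0 :> R[i] by rewrite pnatr_eq0 -lt0n fact_gt0.
  rewrite -mulr_natr -(bin_fact ik) !natrM /m.
  by field; rewrite !f0 pnatr_eq0 -lt0n bin_gt0 ik.
rewrite E1 E2 in h2.
have -> : esum (x +i* y) K - (expR x)%:C * (cos y +i* sin y) =
  (esum (x +i* y) K - esum x%:C K * esum (0 +i* y) K) +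
  (esum x%:C K * esum (0 +i* y) K - (expR x)%:C * (cos y +i* sin y)).
  by rewrite addrA subrK.
by apply: le_trans (cnD _ _) _; rewrite [leRHS]splitr lerD.
Qed.

(** The Cauchy bound belongs to the notion, so that expansions can be multiplied and
    differentiated without returning to the convergence of the series. *)
Definition ana (f : R[i] -> R[i]) z0 := exists (c : nat -> R[i]) (r B : R),
  [/\ 0 < r, forall k, cn (c k) * r ^+ k <= B &
    forall z, cn (z - z0) < r ->
      ((fun K => \sum_(k < K) c k * (z - z0) ^+ k) : nat -> C) @ \oo --> (f z : C)].

Lemma cauchy_bound_le (c : nat -> R[i]) (r r' B : R) : 0 < r' -> r' <= r ->
  (forall k, cn (c k) * r ^+ k <= B) -> forall k, cn (c k) * r' ^+ k <= B.
Proof.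
move=> r'0 r'r h k; apply: le_trans (h k); rewrite ler_wpM2l ?cn_ge0 //.
by apply: lerXn2r => //; rewrite nnegrE ltW // (lt_le_trans r'0).
Qed.

Lemma anaB f g z0 : ana f z0 -> ana g z0 -> ana (fun z => f z - g z) z0.
Proof.
move=> [c [r [B [r0 cB hc]]]] [d [r' [B' [r'0 dB hd]]]].
pose s := Num.min r r'; have s0 : 0 < s by rewrite lt_min r0.
have sr : s <= r by rewrite ge_min lexx.
have sr' : s <= r' by rewrite ge_min lexx orbT.
exists (fun k => c k - d k), s, (B + B'); split=> //.
  move=> k; have h1 := cauchy_bound_le s0 sr cB k; have h2 := cauchy_bound_le s0 sr' dB k.
  apply: le_trans (lerD h1 h2); rewrite -mulrDl.
  apply: ler_wpM2r; first by rewrite exprn_ge0 // ltW.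
  by apply: le_trans (cnD _ _) _; rewrite cnN.
move=> z hz; rewrite (_ : (fun K => _) = fun K =>
    (\sum_(k < K) c k * (z - z0) ^+ k : C) - (\sum_(k < K) d k * (z - z0) ^+ k : C)).
  apply: cvgB; [exact: hc (lt_le_trans hz sr)|exact: hd (lt_le_trans hz sr')].
by apply/funext => K; rewrite -sumrB; apply: eq_bigr => k _; rewrite mulrBl.
Qed.

Lemma anaZ (a : R[i]) f z0 : ana f z0 -> ana (fun z => a * f z) z0.
Proof.
move=> [c [r [B [r0 cB hc]]]]; exists (fun k => a * c k), r, (cn a * B); split; first exact: r0.
  by move=> k; rewrite cnM -mulrA; apply: ler_wpM2l; [exact: cn_ge0|exact: cB].
move=> z hz; rewrite (_ : (fun K => _) = fun K => a * \sum_(k < K) c k * (z - z0) ^+ k).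
  by apply: cvg_cnM (hc z hz); exact: cvg_cst.
by apply/funext => K; rewrite mulr_sumr; apply: eq_bigr => k _; rewrite mulrA.
Qed.

Lemma geom_half (K : nat) : \sum_(k < K) (2%:R^-1 : R) ^+ k <= 2%:R.
Proof.
suff : \sum_(k < K) (2%:R^-1 : R) ^+ k = 2%:R - 2%:R * 2%:R^-1 ^+ K.
  by move=> ->; rewrite lerBlDr lerDl mulr_ge0 // exprn_ge0 // invr_ge0.
elim: K => [|K IH]; first by rewrite big_ord0 expr0 mulr1 subrr.
by rewrite big_ord_recr /= IH exprS; field.
Qed.

Lemma anaM f g z0 : ana f z0 -> ana g z0 -> ana (fun z => f z * g z) z0.
Proof.
move=> [c [r [B [r0 cB hc]]]] [d [r' [B' [r'0 dB hd]]]].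
pose s := Num.min r r'; have s0 : 0 < s by rewrite lt_min r0.
have sr : s <= r by rewrite ge_min lexx.
have sr' : s <= r' by rewrite ge_min lexx orbT.
have {cB}cB := cauchy_bound_le s0 sr cB; have {dB}dB := cauchy_bound_le s0 sr' dB.
(* Halving the radius makes the coefficient bounds geometrically summable. *)
pose q := s / 2; have q0 : 0 < q by rewrite divr_gt0.
have qE k : q ^+ k = s ^+ k * 2%:R^-1 ^+ k by rewrite /q exprMn.
have B0 : 0 <= B by apply: le_trans (cB 0%N); rewrite expr0 mulr1 cn_ge0.
have B'0 : 0 <= B' by apply: le_trans (dB 0%N); rewrite expr0 mulr1 cn_ge0.
have h0 k : 0 <= 2%:R^-1 ^+ k :> R by rewrite exprn_ge0 // invr_ge0.
have cq k : cn (c k) * q ^+ k <= B * 2%:R^-1 ^+ k by rewrite qE mulrA ler_wpM2r.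
have dq k : cn (d k) * q ^+ k <= B' * 2%:R^-1 ^+ k by rewrite qE mulrA ler_wpM2r.
exists (fun k => \sum_(i < k.+1) c i * d (k - i)%N), q, (B * 2%:R * B'); split=> //.
  move=> k; apply: (@le_trans _ _ (\sum_(i < k.+1) (B * 2%:R^-1 ^+ i) * B')).
    apply: le_trans (ler_wpM2r (exprn_ge0 _ (ltW q0)) (cn_sum _ _ _)) _.
    rewrite mulr_suml; apply: ler_sum => i _; rewrite cnM.
    have ik : (i <= k)%N by rewrite -ltnS.
    have -> : q ^+ k = q ^+ i * q ^+ (k - i) by rewrite -exprD subnKC.
    rewrite mulrACA; apply: ler_pM => //.
    - by rewrite mulr_ge0 ?cn_ge0 // exprn_ge0 // ltW.
    - by rewrite mulr_ge0 ?cn_ge0 // exprn_ge0 // ltW.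
    - apply: le_trans (dq _) _; rewrite ler_piMr // exprn_ile1 ?invr_ge0 //.
      by rewrite invf_le1 // ler1n.
  by rewrite -mulr_suml -mulr_sumr ler_wpM2r // ler_wpM2l // geom_half.
move=> z hz; have qs : q <= s by rewrite ler_pdivrMr // ler_pMr // ler1n.
have zq := ltW hz; have z0' := cn_ge0 (z - z0).
have /cvg_cn prod := cvg_cnM (hc z (lt_le_trans hz (le_trans qs sr))) (hd z (lt_le_trans hz (le_trans qs sr'))).
pose m i j : C := c i * d j * (z - z0) ^+ (i + j).
have hm i j : rnorm (m i j) <= (B * 2%:R^-1 ^+ i) * (B' * 2%:R^-1 ^+ j).
  rewrite -/(cn (m i j)) /m !cnM cnX exprD mulrACA.
  have P (e : R[i]) k : cn e * cn (z - z0) ^+ k <= cn e * q ^+ k.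
    by rewrite ler_wpM2l ?cn_ge0 // lerXn2r // nnegrE // ltW.
  apply: ler_pM.
  - by rewrite mulr_ge0 ?cn_ge0 // exprn_ge0.
  - by rewrite mulr_ge0 ?cn_ge0 // exprn_ge0.
  - exact: le_trans (P _ _) (cq _).
  - exact: le_trans (P _ _) (dq _).
have A0 k : 0 <= B * 2%:R^-1 ^+ k by rewrite mulr_ge0.
have A0' k : 0 <= B' * 2%:R^-1 ^+ k by rewrite mulr_ge0.
have A1 K : \sum_(k < K) B * 2%:R^-1 ^+ k <= B * 2%:R.
  by rewrite -mulr_sumr ler_wpM2l // geom_half.
have A1' K : \sum_(k < K) B' * 2%:R^-1 ^+ k <= B' * 2%:R.
  by rewrite -mulr_sumr ler_wpM2l // geom_half.
have sq := square_minus_triangle A0 A0' A1 A1' hm.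
apply/cvg_cn => e e0; have e2 : 0 < e / 2 by rewrite divr_gt0.
have [K1 h1] := prod _ e2; have [K2 h2] := sq _ e2.
exists (maxn K1 K2) => K; rewrite geq_max => /andP[/h1 {}h1 /h2 {}h2].
set S := \sum_(k < K) _.
have E1 : \sum_(i < K) \sum_(j < K) m i j =
    (\sum_(k < K) c k * (z - z0) ^+ k) * (\sum_(k < K) d k * (z - z0) ^+ k).
  rewrite mulr_suml; apply: eq_bigr => i _; rewrite mulr_sumr; apply: eq_bigr => j _.
  by rewrite /m exprD mulrACA.
have E2 : \sum_(k < K) \sum_(i < k.+1) m i (k - i)%N = S.
  apply: eq_bigr => k _; rewrite mulr_suml; apply: eq_bigr => i _.
  by rewrite /m subnKC // -ltnS.
rewrite E1 E2 in h2.
rewrite -[S - _](subrKA ((\sum_(k < K) c k * (z - z0) ^+ k) * (\sum_(k < K) d k * (z - z0) ^+ k))).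
by apply: le_trans (cnD _ _) _; rewrite [leRHS]splitr lerD.
Qed.

(** A function with an expansion at [z0] and zeros accumulating at [z0] vanishes
    near [z0]: scaled to the unit disc, its coefficients are bounded, and
    [power_series_eq0] applies. *)
Lemma ana_isolated f z0 : ana f z0 ->
  (forall e : R, 0 < e -> exists z, 0 < cn (z - z0) < e /\ f z = 0) ->
  exists2 r : R, 0 < r & forall z, cn (z - z0) < r -> f z = 0.
Proof.
move=> [c [r [B [r0 cB hc]]]] hz.
have rn : r%:C != 0 :> R[i] by rewrite eq_complex /= eqxx andbT gt_eqF.
have c0 k : c k * r%:C ^+ k = 0.
  apply: (@power_series_eq0 R[i] (fun k => c k * r%:C ^+ k) B%:C).
    move=> j; rewrite cnE lecR cnM cnX cn_real gtr0_norm //; exact: cB.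
  move=> e; rewrite ltcE /= => /andP[/eqP ei er].
  have e0 : 0 < Num.min r (complex.Re e * r) by rewrite lt_min r0 mulr_gt0.
  have [z [/andP[z0' ze] fz]] := hz _ e0.
  exists ((z - z0) / r%:C).
  have cnr : cn (r%:C^-1) = r^-1.
    by rewrite -rmorphV ?unitfE ?gt_eqF // cn_real gtr0_norm // invr_gt0.
  split.
    rewrite cnE ltcR cnM cnr divr_gt0 //= ltcE /= ei eqxx /= ltr_pdivrMr //.
    by apply: lt_le_trans ze _; rewrite ge_min lexx orbT.
  have zr : cn (z - z0) < r by apply: lt_le_trans ze _; rewrite ge_min lexx.
  have := hc z zr; rewrite fz.
  rewrite (_ : (fun K => \sum_(k < K) c k * (z - z0) ^+ k) =
     (fun n => \sum_(k < n) c k * r%:C ^+ k * ((z - z0) / r%:C) ^+ k)) //.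
  apply/funext => K; apply: eq_bigr => j _.
  by rewrite expr_div_n -mulrA [r%:C ^+ j * _]mulrC divfK // expf_neq0.
exists r => // z zr; have h := hc z zr.
have h0 : ((fun K => \sum_(k < K) c k * (z - z0) ^+ k) : nat -> C) @ \oo --> (0 : C).
  rewrite (_ : (fun K => _) = fun=> 0); first exact: cvg_cst.
  apply/funext => K; rewrite big1 // => k _.
  have /eqP := c0 k; rewrite mulf_eq0 expf_eq0 (negbTE rn) andbF orbF => /eqP ->.
  by rewrite mul0r.
exact: cvg_unique h h0.
Qed.

End ComplexAnalytic.

(** * Analytic continuation in the right half-plane *)

Section Holomorphy.
Context {R : realType}.
Local Notation C := (R[i]^o).
Implicit Types (z w : R[i]) (p : finmeas R).

(** The terms of a series that converges at a distance [q] from [z0] are bounded,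
    which is the Cauchy bound for the radius [q]. *)
Lemma analytic_on_ana (U : set R[i]) f z0 : analytic_on U f -> U z0 -> ana f z0.
Proof.
move=> hf Uz; have [c [r [r0 hc]]] := hf z0 Uz.
pose q := r / 2; have q0 : 0 < q by rewrite divr_gt0.
have qr : q < r by rewrite ltr_pdivrMr // ltr_pMr // ltr1n.
have hs z : cn (z - z0) < r ->
    ((fun K => \sum_(k < K) c k * (z - z0) ^+ k) : nat -> C) @ \oo --> (f z : C).
  move=> zr; have := hc z; rewrite cnE ltcR => /(_ zr).
  rewrite (_ : series _ = fun K => \sum_(k < K) c k * (z - z0) ^+ k) //.
  by apply/funext => K; rewrite /series /= big_mkord.
have cz1 : cn (z0 + q%:C - z0) = q by rewrite addrC addKr cn_real gtr0_norm.
have /cvg_cn /(_ 1 ltr01) [N hN] : ((fun K => \sum_(k < K) c k * q%:C ^+ k) : nat -> C)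
    @ \oo --> (f (z0 + q%:C) : C).
  have := hs (z0 + q%:C); rewrite cz1 => /(_ qr).
  by rewrite [z0 + q%:C - z0]addrC addKr.
exists c, q, (\sum_(k < N) cn (c k) * q ^+ k + 2); split=> //; last first.
  by move=> z zq; apply: hs; exact: lt_trans zq qr.
move=> k; have t0 j : 0 <= cn (c j) * q ^+ j by rewrite mulr_ge0 ?cn_ge0 // exprn_ge0 // ltW.
have [kN|kN] := ltnP k N.
  rewrite (bigD1 (Ordinal kN)) //= -addrA lerDl addr_ge0 //.
  by apply: sumr_ge0 => j _.
apply: (@le_trans _ _ 2); last by rewrite lerDr sumr_ge0.
have h1 := hN k kN; have h2 := hN k.+1 (leqW kN).
rewrite big_ord_recr /= in h2.
have -> : cn (c k) * q ^+ k = cn (c k * q%:C ^+ k).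
  by rewrite cnM cnX cn_real gtr0_norm.
set S := \sum_(i < k) _ in h1 h2; set t := c k * _ in h2 *.
have -> : t = (S + t - f (z0 + q%:C)) - (S - f (z0 + q%:C)) by ring.
by apply: le_trans (cnD _ _) _; rewrite cnN (le_trans (lerD h2 h1)).
Qed.

(** Within half the radius, the remainder after the linear term is a geometric series
    of the order of the squared increment. *)
Lemma ana_derivable f z0 : ana f z0 -> derivable (f : C -> C) z0 1.
Proof.
move=> [c [r [B [r0 cB hc]]]].
have B0 : 0 <= B by apply: le_trans (cB 0%N); rewrite expr0 mulr1 cn_ge0.
have f0 : f z0 = c 0%N.
  have := hc z0; rewrite subrr cn0 => /(_ r0) h.
  have h' : ((fun K => \sum_(k < K) c k * 0 ^+ k) : nat -> C) @ \oo --> (c 0%N : C); last first.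
    exact: cvg_unique h h'.
  apply/cvg_cn => e e0; exists 1%N => -[//|n] _.
  rewrite big_ord_recl expr0 mulr1 big1 ?addr0 ?subrr ?cn0 ?ltW //.
  by move=> j _; rewrite expr0n mulr0.
apply/cvg_ex; exists (c 1%N : C); apply/cvg_rnormP => e e0.
pose D := 2 * B / r ^+ 2 + 1.
have D0 : 0 < D by rewrite ltr_wpDl // divr_ge0 ?sqr_ge0 // mulr_ge0.
pose d := Num.min (r / 2) (e / (2 * D)).
have d0 : 0 < d by rewrite lt_min divr_gt0 //= divr_gt0 // mulr_gt0.
have dC : 0 < d%:C :> R[i] by rewrite ltcR.
exists d%:C => // h /= hd h0.
rewrite sub0r normrN cnE ltcR in hd.
have hr2 : cn h < r / 2 by apply: lt_le_trans hd _; rewrite ge_min lexx.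
have hr : cn h < r by apply: lt_trans hr2 _; rewrite ltr_pdivrMr // ltr_pMr // ltr1n.
have hn : 0 < cn h by rewrite lt_def cn_ge0 andbT; apply: contra_neq h0; exact: cn_eq0.
have -> : h *: (1 : C) = h by rewrite -[LHS]/(h * 1) mulr1.
have E : cn (f (h + z0) - c 0%N - c 1%N * h) <= 2 * B / r ^+ 2 * cn h ^+ 2.
  have hzz : h + z0 - z0 = h by rewrite addrK.
  have := hc (h + z0); rewrite hzz => /(_ hr) /cvg_cn cv.
  apply/ler_addgt0Pr => e' e'0; have [N hN] := cv e' e'0.
  have {hN} := hN N.+2 (leqW (leqnSn N)).
  rewrite 2!big_ord_recl expr0 mulr1 expr1 /=.
  set S := \sum_(i < N) _ => hS.
  have SB : cn S <= 2 * B / r ^+ 2 * cn h ^+ 2.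
    apply: le_trans (cn_sum _ _ _) _.
    apply: (@le_trans _ _ (\sum_(i < N) B / r ^+ 2 * cn h ^+ 2 * 2%:R^-1 ^+ i)).
      apply: ler_sum => i _; rewrite cnM cnX /bump /= !add1n.
      have rk : cn (c i.+2) <= B / r ^+ i.+2 by rewrite ler_pdivlMr ?exprn_gt0.
      apply: (@le_trans _ _ (B / r ^+ i.+2 * (cn h ^+ 2 * (r / 2) ^+ i))).
        apply: ler_pM => //; [exact: cn_ge0|by rewrite exprn_ge0 // cn_ge0|].
        rewrite -addn2 addnC exprD ler_wpM2l ?sqr_ge0 // lerXn2r // ?nnegrE ?cn_ge0 ?ltW //.
        by rewrite divr_gt0.
      rewrite -[i.+2]addn2 exprD expr_div_n exprVn le_eqVlt; apply/orP; left; apply/eqP.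
      by field; rewrite !expf_neq0 ?gt_eqF.
    rewrite -mulr_sumr; apply: le_trans (ler_wpM2l _ (geom_half N)) _.
      by rewrite mulr_ge0 ?sqr_ge0 // divr_ge0 ?sqr_ge0.
    by rewrite le_eqVlt; apply/orP; left; apply/eqP; field; rewrite gt_eqF.
  have -> : f (h + z0) - c 0%N - c 1%N * h = S - (c 0%N + (c 1%N * h + S) - f (h + z0)) by ring.
  by apply: le_trans (cnD _ _) _; rewrite cnN lerD.
rewrite -[rnorm _]/(cn _).
have -> : h^-1 *: ((f \o shift z0) h - f z0 : C) - c 1%N = h^-1 * (f (h + z0) - c 0%N - c 1%N * h).
  by rewrite f0 /= mulrBr mulrCA [h^-1 * h]mulVf // mulr1.
have hV : cn h^-1 = (cn h)^-1.
  have hn0 : cn h != 0 by rewrite gt_eqF.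
  by apply: (mulIf hn0); rewrite -cnM !mulVf // cn1.
rewrite cnM hV mulrC ltr_pdivrMr //; apply: le_lt_trans E _.
rewrite expr2 mulrA ltr_pM2r //.
apply: (@le_lt_trans _ _ (D * d)).
  by apply: ler_pM; [rewrite divr_ge0 ?sqr_ge0 // mulr_ge0|exact: cn_ge0|rewrite /D lerDl|exact: ltW].
apply: (@le_lt_trans _ _ (e / 2)); last by rewrite ltr_pdivrMr // ltr_pMr // ltr1n.
rewrite mulrC -ler_pdivlMr // -mulrA -invfM.
by rewrite ge_min lexx orbT.
Qed.

Lemma Re_segment (t : R) z : complex.Re (1 + t%:C * (z - 1)) = (1 - t) + t * complex.Re z.
Proof. by case: z => a b /=; ring. Qed.

(** Continuation along the segment from [1]: the supremum [s] of the initial stretch of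
    zeros is an accumulation point of zeros, so that the stretch extends beyond
    [s] unless [s = 1]. *)
Lemma identity_Cplus (h : R[i] -> R[i]) : (forall z, Cplus z -> ana h z) ->
  (forall x : R, 0 < x -> h x%:C = 0) -> forall z, Cplus z -> h z = 0.
Proof.
move=> ha hr z zp; have [->|z1] := eqVneq z 1; first exact: hr.
pose g (t : R) := 1 + t%:C * (z - 1).
pose d := cn (z - 1).
have d0 : 0 < d.
  rewrite lt_def cn_ge0 andbT; apply: contra_neq z1 => /cn_eq0 /eqP.
  by rewrite subr_eq0 => /eqP.
have gd t u : cn (g t - g u) = `|t - u| * d.
  by rewrite -cn_real -cnM rmorphB; congr cn; rewrite /g; ring.
have gp t : 0 <= t <= 1 -> Cplus (g t).
  move=> /andP[t0 t1]; rewrite /Cplus /= /g Re_segment.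
  move: t0; rewrite le_eqVlt => /orP[/eqP <-|t0]; first by rewrite subr0 mul0r addr0.
  by rewrite ltr_wpDl ?subr_ge0 // mulr_gt0.
pose S := [set t : R | 0 <= t <= 1 /\ forall u, 0 <= u <= t -> h (g u) = 0].
have S0 : S 0.
  split; first by rewrite lexx ler01.
  move=> u /andP[u0 u1]; have -> : u = 0 by apply/eqP; rewrite eq_le u0 u1.
  by rewrite /g mul0r addr0; exact: hr.
have S1 : ubound S 1 by move=> t [/andP[]].
have supS : has_sup S by split; [exists 0|exists 1].
pose s := sup S.
have s0 : 0 <= s by exact: (ub_le_sup supS.2).
have s1 : s <= 1 by apply: ge_sup => //; exists 0.
have below u : 0 <= u -> u < s -> h (g u) = 0.
  move=> u0 us; have e0 : 0 < s - u by rewrite subr_gt0.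
  have [t [_ ht]] := sup_adherent e0 supS; rewrite opprB addrC subrK => ut.
  by apply: ht; rewrite u0 ltW.
have gs : Cplus (g s) by apply: gp; rewrite s0.
have acc e : 0 < e -> exists w, 0 < cn (w - g s) < e /\ h w = 0.
  move=> e0; move: s0; rewrite le_eqVlt => /orP[/eqP ss|sp].
    exists (1 + e / 2)%:C; split.
      have -> : (1 + e / 2)%:C - g s = (e / 2)%:C :> R[i].
        by rewrite /g -ss rmorphD mul0r /=; ring.
      by rewrite cn_real gtr0_norm ?divr_gt0 //= ltr_pdivrMr // ltr_pMr // ltr1n.
    by apply: hr; rewrite addr_gt0 // divr_gt0.
  pose t := Num.max 0 (s - e / (2 * d)).
  have ts : t < s by rewrite gt_max sp /= ltrBlDr ltrDl divr_gt0 // mulr_gt0.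
  exists (g t); split; last by apply: below => //; rewrite le_max lexx.
  rewrite gd mulr_gt0 ?normr_gt0 ?subr_eq0 ?lt_eqF //=.
  rewrite ler0_norm ?opprB; last by rewrite subr_le0 ltW.
  apply: (@le_lt_trans _ _ (e / (2 * d) * d)).
    rewrite ler_wpM2r ?(ltW d0) // lerBlDr -lerBlDl /t le_max; apply/orP; right.
    by [].
  have -> : e / (2 * d) * d = e / 2 by field; rewrite gt_eqF.
  by rewrite ltr_pdivrMr // ltr_pMr // ltr1n.
have [r r0 hz] := ana_isolated (ha _ gs) acc.
pose t := Num.min 1 (s + r / (2 * d)).
have rd : 0 < r / (2 * d) by rewrite divr_gt0 // mulr_gt0.
have tS : S t.
  split; first by rewrite le_min ler01 ge_min lexx /= addr_ge0 // ltW.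
  move=> u /andP[u0 ut]; have [us|su] := ltP u s; first exact: below.
  apply: hz; rewrite gd ger0_norm ?subr_ge0 //.
  apply: (@le_lt_trans _ _ (r / (2 * d) * d)).
    rewrite ler_wpM2r ?(ltW d0) // lerBlDl (le_trans ut) // ge_min lexx orbT //.
  have -> : r / (2 * d) * d = r / 2 by field; rewrite gt_eqF.
  by rewrite ltr_pdivrMr // ltr_pMr // ltr1n.
have ts : t <= s by exact: (ub_le_sup supS.2).
have s1' : s = 1.
  apply/eqP; rewrite eq_le s1 /=; move: ts; rewrite ge_min => /orP[//|].
  by rewrite gerDl leNgt rd.
apply: hz; rewrite s1' (_ : z - g 1 = 0) ?cn0 //.
by rewrite /g mul1r; ring.
Qed.

End Holomorphy.

(** * Laplace transforms of complex measures *)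

Section ComplexLaplace.
Context {R : realType}.
Local Notation C := (R[i]^o).
Implicit Types (z w : R[i]) (p : finmeas R) (h : R -> R[i]).

Definition bmc h := bm (fun s => complex.Re (h s)) /\ bm (fun s => complex.Im (h s)).

Lemma cintegralE p h :
  cintegral p h = Iplus p (fun s => complex.Re (h s)) +i* Iplus p (fun s => complex.Im (h s)).
Proof. by []. Qed.

Lemma ReM z w : complex.Re (z * w) = complex.Re z * complex.Re w - complex.Im z * complex.Im w.
Proof. by case: z; case: w. Qed.

Lemma ImM z w : complex.Im (z * w) = complex.Re z * complex.Im w + complex.Im z * complex.Re w.
Proof. by case: z; case: w. Qed.

Lemma bmcM h w : bmc h -> bmc (fun s => h s * w).
Proof.
move=> [hr hi]; split.
  rewrite (_ : (fun s => _) = fun s => complex.Re w * complex.Re (h s) - complex.Im w * complex.Im (h s)).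
    by apply: bmB; exact: bmZ.
  by apply/funext => s; rewrite ReM; ring.
rewrite (_ : (fun s => _) = fun s => complex.Im w * complex.Re (h s) + complex.Re w * complex.Im (h s)).
  by apply: bmD; exact: bmZ.
by apply/funext => s; rewrite ImM; ring.
Qed.

Lemma cintegralM p h w : bmc h -> cintegral p h * w = cintegral p (fun s => h s * w).
Proof.
move=> [hr hi]; rewrite !cintegralE.
have -> : Iplus p (fun s => complex.Re (h s * w)) =
    complex.Re w * Iplus p (fun s => complex.Re (h s)) - complex.Im w * Iplus p (fun s => complex.Im (h s)).
  rewrite -!IplusZ // -IplusB; try exact: bmZ.
  by apply: Iplus_eq => s _; rewrite ReM; ring.
have -> : Iplus p (fun s => complex.Im (h s * w)) =
    complex.Im w * Iplus p (fun s => complex.Re (h s)) + complex.Re w * Iplus p (fun s => complex.Im (h s)).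
  rewrite -!IplusZ // -IplusD; try exact: bmZ.
  by apply: Iplus_eq => s _; rewrite ImM; ring.
by case: w => a b /=; simpc; congr (_ +i* _); ring.
Qed.

Lemma cintegral_sum p K (u : nat -> R -> R[i]) : (forall k, bmc (u k)) ->
  \sum_(k < K) cintegral p (u k) = cintegral p (fun s => \sum_(k < K) u k s).
Proof.
move=> bu; apply/eqP; rewrite eq_complex Re_sum Im_sum cintegralE /=.
have -> : Iplus p (fun s => complex.Re (\sum_(k < K) u k s)) =
    \sum_(k < K) Iplus p (fun s => complex.Re (u k s)).
  rewrite -Iplus_sum; last by move=> k; have [] := bu k.
  by apply: Iplus_eq => s _; rewrite Re_sum.
have -> : Iplus p (fun s => complex.Im (\sum_(k < K) u k s)) =
    \sum_(k < K) Iplus p (fun s => complex.Im (u k s)).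
  rewrite -Iplus_sum; last by move=> k; have [] := bu k.
  by apply: Iplus_eq => s _; rewrite Im_sum.
by rewrite !eqxx.
Qed.

Lemma bmc_sum K (u : nat -> R -> R[i]) : (forall k, bmc (u k)) ->
  bmc (fun s => \sum_(k < K) u k s).
Proof.
move=> bu; split.
  rewrite (_ : (fun s => _) = fun s => \sum_(k < K) complex.Re (u k s)).
    by apply: bm_sum => k; have [] := bu k.
  by apply/funext => s; rewrite Re_sum.
rewrite (_ : (fun s => _) = fun s => \sum_(k < K) complex.Im (u k s)).
  by apply: bm_sum => k; have [] := bu k.
by apply/funext => s; rewrite Im_sum.
Qed.

Lemma cintegral_dct p (h_ : nat -> R -> R[i]) h (B : R) :
  (forall n, bmc (h_ n)) -> bmc h -> (forall n s, 0 <= s -> cn (h_ n s) <= B) ->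
  (forall s, 0 <= s -> ((fun n => h_ n s) : nat -> C) @ \oo --> (h s : C)) ->
  ((fun n => cintegral p (h_ n)) : nat -> C) @ \oo --> (cintegral p h : C).
Proof.
move=> bh_ bh hB hc; apply: cvg_Re_Im => /=.
  apply: (@Iplus_dct _ _ _ _ B).
  - by move=> n; have [] := bh_ n.
  - by have [] := bh.
  - by move=> n s s0; apply: le_trans (cn_Re _) (hB _ _ s0).
  - move=> s s0; have /cvg_cn hs := hc s s0; apply/cvgrPdist_le => e e0.
    have [N hN] := hs e e0; exists N => // n hn; rewrite distrC -ReB.
    exact: le_trans (cn_Re _) (hN n hn).
apply: (@Iplus_dct _ _ _ _ B).
- by move=> n; have [] := bh_ n.
- by have [] := bh.
- by move=> n s s0; apply: le_trans (cn_Im _) (hB _ _ s0).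
- move=> s s0; have /cvg_cn hs := hc s s0; apply/cvgrPdist_le => e e0.
  have [N hN] := hs e e0; exists N => // n hn; rewrite distrC -ImB.
  exact: le_trans (cn_Im _) (hN n hn).
Qed.

Lemma cexp_kernel (s : R) z : cexp (- (s%:C * z)) =
  (expR (- (s * complex.Re z)) * cos (- (s * complex.Im z))) +i*
  (expR (- (s * complex.Re z)) * sin (- (s * complex.Im z))).
Proof. by case: z => a b /=; rewrite -cexpE; congr cexp; simpc. Qed.

(** The integrands of the Taylor coefficients of a Laplace transform. *)
Definition taylor_kernel z k (s : R) : R[i] :=
  cexp (- (s%:C * z)) * ((- s) ^+ k / k`!%:R)%:C.

Lemma cn_taylor_kernel z k s : 0 <= s ->
  cn (taylor_kernel z k s) = expR (- (s * complex.Re z)) * (s ^+ k / k`!%:R).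
Proof.
move=> s0; rewrite /taylor_kernel cnM cn_cexp cn_real; congr (_ * _).
  by congr expR; case: z => a b /=; ring.
by rewrite normrM normrX normrN ger0_norm // ger0_norm ?invr_ge0.
Qed.

Lemma bmc_taylor_kernel z k : 0 < complex.Re z -> bmc (taylor_kernel z k).
Proof.
move=> z0; pose r := complex.Re z.
have rk : 0 < r ^+ k by rewrite exprn_gt0.
have bd s : 0 <= s -> cn (taylor_kernel z k s) <= (r ^+ k)^-1.
  move=> s0; rewrite cn_taylor_kernel // -(ler_pM2r rk) mulVf ?gt_eqF //.
  have := @pois_le1 R (s * r) k (mulr_ge0 s0 (ltW z0)).
  rewrite /pois exprMn -/r => h; apply: le_trans h; rewrite le_eqVlt; apply/orP; left.
  by apply/eqP; ring.
have cl (a : R) : continuous (fun s : R => - (s * a)).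
  by move=> s; apply: cvgN; apply: cvgMl; exact: cvg_id.
have ce : continuous (fun s : R => expR (- (s * r))).
  by move=> s; apply: (@continuous_comp R R R (fun s => - (s * r)) expR); [exact: cl|exact: continuous_expR].
have cp : continuous (fun s : R => (- s) ^+ k / k`!%:R).
  move=> s; apply: cvgMl.
  apply: (@continuous_comp R R R (fun s => - s) (fun x => x ^+ k)); last exact: exprn_continuous.
  by apply: cvgN; exact: cvg_id.
have cc : continuous (fun s : R => cos (- (s * complex.Im z))).
  by move=> s; apply: (@continuous_comp R R R (fun s => - (s * complex.Im z)) cos); [exact: cl|exact: continuous_cos].
have cs : continuous (fun s : R => sin (- (s * complex.Im z))).
  by move=> s; apply: (@continuous_comp R R R (fun s => - (s * complex.Im z)) sin); [exact: cl|exact: continuous_sin].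
split.
  apply: (bm_continuous (B := (r ^+ k)^-1)) => [s|s s0]; last exact: le_trans (cn_Re _) (bd s s0).
  rewrite /taylor_kernel (_ : (fun s => _) = fun s => expR (- (s * r)) * cos (- (s * complex.Im z)) *
    ((- s) ^+ k / k`!%:R)).
    by apply: cvgM; [apply: cvgM; [exact: ce|exact: cc]|exact: cp].
  by apply/funext => u; rewrite cexp_kernel ReM /= mulr0 subr0.
apply: (bm_continuous (B := (r ^+ k)^-1)) => [s|s s0]; last exact: le_trans (cn_Im _) (bd s s0).
rewrite /taylor_kernel (_ : (fun s => _) = fun s => expR (- (s * r)) * sin (- (s * complex.Im z)) *
  ((- s) ^+ k / k`!%:R)).
  by apply: cvgM; [apply: cvgM; [exact: ce|exact: cs]|exact: cp].
by apply/funext => u; rewrite cexp_kernel ImM /= mulr0 add0r.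
Qed.

Definition cLap p z : R[i] := cintegral p (fun s => cexp (- (s%:C * z))).

Lemma taylor_kernel0 z s : taylor_kernel z 0 s = cexp (- (s%:C * z)).
Proof. by rewrite /taylor_kernel expr0 fact0 divr1 mulr1. Qed.

(** The factor [exp (- s (z - z0))] is expanded under the integral. The coefficients
    satisfy a Cauchy bound for the radius [Re z0], since
    [s ^+ k * exp (- s * Re z0) * (Re z0) ^+ k / k!] is a Poisson weight. *)
Lemma cLap_ana p z0 : 0 < complex.Re z0 -> ana (cLap p) z0.
Proof.
move=> z00; pose r := complex.Re z0; pose u := taylor_kernel z0.
have bu k : bmc (u k) by exact: bmc_taylor_kernel.
exists (fun k => cintegral p (u k)), r, (2 * mass p); split=> //.
  move=> k; have rk : 0 < r ^+ k by rewrite exprn_gt0.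
  have bd s : 0 <= s -> cn (u k s) <= (r ^+ k)^-1.
    move=> s0; rewrite cn_taylor_kernel // -(ler_pM2r rk) mulVf ?gt_eqF //.
    have := @pois_le1 R (s * r) k (mulr_ge0 s0 (ltW z00)).
    rewrite /pois exprMn -/r => h; apply: le_trans h; rewrite le_eqVlt; apply/orP; left.
    by apply/eqP; ring.
  have I (f : R -> R) : bm f -> (forall s, 0 <= s -> `|f s| <= (r ^+ k)^-1) ->
      `|Iplus p f| <= (r ^+ k)^-1 * mass p.
    move=> bf hf; rewrite -Iplus_cst ler_norml -mulN1r -IplusZ; last exact: bm_cst.
    apply/andP; split; apply: Iplus_le => //; try exact: bm_cst.
    - by move=> s s0; have := hf s s0; rewrite ler_norml mulN1r => /andP[].
    - by move=> s s0; have := hf s s0; rewrite ler_norml => /andP[].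
  rewrite -ler_pdivlMr //.
  apply: le_trans (cn_le _) _; rewrite cintegralE /=.
  have -> : 2 * mass p / r ^+ k = (r ^+ k)^-1 * mass p + (r ^+ k)^-1 * mass p by ring.
  apply: lerD; apply: I; try by have [] := bu k.
  - by move=> s s0; exact: le_trans (cn_Re _) (bd s s0).
  - by move=> s s0; exact: le_trans (cn_Im _) (bd s s0).
move=> z hz; pose w := z - z0.
rewrite (_ : (fun K => _) = fun K => cintegral p (fun s => \sum_(k < K) u k s * w ^+ k)).
  have zz : 0 < complex.Re z.
    have := le_lt_trans (cn_Re w) hz; rewrite ltr_norml /w ReB -/r => /andP[h1 _]; lra.
  have uE K s : \sum_(k < K) u k s * w ^+ k = cexp (- (s%:C * z0)) * esum (- (s%:C * w)) K.
    rewrite /esum mulr_sumr; apply: eq_bigr => k _; rewrite /u /taylor_kernel -!mulrA.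
    congr (_ * _); have -> : - (s%:C * w) = (- s)%:C * w by rewrite rmorphN mulNr.
    by rewrite exprMn rmorphM rmorphXn /= fact_real mulrAC.
  apply: (@cintegral_dct _ _ _ 1).
  - by move=> n; apply: (@bmc_sum n (fun k s => u k s * w ^+ k)) => k; exact: bmcM.
  - have := @bmc_taylor_kernel z 0%N zz.
    by rewrite (_ : taylor_kernel z 0 = fun s => cexp (- (s%:C * z))) //;
      apply/funext => s; rewrite taylor_kernel0.
  - move=> n s s0; rewrite uE cnM cn_cexp.
    apply: le_trans (ler_wpM2l (expR_ge0 _) (esum_le _ _)) _.
    rewrite -expRD -[leRHS]expR0 ler_expR cnN cnM cn_real ger0_norm //.
    have -> : complex.Re (- (s%:C * z0)) = - (s * r) by rewrite /r; case: (z0) => a b /=; ring.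
    by rewrite addrC subr_le0 ler_wpM2l // ltW.
  - move=> s s0; rewrite (_ : (fun n => _) = fun n => cexp (- (s%:C * z0)) * esum (- (s%:C * w)) n).
      have -> : cexp (- (s%:C * z)) = cexp (- (s%:C * z0)) * cexp (- (s%:C * w)).
        by rewrite -cexpD; congr cexp; rewrite /w; ring.
      by apply: cvg_cnM; [exact: cvg_cst|exact: esum_cvg].
    by apply/funext => n; rewrite uE.
apply/funext => K; rewrite -(@cintegral_sum p K (fun k s => u k s * w ^+ k)); last by move=> k; exact: bmcM.
by apply: eq_bigr => k _; rewrite cintegralM.
Qed.

Lemma cLap_real p (x : R) : cLap p x%:C = (Lap p x)%:C.
Proof.
rewrite /cLap cintegralE; congr (_ +i* _).
  by apply: Iplus_eq => s _; rewrite cexp_kernel /= mulr0 oppr0 cos0 mulr1.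
rewrite -[RHS](mul0r (mass p)) -Iplus_cst; apply: Iplus_eq => s _.
by rewrite cexp_kernel /= mulr0 oppr0 sin0 mulr0.
Qed.

Definition chLap (nu : {charge set (measurableTypeR R) -> \bar R}) (x : R) : R :=
  Lap (pos_part nu) x - Lap (neg_part nu) x.

Lemma laplace_ana (mu : cmeasure R) z0 : Cplus z0 -> ana (laplace mu) z0.
Proof.
move=> z00; pose c nu z := cLap (pos_part nu) z - cLap (neg_part nu) z.
have ac nu : ana (c nu) z0 by apply: anaB; exact: cLap_ana.
have := anaB (ac (cm_re mu)) (anaZ (- (0 +i* 1)) (ac (cm_im mu))).
rewrite (_ : (fun z => _) = laplace mu) //.
by apply/funext => z; rewrite mulNr opprK.
Qed.

Lemma laplace_real (mu : cmeasure R) (x : R) :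
  laplace mu x%:C = chLap (cm_re mu) x +i* chLap (cm_im mu) x.
Proof.
rewrite /laplace /charge_cintegral -!/(cLap _ _) !cLap_real -!rmorphB.
by rewrite /chLap; simpc.
Qed.

Lemma jordan_difference (nu : {charge set (measurableTypeR R) -> \bar R}) A :
  measurable A -> nu A = (pos_part nu A - neg_part nu A)%E.
Proof.
move=> mA; rewrite /pos_part /neg_part.
move: (svalP (cid (svalP (cid (Hahn_decomposition nu))))) => H.
rewrite (jordan_decomp H mA) /cadd /= cscaleN1 /=.
by [].
Qed.

(** The Jordan parts of [p - q] differ from [p] and [q] by a common summand. *)
Lemma chLap_diff (nu : {charge set (measurableTypeR R) -> \bar R}) (p q : finmeas R) :
  (forall A, measurable A -> nu A = (p A - q A)%E) ->
  forall x, 0 <= x -> chLap nu x = Lap p x - Lap q x.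
Proof.
move=> nuE x x0.
suff : Lap (pos_part nu) x + Lap q x = Lap p x + Lap (neg_part nu) x.
  by rewrite /chLap; lra.
have bx := bm_exp x0.
have bi (r : finmeas R) := bm_integrable r bx.
apply: EFin_inj; rewrite !EFinD -!Lap_EFin //.
rewrite -[LHS](integral_measure_add measurable_Rplus (bi _) (bi _)).
rewrite -[RHS](integral_measure_add measurable_Rplus (bi _) (bi _)).
apply: eq_measure_integral => A mA AR.
have fin (r : finmeas R) : r A \is a fin_num by exact: fin_num_measure.
have jd : nu A = (pos_part nu A - neg_part nu A)%E.
  exact: jordan_difference.
have e : (pos_part nu A - neg_part nu A = p A - q A)%E by rewrite -jd nuE.
transitivity (pos_part nu A + q A)%E; first by exact: measure_addE.
transitivity (p A + neg_part nu A)%E; last by apply: esym; exact: measure_addE.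
move: e; rewrite -(fineK (fin p)) -(fineK (fin q)) -(fineK (fin (pos_part nu))) -(fineK (fin (neg_part nu))).
by rewrite -!EFinB -!EFinD => h; have {}h := EFin_inj h; congr (_%:E); lra.
Qed.

Lemma charge_exists (p q : finmeas R) :
  exists nu : {charge set (measurableTypeR R) -> \bar R},
    forall x, 0 <= x -> chLap nu x = Lap p x - Lap q x.
Proof.
exists (cadd (charge_of_finite_measure p) (copp (charge_of_finite_measure q))).
exact: chLap_diff.
Qed.

End ComplexLaplace.

(** * The extended calculus *)

Section ExtendedCalculus.
Context {R : realType} {X : completeNormedModType R[i]}.
Variables (T : R -> {linear X -> X}) (A : operator X) (M : R).
Hypothesis hT : C0_semigroup T.
Hypothesis hA : forall x y, op_opp A x y <-> generator T x y.
Hypothesis M0 : 0 <= M.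
Hypothesis TM : forall t x, 0 <= t -> rnorm (T t x) <= M * rnorm x.
Implicit Types (x y : X) (u v : X -> X) (phi f : R -> R) (F : R[i] -> R[i]).
Implicit Types (a b : {charge set (measurableTypeR R) -> \bar R}) (m mu nu : cmeasure R).
Local Notation rep := (rep T).

Definition hpch a x : X := hpint T (pos_part a) x - hpint T (neg_part a) x.

Definition hp m x : X := hpch (cm_re m) x + (0 +i* 1) *: hpch (cm_im m) x.

Lemma rep_hpch a : rep (chLap a) (hpch a).
Proof. by exists (pos_part a), (neg_part a). Qed.

Lemma charge_bochnerP a x y : charge_bochner a (fun s => T s x) y <-> y = hpch a x.
Proof.
split=> [[yp [yn [/(hpintP hT TM) -> /(hpintP hT TM) -> ->]]] //|->].
by exists (hpint T (pos_part a) x), (hpint T (neg_part a) x); split=> //; exact/(hpintP hT TM).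
Qed.

Lemma hille_phillipsP m x y : hille_phillips T m x y <-> y = hp m x.
Proof.
split=> [[yr [yi [/charge_bochnerP -> /charge_bochnerP -> ->]]] //|->].
exists (hpch (cm_re m) x), (hpch (cm_im m) x).
by split=> //; exact/charge_bochnerP.
Qed.

(** On the positive half-line the real and imaginary parts of the transforms are
    the transforms of the signed measures, and [f] is real, so that [rep_unique]
    applies to each part. *)
Lemma hp_intertwine mu nu F f phi u v :
  (forall z, Cplus z -> laplace nu z = laplace mu z * F z) ->
  (forall z : R, 0 < z -> F z%:C = (f z)%:C) ->
  rep phi u -> rep (fun z => f z * phi z) v ->
  forall x, hp nu (u x) = hp mu (v x).
Proof.
move=> hL hF hu hv x.
have e z : 0 < z -> chLap (cm_re nu) z = chLap (cm_re mu) z * f z /\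
    chLap (cm_im nu) z = chLap (cm_im mu) z * f z.
  move=> z0; have := hL z%:C; rewrite /Cplus /= => /(_ z0).
  rewrite hF // !laplace_real; simpc => -[-> ->].
  by split; ring.
have part a b :
    (forall z, 0 < z -> chLap b z = chLap a z * f z) -> hpch b (u x) = hpch a (v x).
  move=> hab; apply: (rep_unique hT M0 TM (repM hT M0 TM (rep_hpch b) hu)
    (repM hT M0 TM (rep_hpch a) hv)) => z z0.
  by rewrite hab // mulrA.
by rewrite /hp (part (cm_re mu)) ?(part (cm_im mu)) // => z /e[].
Qed.

Lemma hp_comm m phi u x : rep phi u -> u (hp m x) = hp m (u x).
Proof.
move=> hu; have e1 := rep_comm hT M0 TM hu (rep_hpch (cm_re m)) x.
have e2 := rep_comm hT M0 TM hu (rep_hpch (cm_im m)) x.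
have L := rep_linear hT M0 TM hu (0 +i* 1) (hpch (cm_im m) x) (hpch (cm_re m) x).
by rewrite /hp -e1 -e2 [RHS]addrC -L addrC.
Qed.

Lemma functional_calculusP F x y : functional_calculus T F x y <->
  exists mu nu, regularizes T F mu nu /\ hp nu x = hp mu y.
Proof.
split=> [[mu [nu [hr [w /hille_phillipsP hn /hille_phillipsP hm]]]]|[mu [nu [hr e]]]].
  by exists mu, nu; rewrite -hn.
by exists mu, nu; split=> //; exists (hp nu x); [exact/hille_phillipsP|rewrite e; exact/hille_phillipsP].
Qed.

(** Injectivity of the regularizer cancels it from [hp_intertwine]. *)
Lemma functional_calculus_value F f phi u v x y :
  (forall z : R, 0 < z -> F z%:C = (f z)%:C) ->
  rep phi u -> rep (fun z => f z * phi z) v ->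
  functional_calculus T F (u x) y -> y = v x.
Proof.
move=> hF hu hv /functional_calculusP [mu [nu [[_ hL inj] e]]].
have h1 : hille_phillips T mu y (hp mu y) := (hille_phillipsP mu y _).2 erefl.
have h2 := (hille_phillipsP mu (v x) _).2 (erefl (hp mu (v x))).
have h := hp_intertwine hL hF hu hv x; rewrite e in h.
by rewrite -h in h2; exact: inj h1 h2.
Qed.

Lemma functional_calculus_comm F f phi u v x y :
  (forall z : R, 0 < z -> F z%:C = (f z)%:C) ->
  rep phi u -> rep (fun z => f z * phi z) v ->
  functional_calculus T F x y -> u y = v x.
Proof.
move=> hF hu hv /functional_calculusP [mu [nu [[_ hL inj] e]]].
have h1 := (hille_phillipsP mu (u y) _).2 (erefl (hp mu (u y))).
have h2 := (hille_phillipsP mu (v x) _).2 (erefl (hp mu (v x))).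
have h := hp_intertwine hL hF hu hv x; rewrite -(hp_comm nu x hu) e (hp_comm mu y hu) in h.
by rewrite -h in h2; exact: inj h1 h2.
Qed.

Lemma lap_cmeasure V phi : lap V phi -> exists m : cmeasure R,
  forall x : R, 0 < x -> laplace m x%:C = (phi x)%:C.
Proof.
move=> [p [q [_ h]]].
have [a ha] := charge_exists p q; have [b hb] := charge_exists p p.
exists (CMeasure a b) => x x0; rewrite laplace_real /= ha ?ltW // hb ?ltW //.
by rewrite subrr h.
Qed.

(** The regularizer is [(z / (1 + z)) ^+ 2]. The measures are built from the values on
    the positive half-line; that their transforms agree on the right half-plane is
    the identity theorem, [F] being analytic there. *)
Lemma stieltjes_regularizes f F : closure (op_ran A) = setT ->
  stieltjes 2 f -> analytic_extension f F -> exists mu nu, regularizes T F mu nu.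
Proof.
move=> dense sf [aF FE].
have [V le] := @lap_regularizer R; have [W lef] := lap_stieltjes_regularized sf.
have [mu hmu] := lap_cmeasure le; have [nu hnu] := lap_cmeasure lef.
have aFz z : Cplus z -> ana F z.
  move=> zp; apply: (analytic_on_ana aF); rewrite /slit_plane /= => -[_].
  by move: zp; rewrite /Cplus /= => h /(lt_le_trans h); rewrite ltxx.
exists mu, nu; split.
- by move=> z /aFz; exact: ana_derivable.
- pose h z := laplace nu z - laplace mu z * F z.
  have ah z : Cplus z -> ana h z.
    move=> zp; have am := laplace_ana mu zp; have an := laplace_ana nu zp.
    exact: anaB an (anaM am (aFz z zp)).
  have rh (x : R) : 0 < x -> h x%:C = 0.
    by move=> x0; rewrite /h (hnu x x0) (hmu x x0) (FE x x0) rmorphM subrr.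
  by move=> z zp; have := identity_Cplus ah rh zp; rewrite /h => /subr0_eq.
have hre z : 0 < z -> chLap (cm_re mu) z = (z / (1 + z)) ^+ 2 /\ chLap (cm_im mu) z = 0.
  by move=> z0; have := hmu z z0; rewrite laplace_real => -[].
have im0 x : hpch (cm_im mu) x = 0.
  have [u [hu uB]] := lap_rep hT M0 TM (lap_cst (0 : R)).
  rewrite (rep_unique hT M0 TM (rep_hpch _) hu); last by move=> z /hre[].
  by apply: rnorm_eq0; apply/eqP; rewrite eq_le rnorm_ge0 andbT (le_trans (uB x)) // normr0 mulr0 mul0r.
have hpE x : hp mu x = hpch (cm_re mu) x by rewrite /hp im0 scaler0 addr0.
have hu : rep (fun z => (z / (1 + z)) ^+ 2) (hpch (cm_re mu)) :=
  rep_ext (rep_hpch (cm_re mu)) (fun z z0 => esym (hre z z0).1) (fun x => erefl).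
move=> x1 x2 y /hille_phillipsP h1 /hille_phillipsP h2; rewrite hpE in h1; rewrite hpE in h2.
exact: (regularizer_injective hT hA M0 TM dense hu) (etrans (esym h1) h2).
Qed.

Lemma functional_calculus_dom f F phi u v x : closure (op_ran A) = setT ->
  stieltjes 2 f -> analytic_extension f F ->
  rep phi u -> rep (fun z => f z * phi z) v -> functional_calculus T F (u x) (v x).
Proof.
move=> dense sf aF hu hv; apply/functional_calculusP.
have [mu [nu hr]] := stieltjes_regularizes dense sf aF; exists mu, nu; split=> //.
by case: hr => _ hL _; apply: (hp_intertwine hL _ hu hv); case: aF.
Qed.

End ExtendedCalculus.

(** * Negative powers as Stieltjes functions *)

Section Powers.
Context {R : realType}.
Local Notation RR := (measurableTypeR R).
Local Notation mu := (@lebesgue_measure R).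
Implicit Types alpha z : R.

(** The integrand [tau `^ (1 - alpha) / (1 + tau) ^+ 2] of a beta integral, in the
    logarithmic coordinate [tau = expR v]. *)
Definition beta_kernel alpha (v : R) : R := expR ((2 - alpha) * v) * (1 + expR v) ^- 2.

Lemma beta_kernel_ge0 alpha v : 0 <= beta_kernel alpha v.
Proof. by rewrite mulr_ge0 ?expR_ge0 // invr_ge0 exprn_ge0 // addr_ge0 ?expR_ge0. Qed.

Lemma continuous_beta_kernel alpha : continuous (beta_kernel alpha).
Proof.
move=> v; apply: cvgM.
  apply: (@continuous_comp _ _ _ (fun v : R => (2 - alpha) * v) expR); last exact: continuous_expR.
  exact: mulrl_continuous.
apply: cvgV; first by rewrite gt_eqF // exprn_gt0 // addr_gt0 ?expR_gt0.
apply: (@continuous_comp _ _ _ (fun v : R => 1 + expR v) (fun u => u ^+ 2)); last exact: exprn_continuous.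
by apply: cvgD; [exact: cvg_cst|exact: continuous_expR].
Qed.

Lemma measurable_beta_kernel alpha : measurable_fun setT (beta_kernel alpha : RR -> R).
Proof. by apply: continuous_measurable_fun; exact: continuous_beta_kernel. Qed.

Lemma beta_kernel_le alpha v : 0 < alpha < 2 ->
  beta_kernel alpha v <= expR (- (`|v| * Num.min alpha (2 - alpha))).
Proof.
move=> /andP[a0 a2]; set c := Num.min _ _.
have c1 : c <= alpha by rewrite ge_min lexx.
have c2 : c <= 2 - alpha by rewrite ge_min lexx orbT.
have s1 : 0 < 1 + expR v by rewrite addr_gt0 ?expR_gt0.
rewrite /beta_kernel ler_pdivrMr ?exprn_gt0 //.
have e : expR v ^+ 2 = expR (2 * v) by rewrite -expRM_natl.
have h1 : 1 <= (1 + expR v) ^+ 2 by rewrite expr2 -{1}(mulr1 1) ler_pM // lerDl expR_ge0.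
have h2 : expR (2 * v) <= (1 + expR v) ^+ 2.
  by rewrite -e; apply: lerXn2r; rewrite ?nnegrE ?expR_ge0 ?(ltW s1) // lerDr.
have [v0|v0] := leP 0 v.
  apply: le_trans (ler_wpM2l (expR_ge0 _) h2); rewrite -expRD ler_expR ger0_norm //.
  by have := ler_wpM2l v0 c1; lra.
apply: le_trans (ler_wpM2l (expR_ge0 _) h1); rewrite mulr1 ler_expR ltr0_norm //.
have nv : 0 <= - v by rewrite oppr_ge0 ltW.
by have := ler_wpM2l nv c2; lra.
Qed.

Lemma integral_beta_kernel alpha : 0 < alpha < 2 ->
  exists2 c : R, 0 < c & (\int[mu]_v (beta_kernel alpha v)%:E = c%:E)%E.
Proof.
move=> ha; have /andP[a0 a2] := ha.
have mk : measurable_fun setT (EFin \o (beta_kernel alpha : RR -> R)).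
  by apply/measurable_EFinP; exact: measurable_beta_kernel.
set c := Num.min alpha (2 - alpha).
have c0 : 0 < c by rewrite lt_min a0 subr_gt0.
have ce : continuous (fun v : R => expR (- (`|v| * c))).
  move=> v; apply: (@continuous_comp _ _ _ (fun v : R => - (`|v| * c)) expR); last exact: continuous_expR.
  by apply: cvgN; apply: cvgMl; exact: norm_continuous.
have up : (\int[mu]_v (beta_kernel alpha v)%:E < +oo)%E.
  apply: (@le_lt_trans _ _ (\int[mu]_v (expR (- (`|v| * c)))%:E)%E).
    apply: ge0_le_integral => //.
    - by move=> v _; rewrite lee_fin beta_kernel_ge0.
    - by apply/measurable_EFinP; apply: continuous_measurable_fun.
    - by move=> v _; rewrite lee_fin; exact: beta_kernel_le.
  rewrite ge0_symfun_integralT; last 3 first.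
  - by move=> v; exact: expR_ge0.
  - exact: ce.
  - by move=> v /=; rewrite normrN.
  rewrite [X in (_ * X)%E](_ : _ = (c^-1)%:E) -?EFinM ?ltry // -(integral_exp_half_line c0).
  rewrite (_ : `[0%R, +oo[%classic = [set x : R | 0 <= x]); last first.
    by apply/seteqP; split=> x /=; rewrite in_itv /= andbT.
  by apply: eq_integral => x; rewrite inE /= => x0; rewrite ger0_norm.
pose l : R := (1 + expR 1) ^- 2.
have l0 : 0 < l by rewrite invr_gt0 exprn_gt0 // addr_gt0 ?expR_gt0.
have m01 : measurable (`[0%R, 1%R]%classic : set RR) by exact: measurable_itv.
have low : (l%:E <= \int[mu]_v (beta_kernel alpha v)%:E)%E.
  apply: (@le_trans _ _ (\int[mu]_(v in `[0%R, 1%R]) (beta_kernel alpha v)%:E)%E); last first.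
    apply: ge0_subset_integral => //.
    by move=> v _; rewrite lee_fin beta_kernel_ge0.
  apply: (@le_trans _ _ (\int[mu]_(v in `[0%R, 1%R]) (cst l%:E v))%E).
    rewrite integral_cst //= lebesgue_measure_itv /= lte_fin ltr01.
    by rewrite -EFinB subr0 mule1; exact: lexx.
  apply: ge0_le_integral => //.
  - by move=> v _; rewrite lee_fin ltW.
  - exact: measurable_funTS.
  move=> v; rewrite /= in_itv /= lee_fin => /andP[v0 v1].
  rewrite -[l]mul1r /beta_kernel; apply: ler_pM => //; first exact: ltW.
    by rewrite -[leLHS]expR0 ler_expR mulr_ge0 // subr_ge0 ltW.
  rewrite lef_pV2 ?posrE ?exprn_gt0 ?addr_gt0 ?expR_gt0 //.
  by apply: lerXn2r; rewrite ?nnegrE ?addr_ge0 ?expR_ge0 // lerD2l ler_expR.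
exists (fine (\int[mu]_v (beta_kernel alpha v)%:E)%E).
  by rewrite -lte_fin fineK ?ge0_fin_numE // ?(le_trans _ low) ?(lt_le_trans _ low) ?lee_fin ?lte_fin // ltW.
by rewrite fineK // ge0_fin_numE // (le_trans _ low) // lee_fin ltW.
Qed.

Lemma integral_shift (G : R -> R) (w : R) : continuous G -> (forall x, 0 <= G x) ->
  (\int[mu]_v (G v)%:E = \int[mu]_v (G (v + w))%:E)%E.
Proof.
move=> cG G0.
have D : derive1 (fun v : R => v + w) = cst 1.
  by apply/funext => v; rewrite derive1E deriveD // derive_id derive_cst addr0.
rewrite (@increasing_ge0_integration_by_substitutionT R (fun v => v + w)) //.
- by apply: eq_integral => v _; rewrite D !fctE mulr1.
- by move=> x y xy; rewrite ltrD2r.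
- by rewrite D => ?; exact: cvg_cst.
- by rewrite D; exact: is_cvg_cst.
- by rewrite D; exact: is_cvg_cst.
- exact: cvg_addrr_Ny.
- exact: cvg_addrr.
Qed.

(** Up to a constant factor, the measure is [tau `^ (1 - alpha)] times Lebesgue measure
    for [alpha < 2]: the dilation by [z] becomes a translation by [ln z] in the
    logarithmic coordinate, and homogeneity yields the power. For [alpha = 2] it is
    the unit mass at the origin. *)
Lemma stieltjes_power alpha : 0 < alpha <= 2 -> stieltjes 2 (fun z => z `^ (- alpha)).
Proof.
move=> /andP[a0]; rewrite le_eqVlt => /predU1P[->|a2].
  have mz z : measurable_fun (@Rplus R : set RR) (fun s => ((z + s) `^ (- 2))%:E).
    apply/measurable_EFinP; apply: measurable_funTS.
    by apply: (measurableT_comp (measurable_powR _)); exact: measurable_funD.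
  have I z : (\int[\d_ (0%R : RR)]_(s in @Rplus R) ((z + s) `^ (- 2))%:E = (z `^ (- 2))%:E)%E.
    rewrite integral_dirac //=; last exact: measurable_Rplus.
    by rewrite diracE mem_set ?mul1e ?addr0 //= /Rplus /=.
  exists 0, (\d_ (0%R : RR)); split=> //; first by rewrite I ltry.
  by move=> z z0; rewrite I add0e.
have ha : 0 < alpha < 2 by rewrite a0.
have [c c0 hc] := integral_beta_kernel ha.
pose W (v : R) := c^-1 * expR ((2 - alpha) * v).
have mW : measurable_fun setT (W : RR -> R).
  apply: measurable_funM => //.
  by apply: (measurableT_comp (@measurable_expR R)); exact: mulrl_measurable.
have W0 v : 0 <= W v by rewrite mulr_ge0 ?expR_ge0 // invr_ge0 ltW.
have [q hq] := push_measure mu (measurableT : measurable [set: RR]) mW (@measurable_expR R)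
  W0 (fun v _ => expR_ge0 v).
have qE z : 0 < z -> (\int[q]_(s in @Rplus R) ((z + s) `^ (- 2))%:E = (z `^ (- alpha))%:E)%E.
  move=> z0; rewrite hq; last 2 first.
  - by move=> s; exact: powR_ge0.
  - by apply: (measurableT_comp (measurable_powR _)); exact: measurable_funD.
  pose G v := z `^ (- alpha) * (c^-1 * beta_kernel alpha (v - ln z)).
  transitivity (\int[mu]_v (G v)%:E)%E.
    apply: eq_integral => v _; congr (_%:E); rewrite /G /W /beta_kernel.
    have ez : expR (ln z) = z by rewrite lnK.
    rewrite powRN2 ?addr_gt0 ?expR_gt0 //.
    have -> : z `^ (- alpha) = expR (- (alpha * ln z)).
      by rewrite /powR gt_eqF // mulNr.
    have -> : (2 - alpha) * (v - ln z) = (2 - alpha) * v + alpha * ln z - 2%:R * ln z.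
      by ring.
    have -> : expR (v - ln z) = expR v / z by rewrite expRD expRN ez.
    rewrite !expRD !expRN expRM_natl ez.
    have s1 : 0 < z + expR v by rewrite addr_gt0 ?expR_gt0.
    field; rewrite !gt_eqF ?expR_gt0 //=.
  rewrite (@integral_shift G (ln z)).
  - transitivity (\int[mu]_v ((z `^ (- alpha) * c^-1)%:E * (beta_kernel alpha v)%:E))%E.
      by apply: eq_integral => v _; rewrite -EFinM /G addrK mulrA.
    rewrite ge0_integralZl //=.
    + by rewrite hc -EFinM mulfVK // gt_eqF.
    + by apply/measurable_EFinP; exact: measurable_beta_kernel.
    + by move=> v _; rewrite lee_fin beta_kernel_ge0.
    + by rewrite lee_fin mulr_ge0 ?powR_ge0 // invr_ge0 ltW.
  - move=> v; apply: cvgMr; apply: cvgMr.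
    apply: (@continuous_comp _ _ _ (fun v => v - ln z)); last exact: continuous_beta_kernel.
    by apply: cvgD; [exact: cvg_id|exact: cvg_cst].
  - by move=> v; rewrite mulr_ge0 ?powR_ge0 // mulr_ge0 ?beta_kernel_ge0 // invr_ge0 ltW.
by exists 0, q; split=> // [|z z0]; rewrite ?qE ?ltry ?add0e.
Qed.

End Powers.

(** * The rate of convergence *)

Section SemigroupBound.
Context {R : realType} {X : completeNormedModType R[i]}.
Variables (T : R -> {linear X -> X}) (M : R).
Hypothesis hM : semigroup_sup T = M%:E.

Lemma semigroup_sup_ge0 : 0 <= M.
Proof.
rewrite -lee_fin -hM; apply: (@le_trans _ _ (opnorm (T 0))); last first.
  by apply: ereal_sup_ubound; exists 0 => //=.
by apply: ereal_sup_ubound; exists 0; rewrite /= ?linear0 ?rnorm0.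
Qed.

Lemma semigroup_sup_bound t x : 0 <= t -> rnorm (T t x) <= M * rnorm x.
Proof.
move=> t0; have [x0|x0] := eqVneq (rnorm x) 0.
  by rewrite (rnorm_eq0 x0) linear0 rnorm0 mulr0.
have xp : 0 < rnorm x by rewrite lt_def x0 rnorm_ge0.
have : ((rnorm (T t ((rnorm x)^-1%:C *: x)))%:E <= M%:E)%E.
  rewrite -hM; apply: (@le_trans _ _ (opnorm (T t))); last first.
    by apply: ereal_sup_ubound; exists t.
  apply: ereal_sup_ubound; exists ((rnorm x)^-1%:C *: x) => //=.
  by rewrite rnormZr ger0_norm ?invr_ge0 ?rnorm_ge0 // mulVf.
rewrite lee_fin linearZ /= rnormZr ger0_norm ?invr_ge0 ?rnorm_ge0 //.
by rewrite mulrC ler_pdivrMr.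
Qed.

End SemigroupBound.

Section PrincipalPowers.
Context {R : realType}.

Lemma cpow_real (alpha z : R) : 0 < z -> cpow alpha z%:C = (z `^ alpha)%:C.
Proof.
move=> z0; rewrite /cpow /clog normc_def /= expr0n addr0 sqrtr_sqr gtr0_norm // mul0r atan0.
rewrite (_ : alpha%:C * _ = (alpha * ln z)%:C); last by simpc.
by rewrite /cexp /= cos0 sin0 mulr1 /powR gt_eqF.
Qed.

End PrincipalPowers.

Section EulerEstimates.
Context {R : realType} {X : completeNormedModType R[i]}.
Variables (T : R -> {linear X -> X}) (A : operator X) (M : R).
Hypothesis hT : C0_semigroup T.
Hypothesis hA : forall x y, op_opp A x y <-> generator T x y.
Hypothesis M0 : 0 <= M.
Hypothesis TM : forall t x, 0 <= t -> rnorm (T t x) <= M * rnorm x.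
Variables (f : R -> R) (n : nat) (t : R).
Hypotheses (sf : stieltjes 2 f) (n0 : (0 < n)%N) (t0 : 0 < t).

(** [K] is [f(A)] composed with [Delta]: all three estimates are bounds for its norm. *)
Lemma stieltjes_Delta : exists (phi : R -> R) (D K : X -> X),
  [/\ rep T phi D, forall x w, Delta T A n t x w <-> w = D x,
      rep T (fun z => f z * phi z) K
    & forall x, rnorm (K x) <= 12 * M * rnorm x * f (Num.sqrt n%:R / t)].
Proof.
have [D [hD DE]] := Delta_rep hT hA M0 TM n0 t0.
have [K [hK KB]] := lap_rep hT M0 TM (lap_stieltjes_delta sf n0 t0).
exists (fun z => (1 + t / n%:R * z)^-1 ^+ n - expR (- (t * z))), D, K; split=> // x.
set c := Num.sqrt n%:R / t.
have c0 : 0 < c by rewrite divr_gt0 // sqrtr_gt0 ltr0n.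
have fc : 0 <= f c.
  have [a [J0 [J1 [a0 J00 J10 fE _]]]] := stieltjes_split sf c0.
  by rewrite fE // !addr_ge0.
apply: le_trans (KB x) _; rewrite -/c -subr_ge0.
have -> : 12 * M * rnorm x * f c - M * (8 * f c) * rnorm x = 4 * (M * rnorm x * f c) by ring.
by rewrite !mulr_ge0 ?rnorm_ge0.
Qed.

End EulerEstimates.

Theorem theorem5p1 (R : realType) (X : completeNormedModType R[i])
    (T : R -> {linear X -> X}) (A : operator X) (M : R)
    (hT : C0_semigroup T)
    (hA : forall x y, op_opp A x y <-> generator T x y)
    (hran : closure (op_ran A) = setT)
    (hM : semigroup_sup T = M%:E) :
  (forall (f : R -> R) (F : R[i] -> R[i]),
     stieltjes 2 f -> analytic_extension f F ->
     (forall (x : X) (n : nat) (t : R), (0 < n)%N -> 0 < t ->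
        op_dom (Delta T A n t) x /\
        forall w : X, Delta T A n t x w ->
          op_dom (functional_calculus T F) w /\
          forall y : X, functional_calculus T F w y ->
            rnorm y <= 12 * M * rnorm x * f (Num.sqrt n%:R / t)) /\
     (forall x y : X, functional_calculus T F y x ->
        forall (n : nat) (t : R), (0 < n)%N -> 0 < t ->
        forall w : X, Delta T A n t x w ->
          rnorm w <= 12 * M * rnorm y * f (Num.sqrt n%:R / t))) /\
  (forall alpha : R, 0 < alpha <= 2 ->
     forall x y : X, functional_calculus T (cpow alpha) x y ->
     forall (n : nat) (t : R), (0 < n)%N -> 0 < t ->
     forall w : X, Delta T A n t x w ->
       rnorm w <= 12 * M * rnorm y * (t / Num.sqrt n%:R) `^ alpha).
Proof.
have M0 := semigroup_sup_ge0 hM.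
have TM (t : R) (x : X) (t0 : 0 <= t) := semigroup_sup_bound hM x t0.
split=> [f F sf aF|alpha ha x y hxy n t n0 t0 w]; last first.
  have [phi [D [K [hD DE hK KB]]]] := stieltjes_Delta hT hA M0 TM (stieltjes_power ha) n0 t0.
  move=> /DE ->.
  have hD' : rep T (fun z => z `^ alpha * (z `^ (- alpha) * phi z)) D.
    apply: (rep_ext hD) => // z z0.
    by rewrite mulrA powRN mulfV ?mul1r // gt_eqF // powR_gt0.
  have e := functional_calculus_comm hT M0 TM (fun z => @cpow_real R alpha z) hK hD' hxy.
  rewrite -e; apply: le_trans (KB y) _.
  have s0 : 0 < Num.sqrt n%:R / t by rewrite divr_gt0 // sqrtr_gt0 ltr0n.
  have -> : t / Num.sqrt n%:R = (Num.sqrt n%:R / t)^-1 by rewrite invf_div.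
  by rewrite /powR invr_eq0 !gt_eqF // lnV ?posrE // mulrN mulNr.
split=> [x n t n0 t0|x y hyx n t n0 t0 w].
  have [phi [D [K [hD DE hK KB]]]] := stieltjes_Delta hT hA M0 TM sf n0 t0.
  split; first by exists (D x); apply/DE.
  move=> w /DE ->; split.
    by exists (K x); exact: (functional_calculus_dom hT hA M0 TM x hran sf aF hD hK).
  move=> y hy; have [_ FE] := aF.
  by rewrite (functional_calculus_value hT M0 TM FE hD hK hy).
have [phi [D [K [hD DE hK KB]]]] := stieltjes_Delta hT hA M0 TM sf n0 t0.
have [_ FE] := aF; move=> /DE ->.
by rewrite (functional_calculus_comm hT M0 TM FE hD hK hyx).
Qed.
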